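(* Let $m\ge 1$ and let $\Omega\subset\subset\mathbb{C}^m$ be a bounded domain with Lipschitz boundary. Suppose that $F:\Omega\to\mathbb{C}^m$ is a holomorphic map and let $V\subset\Omega$ be a nonempty open subset. Then $F$ does not have a dense orbit in $V$; that is, there does not exist a sequence $\{p_n\}_{n\ge 0}\subset\Omega$ such that $F(p_n)=p_{n+1}$ for all $n\ge 0$ and such that $\{p_n\}\cap V$ is dense in $V$.
   Context: A domain is a connected open set, and $\Omega\subset\subset\mathbb{C}^m$ means that $\Omega$ is relatively compact (bounded) in $\mathbb{C}^m$. A domain $\Omega\subset\mathbb{C}^m$ has Lipschitz boundary if near every boundary point, after a holomorphic rotation of coordinates (a unitary change of coordinates, composed with a translation), one can write $\Omega$ locally as $\Omega=\{\operatorname{Im} z_m<r(z_1,\dots,z_{m-1},\operatorname{Re} z_m)\}$, where $r$ is a real-valued function satisfying $|r(x)-r(y)|\le C\|x-y\|$ for some constant $C$. *)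

(* Defs.v *)
From HB Require Import structures.
From mathcomp Require Import all_boot all_order all_algebra complex.
From mathcomp Require Import all_classical all_reals all_analysis.

Set Implicit Arguments.
Unset Strict Implicit.
Unset Printing Implicit Defensive.

Import Order.TTheory GRing.Theory Num.Theory.
Import numFieldNormedType.Exports.

Local Open Scope classical_set_scope.
Local Open Scope ring_scope.
Local Open Scope complex_scope.

(* [R[i]] packed as a [numClosedFieldType]: the library attaches its topology to
   the abstract number structures, not to the bare type [R[i]]. *)
Definition CC (R : realType) : numClosedFieldType := R[i].

Definition domain (T : topologicalType) (A : set T) : Prop :=
  open A /\ connected A.

Definition boundary (T : topologicalType) (A : set T) : set T :=
  closure A `\` A°.

(* [differentiable] is Fréchet differentiability over the scalar field [CC R],
   i.e. the differential is [CC R]-linear.  Only the germs of [F] at points of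
   [Omega] matter, so the values of [F] outside the open set [Omega] are
   junk. *)
Definition holomorphic_on (R : realType) (m n : nat)
    (Omega : set 'rV[CC R]_m.+1)
    (F : 'rV[CC R]_m.+1 -> 'rV[CC R]_n.+1) : Prop :=
  forall z, Omega z -> differentiable F z.

(* Euclidean distance on [C^n x R]; the library's norms on ['rV_n] and on
   products are sup norms. *)
Definition eucl_dist (R : realType) (n : nat) (x y : 'rV[CC R]_n * R) : R :=
  Num.sqrt (\sum_(j < n) (complex.Re (x.1 ord0 j - y.1 ord0 j) ^+ 2 +
                          complex.Im (x.1 ord0 j - y.1 ord0 j) ^+ 2)
            + (x.2 - y.2) ^+ 2).

(* [(w_1, .., w_n, Re w_(n+1))] for [w] in [C^(n+1)]. *)
Definition graph_coord (R : realType) (n : nat) (w : 'rV[CC R]_n.+1) :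
    'rV[CC R]_n * R :=
  (col' ord_max w, complex.Re (w ord0 ord_max)).

(* The new coordinates near the boundary point [p] are [w = z *m U + b], with
   [U] unitary; [r] is taken to be defined on all of [C^n x R]. *)
Definition lipschitz_boundary (R : realType) (n : nat)
    (Omega : set 'rV[CC R]_n.+1) : Prop :=
  forall p, boundary Omega p ->
  exists (U : 'M[CC R]_n.+1) (b : 'rV[CC R]_n.+1)
         (r : 'rV[CC R]_n * R -> R) (C : R),
  [/\ U \is unitarymx,
      forall x y, `|r x - r y| <= C * eucl_dist x y &
      \forall z \near p, Omega z <->
        complex.Im ((z *m U + b) ord0 ord_max) < r (graph_coord (z *m U + b))].

(* The orbit lives in [Omega]: [F] need not map [Omega] to itself. *)
Definition has_dense_orbit (T : topologicalType) (Omega : set T) (F : T -> T)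
    (V : set T) : Prop :=
  exists p : nat -> T,
  [/\ forall n, Omega (p n),
      forall n, F (p n) = p n.+1 &
      V `<=` closure (range p `&` V)].

(* Main.v *)
(** Let p_0 be a point of the orbit in V and B a ball around p_0 inside V.  Every
    iterate F^k extends from the orbit points in B to a holomorphic map Phi_k from
    B to the closure of Omega, with Phi_k(p_j) = p_(j+k).  Indeed, if Phi_k meets
    the boundary of Omega at Phi_k(z0), the Lipschitz condition gives a direction d
    such that Phi_k + s d lies in Omega near z0 for all small s in a sector, and
    F(Phi_k + s d) stays bounded as s tends to 0: it is controlled by its values on
    a circle around z0 that passes through a point sent into Omega, by continuing
    in s the circle averages (Hartogs).

    The Phi_k are bounded by the size of Omega, hence equi-Lipschitz, so that
    (p_j, p_l) |-> p_(j+l) extends to a holomorphic commutative local group law with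
    unit p_0.  The N-th power map p_j |-> p_(N j) is then holomorphic on a ball that
    does not depend on N, bounded by the size of Omega, and its derivative at p_0 is
    N times the identity.  The Cauchy estimate bounds N, a contradiction.

    Cauchy's formula is used as a limit of averages over the 2^k-th roots of unity,
    which avoids integrals. *)

(* [F] lives on [Omega] only and need not map it to itself, so F^(k+1) is not a composition where
   Phi_k touches the boundary. Shifting Phi_k by s d repairs the domain but gives no bound as s
   tends to 0, since on most of the circle the shifted values may approach the boundary. The circle,
   parametrised by |w| = 1, is therefore shifted by the variable amount s + ep (1 - P(w)), with P a
   holomorphic peak function. P(0) = 1, so the centre gets exactly s; away from w = 1 P is tiny, so
   the shift there is about s + ep and stays deep inside however small s is. Near w = 1 the circle
   passes the point sent into Omega, and any small shift is harmless. A sector instead of a ray is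
   needed because P is complex valued and because s has to range over complex discs for the
   continuation.

   The group law itself is never constructed. Its commutativity appears as commutativity of addition
   of indices at orbit points, and powers are compared by exchanging one factor at a time. *)
Require Import Defs.
From HB Require Import structures.
From mathcomp Require Import all_boot all_order all_algebra complex.
From mathcomp Require Import all_classical all_reals all_analysis.
From mathcomp Require Import ring lra zify.

Import Order.TTheory GRing.Theory Num.Theory.
Import numFieldNormedType.Exports.

Local Open Scope classical_set_scope.
Local Open Scope ring_scope.

Set Implicit Arguments.
Unset Strict Implicit.
Unset Printing Implicit Defensive.

(** * Moduli *)

(* The library's norm on a space over [CC R] has values in [CC R]. *)
Definition nm (R : realType) (V : normedZmodType (CC R)) (v : V) : R :=
  complex.Re `|v|.
Arguments nm {R V} v.

Definition rc (R : realType) (x : R) : CC R := (x%:C)%C.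
Arguments rc {R} x.

Section Modulus.
Variables (R : realType).
Local Notation C := (CC R).
Implicit Types (V : normedZmodType C) (T : normedModType C).

Lemma normE V (v : V) : `|v| = rc (nm v) :> C.
Proof.
have : 0 <= `|v| by exact: normr_ge0.
rewrite /rc /nm; case: `|v| => a b; rewrite lecE /= => /andP[/eqP-> _] //.
Qed.

Lemma rc_le (x y : R) : (rc x <= rc y) = (x <= y).
Proof. exact: lecR. Qed.

Lemma rc_lt (x y : R) : (rc x < rc y) = (x < y).
Proof. exact: ltcR. Qed.

Lemma nm_ge0 V (v : V) : 0 <= nm v.
Proof. by rewrite -rc_le -normE normr_ge0. Qed.

Lemma nmN V (v : V) : nm (- v) = nm v.
Proof. by rewrite /nm normrN. Qed.

Lemma nmC V (v w : V) : nm (v - w) = nm (w - v).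
Proof. by rewrite -nmN opprB. Qed.

Lemma rcD (x y : R) : rc (x + y) = rc x + rc y.
Proof. exact: rmorphD. Qed.

Lemma rcN (x : R) : rc (- x) = - rc x.
Proof. exact: rmorphN. Qed.

Lemma rcM (x y : R) : rc (x * y) = rc x * rc y.
Proof. exact: rmorphM. Qed.

Lemma rcV (x : R) : rc (x^-1) = (rc x)^-1.
Proof. exact: fmorphV. Qed.

Lemma rc0 : rc 0 = 0 :> C.
Proof. by []. Qed.

Lemma rc1 : rc 1 = 1 :> C.
Proof. by []. Qed.

Lemma rc_nat k : rc k%:R = k%:R :> C.
Proof. exact: rmorph_nat. Qed.

Lemma nmD V (v w : V) : nm (v + w) <= nm v + nm w.
Proof. by rewrite -rc_le rcD -!normE ler_normD. Qed.

Lemma nmB V (v w : V) : nm (v - w) <= nm v + nm w.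
Proof. by rewrite (le_trans (nmD _ _))// nmN. Qed.

Lemma nm_dist V (u v w : V) : nm (u - w) <= nm (u - v) + nm (v - w).
Proof. by rewrite -(subrKA v u) nmD. Qed.

Lemma nm_leB V (u v : V) : nm u <= nm v + nm (u - v).
Proof. by rewrite -{1}(subrK v u) addrC nmD. Qed.

Lemma nm0 V : nm (0 : V) = 0.
Proof. by rewrite /nm normr0. Qed.

Lemma nm_eq0 V (v : V) : nm v = 0 -> v = 0.
Proof. by move=> v0; apply/eqP; rewrite -normr_eq0 normE v0. Qed.

Lemma nm_gt0 V (v : V) : v != 0 -> 0 < nm v.
Proof.
by move=> v0; rewrite lt_def nm_ge0 andbT; apply: contra v0 => /eqP/nm_eq0->.
Qed.

Lemma nmZ T (c : C) (v : T) : nm (c *: v) = nm c * nm v.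
Proof. by apply: complexI; rewrite -/(rc _) -/(rc _) rcM -!normE normrZ. Qed.

Lemma nmM (c d : C) : nm (c * d) = nm c * nm d.
Proof. by apply: complexI; rewrite -/(rc _) -/(rc _) rcM -!normE normrM. Qed.

Lemma nmV (c : C) : nm c^-1 = (nm c)^-1.
Proof. by apply: complexI; rewrite -/(rc _) -/(rc _) rcV -!normE normfV. Qed.

Lemma nm1 : nm (1 : C) = 1.
Proof. by rewrite /nm normr1. Qed.

Lemma nmX (c : C) k : nm (c ^+ k) = nm c ^+ k.
Proof. by elim: k => [|k IH]; rewrite ?expr0 ?nm1// !exprS nmM IH. Qed.

Lemma nm_rc (x : R) : nm (rc x) = `|x|.
Proof.
by rewrite /nm /rc normc_def /= expr0n /= addr0 sqrtr_sqr.
Qed.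

Lemma nm_rcp (x : R) : 0 <= x -> nm (rc x) = x.
Proof. by move=> x0; rewrite nm_rc ger0_norm. Qed.

Lemma nm_nat k : nm (k%:R : C) = k%:R.
Proof. by rewrite -rc_nat nm_rcp// ler0n. Qed.

Lemma nm_sum V (I : Type) (r : seq I) (P : pred I) (F : I -> V) :
  nm (\sum_(i <- r | P i) F i) <= \sum_(i <- r | P i) nm (F i).
Proof.
elim/big_rec2: _ => [|i x y _ IH]; first by rewrite nm0.
by rewrite (le_trans (nmD _ _))// lerD2l.
Qed.

Lemma nm_Re (c : C) : `|complex.Re c| <= nm c.
Proof.
have := @normc_ge_Re _ c; rewrite -[X in _ <= X]/(`|c : C|) normE.
by rewrite -/(rc _) rc_le.
Qed.

Lemma nm_sqr (c : C) : nm c ^+ 2 = complex.Re c ^+ 2 + complex.Im c ^+ 2.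
Proof.
rewrite /nm [`|c|](@normc_def _ c) /= sqr_sqrtr// addr_ge0// sqr_ge0 //.
Qed.

Lemma nm_Im (c : C) : `|complex.Im c| <= nm c.
Proof.
rewrite -(@ler_pXn2r _ 2)// ?nnegrE ?nm_ge0// nm_sqr real_normK ?num_real//.
by rewrite lerDr sqr_ge0.
Qed.

Lemma nm_ReIm (c : C) : nm c <= `|complex.Re c| + `|complex.Im c|.
Proof.
rewrite -(@ler_pXn2r _ 2)// ?nnegrE ?nm_ge0 ?addr_ge0// nm_sqr.
rewrite sqrrD !real_normK ?num_real// lerD2r lerDl mulrn_wge0// mulr_ge0//.
Qed.

Lemma nbhs_nm T (x : T) (A : set T) :
  nbhs x A <-> exists2 e : R, 0 < e & forall y, nm (y - x) < e -> A y.
Proof.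
split=> [/nbhs_ballP[e /= e0]|[e e0 xA]]; last apply/nbhs_ballP.
  rewrite -ball_normE => xA.
  have eE : e = rc (complex.Re e).
    by move: e0; rewrite ltcE /= /rc; case: e {xA} => a b /= /andP[/eqP-> _].
  exists (complex.Re e) => [|y yx]; first by rewrite -rc_lt -eE.
  by apply: xA; rewrite /= normE eE rc_lt nmC.
exists (rc e) => [/=|y /=]; first by rewrite -rc0 rc_lt.
rewrite -ball_normE /= => yx.
by apply: xA; rewrite -rc_lt -normE distrC.
Qed.

End Modulus.

(** * Limits along an ultrafilter *)

Lemma nonprincipal_ultrafilter :
  exists G : set_system nat, UltraFilter G /\ \oo `<=` G.
Proof. exact: ultraFilterLemma. Qed.

(** A single free ultrafilter serves for all limits, so no subsequence is extracted and limits of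
    different sequences are compatible without a diagonal argument. *)
Definition UU : set_system nat := projT1 (cid nonprincipal_ultrafilter).

#[global] Instance UU_ultra : UltraFilter UU.
Proof. by rewrite /UU; case: cid => G []. Qed.

Lemma UU_eventually (P : set nat) N : (forall k, (N <= k)%N -> P k) -> UU P.
Proof.
move=> NP; have sub : \oo `<=` UU by rewrite /UU; case: cid => G [].
by apply: sub; exists N.
Qed.

(* Every bounded sequence has a limit along [UU]; this replaces the usual
   compactness and normal family arguments. *)
Definition ucv (R : realType) (V : normedZmodType (CC R)) (u : nat -> V)
    (l : V) : Prop :=
  forall e : R, 0 < e -> UU [set k | nm (u k - l) < e].

Section UltraLimits.
Variables (R : realType).
Local Notation C := (CC R).
Implicit Types (V : normedZmodType C) (T : normedModType C).

Lemma ucv_lim V (u : nat -> V) (l : V) :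
  (forall e : R, 0 < e -> exists N, forall k, (N <= k)%N -> nm (u k - l) < e) ->
  ucv u l.
Proof. by move=> ul e /ul[N NP]; exact: UU_eventually NP. Qed.

Lemma ucv_le V (u : nat -> V) (l x : V) (M : R) :
  ucv u l -> UU [set k | nm (u k - x) <= M] -> nm (l - x) <= M.
Proof.
move=> ul uM; apply/ler_addgt0Pr => e /ul ue.
have [k /= [ke kM]] := filter_ex (filterI ue uM).
by rewrite (le_trans (nm_dist _ (u k) _))// addrC lerD// nmC ltW.
Qed.

Lemma ucv_unique V (u : nat -> V) (l l' : V) : ucv u l -> ucv u l' -> l = l'.
Proof.
move=> ul ul'; apply/eqP; rewrite -subr_eq0; apply/eqP/nm_eq0/eqP.
rewrite eq_le nm_ge0 andbT; apply/ler_addgt0Pr => e e0; rewrite add0r.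
by apply: (ucv_le ul); apply: filterS (ul' _ e0) => k /=; apply: ltW.
Qed.

Lemma ucv_ext V (u v : nat -> V) (l : V) :
  UU [set k | u k = v k] -> ucv u l -> ucv v l.
Proof.
move=> uv ul e /ul ue; apply: filterS (filterI uv ue) => k /= [-> //].
Qed.

Lemma ucvD V (u v : nat -> V) (l m : V) :
  ucv u l -> ucv v m -> ucv (fun k => u k + v k) (l + m).
Proof.
move=> ul vm e e0; have e20 : 0 < e / 2 by rewrite divr_gt0.
apply: filterS (filterI (ul _ e20) (vm _ e20)) => k /= [ke ke'].
by rewrite opprD addrACA (le_lt_trans (nmD _ _))// [ltRHS]splitr ltrD.
Qed.

Lemma ucvN V (u : nat -> V) (l : V) : ucv u l -> ucv (fun k => - u k) (- l).
Proof.
by move=> ul e /ul; apply: filterS => k /=; rewrite -opprD nmN.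
Qed.

Lemma ucvB V (u v : nat -> V) (l m : V) :
  ucv u l -> ucv v m -> ucv (fun k => u k - v k) (l - m).
Proof. by move=> ul /ucvN; exact: ucvD. Qed.

Lemma ucvZ T (c : C) (u : nat -> T) (l : T) :
  ucv u l -> ucv (fun k => c *: u k) (c *: l).
Proof.
move=> ul e e0; have c0 : 0 < nm c + 1 by rewrite ltr_wpDl// nm_ge0.
apply: filterS (ul (e / (nm c + 1)) _); last by rewrite divr_gt0.
move=> k /=; rewrite -scalerBr nmZ ltr_pdivlMr// mulrC => ?.
by rewrite (le_lt_trans _ (_ : (nm c + 1) * nm (u k - l) < e))// ler_wpM2r ?nm_ge0// lerDl.
Qed.

Lemma ucv_nm_le V (u : nat -> V) (l : V) (M : R) :
  ucv u l -> (forall k, nm (u k) <= M) -> nm l <= M.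
Proof.
move=> ul uM; rewrite -[l]subr0; apply: (ucv_le ul).
by apply: filterE => k /=; rewrite subr0.
Qed.

Lemma compact_UU (S : topologicalType) (A : set S) (u : nat -> S) :
  compact A -> (forall k, A (u k)) ->
  exists2 l, A l & forall B, nbhs l B -> UU (u @^-1` B).
Proof.
move=> Aco uA; have [|l [Al ul]] := Aco (u @ UU) _.
  by apply: (@filterE _ UU) => k; exact: uA.
exists l => // B lB; have [//|uB] := in_ultra_setVsetC (u @^-1` B) UU_ultra.
by have [y [/= nBy By]] := ul (~` B) B uB lB.
Qed.

Lemma ucvR (u : nat -> R) (M : R) : (forall k, `|u k| <= M) ->
  exists l : R, forall e, 0 < e -> UU [set k | `|u k - l| < e].
Proof.
move=> uM; have [|l _ ul] := @compact_UU _ _ u (@segment_compact R (- M) M).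
  by move=> k /=; rewrite in_itv /= -ler_norml.
exists l => e e0.
have := ul _ (nbhsx_ballx l e e0); apply: filterS => k /=.
by rewrite /ball /= distrC.
Qed.

Lemma ucv_exC (u : nat -> C) (M : R) :
  (forall k, nm (u k) <= M) -> exists l, ucv u l.
Proof.
move=> uM.
have [a ua] : exists l : R, forall e, 0 < e ->
    UU [set k | `|complex.Re (u k) - l| < e].
  by apply: (@ucvR _ M) => k; exact: le_trans (nm_Re _) (uM k).
have [b ub] : exists l : R, forall e, 0 < e ->
    UU [set k | `|complex.Im (u k) - l| < e].
  by apply: (@ucvR _ M) => k; exact: le_trans (nm_Im _) (uM k).
exists (Complex a b) => e e0; have e20 : 0 < e / 2 by rewrite divr_gt0.
apply: filterS (filterI (ua _ e20) (ub _ e20)) => k /= [ke ke'].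
rewrite (le_lt_trans (nm_ReIm _))// [ltRHS]splitr.
by case: (u k) ke ke' => x y /= ? ?; rewrite ltrD.
Qed.

Lemma nm_coord n (v : 'rV[C]_n.+1) i : nm (v 0 i) <= nm v.
Proof.
rewrite -rc_le -!normE [leRHS]/Num.norm /= mx_normE -[leLHS]nngE num_le.
exact: (le_bigmax _ (fun i : 'I_1 * 'I_n.+1 => `|v i.1 i.2|%:nng) (0, i)).
Qed.

Lemma nm_row n (v : 'rV[C]_n.+1) : exists i, nm v = nm (v 0 i).
Proof.
have [->|v0] := eqVneq v 0; first by exists 0; rewrite mxE !nm0.
have /mx_norm_neq0[[i j] /= vij] : mx_norm v != 0.
  by apply: contra v0 => /eqP/mx_norm_eq0->.
exists j; apply: complexI; rewrite -/(rc _) -/(rc _) -!normE.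
by rewrite -[LHS]/(mx_norm v) vij (ord1 i).
Qed.

Lemma ucv_exV n (u : nat -> 'rV[C]_n.+1) (M : R) :
  (forall k, nm (u k) <= M) -> exists l, ucv u l.
Proof.
move=> uM; have /choice[l ul] : forall i, exists l, ucv (fun k => u k 0 i) l.
  by move=> i; apply: (@ucv_exC _ M) => k; exact: le_trans (nm_coord _ _) (uM k).
exists (\row_i l i) => e e0.
have ue : UU [set k | forall i, nm (u k 0 i - l i) < e].
  by apply: filter_forall => i; exact: ul.
apply: filterS ue => k /= ke.
have [i ->] := nm_row (u k - \row_i l i).
by rewrite !mxE; exact: ke.
Qed.

End UltraLimits.

(** * Goursat's theorem and primitives *)

Section Trapezoids.
Variables (R : realType).
Local Notation C := (CC R).
Variable T : normedModType C.
Implicit Types (f g : C -> T) (a b c z : C).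

Definition cdiff f z : Prop := exists d : T, forall e : R, 0 < e ->
  exists2 r : R, 0 < r &
    forall h : C, nm h < r -> nm (f (z + h) - f z - h *: d) <= e * nm h.

Definition mid a b : C := (a + b) / 2.

(* Trapezoid sums on dyadic subdivisions: they are antisymmetric in the end
   points, exact on affine functions and additive at midpoints, so Goursat's
   subdivision of a triangle is an identity between finite sums. *)
Fixpoint trap f k a b : T :=
  if k is k'.+1 then trap f k' a (mid a b) + trap f k' (mid a b) b
  else ((b - a) / 2) *: (f a + f b).

Definition trap3 f k a b c : T := trap f k a b + trap f k b c + trap f k c a.

Lemma midC a b : mid a b = mid b a.
Proof. by rewrite /mid addrC. Qed.

Lemma mid_disc a b z (r : R) :
  nm (a - z) <= r -> nm (b - z) <= r -> nm (mid a b - z) <= r.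
Proof.
move=> ar br; have -> : mid a b - z = 2^-1 * ((a - z) + (b - z)).
  by rewrite /mid; field.
rewrite nmM nmV nm_nat; have := nmD (a - z) (b - z); lra.
Qed.

Lemma nm_half a : nm (a / 2) = nm a / 2.
Proof. by rewrite nmM nmV nm_nat. Qed.

Lemma trap_anti f k a b : trap f k b a = - trap f k a b.
Proof.
elim: k a b => [|k IH] a b /=.
  by rewrite -scaleNr [f b + _]addrC; congr (_ *: _); field.
by rewrite (midC b a) (IH a) (IH (mid a b)) addrC opprD.
Qed.

Lemma trapB f g k a b :
  trap (fun z => f z - g z) k a b = trap f k a b - trap g k a b.
Proof.
elim: k a b => [|k IH] a b /=; first by rewrite -scalerBr opprD addrACA.
by rewrite !IH opprD addrACA.
Qed.

Lemma trap_affine (u d : T) z k a b :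
  trap (fun x => u + (x - z) *: d) k a b =
  (b - a) *: u + (((b - z) ^+ 2 - (a - z) ^+ 2) / 2) *: d.
Proof.
elim: k a b => [|k IH] a b /=.
  rewrite addrACA -scalerDl -mulr2n -(scaler_nat 2 u) scalerDr !scalerA.
  by congr (_ *: _ + _ *: _); field.
rewrite !IH addrACA -2!scalerDl /mid.
by congr (_ *: _ + _ *: _); field.
Qed.

Lemma trap_bound f k a b z (r m : R) :
  nm (a - z) <= r -> nm (b - z) <= r ->
  (forall x, nm (x - z) <= r -> nm (f x) <= m) ->
  nm (trap f k a b) <= m * nm (b - a).
Proof.
elim: k a b => [|k IH] a b ar br fm /=.
  rewrite nmZ nm_half; have := nmD (f a) (f b); have := fm _ ar.
  by have := fm _ br; have := nm_ge0 (b - a); nra.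
have mr := mid_disc ar br.
have := IH _ _ ar mr fm; have := IH _ _ mr br fm.
have -> : mid a b - a = (b - a) / 2 by rewrite /mid; field.
have -> : b - mid a b = (b - a) / 2 by rewrite /mid; field.
rewrite nm_half; have := nmD (trap f k a (mid a b)) (trap f k (mid a b) b); lra.
Qed.

Lemma trap_near f k a b (e : R) :
  (forall x, nm (x - a) <= nm (b - a) -> nm (f x - f a) <= e) ->
  nm (trap f k a b - (b - a) *: f a) <= e * nm (b - a).
Proof.
move=> fe; have := @trap_bound (fun x => f x - (f a + (x - a) *: 0)) k a b a (nm (b - a)) e.
rewrite trapB trap_affine scaler0 addr0; apply=> //.
  by rewrite subrr nm0 nm_ge0.
by move=> x xa; rewrite scaler0 addr0 fe.
Qed.

(** Each inner edge is run through twice in opposite directions and cancels by antisymmetry. The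
    level drops by one because halving the sides is the first subdivision. *)
Lemma trap3_split f k a b c :
  let m1 := mid a b in let m2 := mid b c in let m3 := mid c a in
  trap3 f k.+1 a b c = trap3 f k a m1 m3 + trap3 f k m1 b m2 +
                       (trap3 f k m3 m2 c + trap3 f k m1 m2 m3).
Proof.
move=> m1 m2 m3; rewrite /trap3 /= -/m1 -/m2 -/m3.
rewrite (trap_anti f k m3 m1) (trap_anti f k m1 m2) (trap_anti f k m2 m3).
set x1 := trap f k a m1; set x2 := trap f k m1 b; set x3 := trap f k b m2.
set x4 := trap f k m2 c; set x5 := trap f k c m3; set x6 := trap f k m3 a.
set y1 := trap f k m3 m1; set y2 := trap f k m1 m2; set y3 := trap f k m2 m3.
rewrite [RHS](AC ((3*3)*(3*3))
  ((1*4)*(5*8)*(9*3)*((12*2)*(10*6)*(11*7)))).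
by rewrite /= !subrr !addr0.
Qed.

Lemma trap3_affine (u d : T) z k a b c :
  trap3 (fun x => u + (x - z) *: d) k a b c = 0.
Proof.
rewrite /trap3 !trap_affine [X in X + _]addrACA -2!scalerDl addrACA -2!scalerDl.
rewrite [X in X *: u](_ : _ = 0); last by ring.
rewrite [X in X *: d](_ : _ = 0); last by field.
by rewrite !scale0r addr0.
Qed.

End Trapezoids.

Section Goursat.
Variables (R : realType).
Local Notation C := (CC R).
Variable T : normedModType C.
Implicit Types (f : C -> T) (a b c z : C).

Definition tri := (C * C * C)%type.

(** Asked for arbitrarily large [k] and not for a limit, because convergence of the sums is not
    known at this stage. *)
Definition nonvanishing f (t : tri) (e : R) : Prop :=
  forall K, exists2 k, (K <= k)%N & e < nm (trap3 f k t.1.1 t.1.2 t.2).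

Definition tri_in (t : tri) (r D : R) : Prop :=
  [/\ nm t.1.1 <= r, nm t.1.2 <= r & nm t.2 <= r] /\
  [/\ nm (t.1.2 - t.1.1) <= D, nm (t.2 - t.1.2) <= D & nm (t.1.1 - t.2) <= D].

(** If the sums of all four quarters were eventually at most [e / 4], their total would eventually
    be at most [e]. The closeness of the first vertices makes the nested sequence converge. *)
Lemma nonvanishing_split f (t : tri) (e r D : R) :
  nonvanishing f t e -> tri_in t r D ->
  exists2 t' : tri, nonvanishing f t' (e / 4) &
    tri_in t' r (D / 2) /\ nm (t'.1.1 - t.1.1) <= D / 2.
Proof.
case: t => [[a b] c]; rewrite /tri_in /= => bad [[ar br cr] [ab bc ca]].
have mr x y : nm x <= r -> nm y <= r -> nm (mid x y) <= r.
  by move=> xr yr; rewrite -[mid x y]subr0; apply: mid_disc; rewrite subr0.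
pose m1 := mid a b; pose m2 := mid b c; pose m3 := mid c a.
pose P (t' : tri) := tri_in t' r (D / 2) /\ nm (t'.1.1 - a) <= D / 2.
have D0 : 0 <= D by exact: le_trans (nm_ge0 _) ab.
have h1 : nm (m1 - a) <= D / 2.
  by have -> : m1 - a = (b - a) / 2 by [rewrite /m1 /mid; field];
    rewrite nm_half ler_pM2r.
have h1' : nm (b - m1) <= D / 2.
  by have -> : b - m1 = (b - a) / 2 by [rewrite /m1 /mid; field];
    rewrite nm_half ler_pM2r.
have h2 : nm (m2 - b) <= D / 2.
  by have -> : m2 - b = (c - b) / 2 by [rewrite /m2 /mid; field];
    rewrite nm_half ler_pM2r.
have h2' : nm (c - m2) <= D / 2.
  by have -> : c - m2 = (c - b) / 2 by [rewrite /m2 /mid; field];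
    rewrite nm_half ler_pM2r.
have h3 : nm (m3 - c) <= D / 2.
  by have -> : m3 - c = (a - c) / 2 by [rewrite /m3 /mid; field];
    rewrite nm_half ler_pM2r.
have h3' : nm (a - m3) <= D / 2.
  by have -> : a - m3 = (a - c) / 2 by [rewrite /m3 /mid; field];
    rewrite nm_half ler_pM2r.
have h12 : nm (m2 - m1) <= D / 2.
  by have -> : m2 - m1 = - ((a - c) / 2) by [rewrite /m1 /m2 /mid; field];
    rewrite nmN nm_half ler_pM2r.
have h23 : nm (m3 - m2) <= D / 2.
  by have -> : m3 - m2 = - ((b - a) / 2) by [rewrite /m3 /m2 /mid; field];
    rewrite nmN nm_half ler_pM2r.
have h31 : nm (m1 - m3) <= D / 2.
  by have -> : m1 - m3 = - ((c - b) / 2) by [rewrite /m1 /m3 /mid; field];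
    rewrite nmN nm_half ler_pM2r.
have P1 : P (a, m1, m3).
  by rewrite /P /tri_in /= subrr nm0 divr_ge0// (nmC m3) h31 !mr.
have P2 : P (m1, b, m2).
  by rewrite /P /tri_in /= (nmC m1 m2) !mr.
have P3 : P (m3, m2, c).
  by rewrite /P /tri_in /= (nmC m2 m3) (nmC m3 a) !mr.
have P4 : P (m1, m2, m3) by rewrite /P /tri_in /= !mr.
apply: contrapT => /forall2NP none.
have no t' : P t' -> exists K, forall k, (K <= k)%N ->
    nm (trap3 f k t'.1.1 t'.1.2 t'.2) <= e / 4.
  move=> Pt; have [/existsNP[K /forall2NP Kt]|//] := none t'.
  exists K => k Kk; have [//|/negP] := Kt k.
  by rewrite -leNgt.
have [K1 no1] := no _ P1; have [K2 no2] := no _ P2.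
have [K3 no3] := no _ P3; have [K4 no4] := no _ P4.
(* Off by one on purpose: level [k.+1] of the large triangle is level [k] of its quarters. *)
have [k Kk] := bad (K1 + K2 + K3 + K4).+1.
case: k Kk => // k; rewrite ltnS => Kk; rewrite ltNge => /negP; apply.
rewrite trap3_split.
have [kK1 kK2 kK3 kK4] : [/\ K1 <= k, K2 <= k, K3 <= k & K4 <= k]%N.
  clear -Kk; split; lia.
have := no1 _ kK1; have := no2 _ kK2; have := no3 _ kK3; have := no4 _ kK4.
rewrite /= -/m1 -/m2 -/m3.
set x1 := trap3 f k a m1 m3; set x2 := trap3 f k m1 b m2.
set x3 := trap3 f k m3 m2 c; set x4 := trap3 f k m1 m2 m3.
have := nmD (x1 + x2) (x3 + x4); have := nmD x1 x2; have := nmD x3 x4; lra.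
Qed.

Lemma goursat f (r r' : R) a b c : r < r' ->
  (forall z, nm z < r' -> cdiff f z) ->
  nm a <= r -> nm b <= r -> nm c <= r ->
  forall e : R, 0 < e ->
  exists K, forall k, (K <= k)%N -> nm (trap3 f k a b c) <= e.
Proof.
move=> rr fd ar br cr e e0; apply: contrapT => /forallNP nK.
have bad : nonvanishing f (a, b, c) e.
  move=> K; apply: contrapT => /forall2NP none; apply: (nK K) => k Kk.
  by have [//|/negP] := none k; rewrite -leNgt.
have r0 : 0 <= r by exact: le_trans (nm_ge0 _) ar.
pose D := r + r + 1; have D0 : 0 < D by rewrite /D; lra.
have tin : tri_in (a, b, c) r D.
  split=> /=; first by [].
  have := nmB b a; have := nmB c b; have := nmB a c; rewrite /D; split; lra.
have /choice[next nextP] : forall p : tri * R * R, exists t' : tri,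
    nonvanishing f p.1.1 p.1.2 -> tri_in p.1.1 r p.2 ->
    nonvanishing f t' (p.1.2 / 4) /\
    (tri_in t' r (p.2 / 2) /\ nm (t'.1.1 - p.1.1.1.1) <= p.2 / 2).
  move=> [[t e'] D'] /=.
  have [[b1 b2]|nb] := pselect (nonvanishing f t e' /\ tri_in t r D').
    by have [t' b3 b4] := nonvanishing_split b1 b2; exists t'.
  by exists t => b1 b2; case: nb.
pose tk := fix tk k := if k is k'.+1
  then next (tk k', e / 4 ^+ k', D / 2 ^+ k') else (a, b, c) : tri.
have tkP k : nonvanishing f (tk k) (e / 4 ^+ k) /\ tri_in (tk k) r (D / 2 ^+ k).
  elim: k => [|k [b1 b2]]; first by rewrite !expr0 !divr1.
  have [b3 [b4 _]] := nextP (tk k, e / 4 ^+ k, D / 2 ^+ k) b1 b2.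
  by rewrite /= !exprSr !invfM !mulrA.
have tkS k : nm ((tk k.+1).1.1 - (tk k).1.1) <= D / 2 ^+ k - D / 2 ^+ k.+1.
  have [b1 b2] := tkP k.
  have [_ [_ h]] := nextP (tk k, e / 4 ^+ k, D / 2 ^+ k) b1 b2.
  rewrite (le_trans h)//= exprSr invfM mulrA; lra.
have tkD k j : nm ((tk (k + j)%N).1.1 - (tk k).1.1) <= D / 2 ^+ k - D / 2 ^+ (k + j).
  elim: j => [|j IH]; first by rewrite addn0 !subrr nm0.
  rewrite addnS; have := nm_dist (tk (k + j).+1).1.1 (tk (k + j)%N).1.1 (tk k).1.1.
  have := tkS (k + j)%N; lra.
have pw k : 0 < 2 ^+ k :> R by rewrite exprn_gt0.
have [z az] : exists z, ucv (fun k => (tk k).1.1) z.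
  by apply: (@ucv_exC _ _ r) => k; have [_ [[]]] := tkP k.
have zr : nm z <= r by apply: (ucv_nm_le az) => k; have [_ [[]]] := tkP k.
have zk k : nm (z - (tk k).1.1) <= D / 2 ^+ k.
  apply: (ucv_le az); apply: (UU_eventually (N := k)) => j kj /=.
  rewrite -(subnKC kj); apply: le_trans (tkD _ _) _.
  by rewrite gerBl divr_ge0// ?ltW.
have [d fzd] := fd z (le_lt_trans zr rr).
(* The three sides of the [k]-th triangle will contribute [6 * D ^+ 2 * e' / 4 ^+ k], which has to
   be at most [e / 4 ^+ k]. *)
pose e' := e / (12 * D ^+ 2 + 1).
have e'0 : 0 < e' by rewrite divr_gt0// ltr_wpDl// mulr_ge0// sqr_ge0.
have [s s0 fs] := fzd _ e'0.
have [k kD] : exists k, 2 * D / 2 ^+ k < s.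
  have [k _ Hk] := near_infty_natSinv_expn_lt (PosNum (divr_gt0 s0 (mulr_gt0 (ltr0n _ 2) D0))).
  exists k; have := Hk k (leqnn k) => /=; rewrite div1r => H.
  by rewrite mulrC -ltr_pdivlMr// mulr_gt0.
have [bad_k [[akr bkr ckr] [abk bck cak]]] := tkP k.
have [j _] := bad_k 0%N; rewrite ltNge => /negP; apply.
set ak := (tk k).1.1 in akr abk cak *; set bk := (tk k).1.2 in bkr abk bck *.
set ck := (tk k).2 in ckr bck cak *.
have zak := zk k; rewrite -/ak in zak.
pose g x := f x - (f z + (x - z) *: d).
have gs x : nm (x - z) <= 2 * D / 2 ^+ k -> nm (g x) <= e' * (2 * D / 2 ^+ k).
  move=> xz; have := fs (x - z); rewrite subrKC => /(_ _).
  rewrite /g opprD addrA => h; apply: (le_trans (h _)); first exact: le_lt_trans kD.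
  by rewrite ler_wpM2l// ltW.
(* Subtracting the tangent map at [z] does not change the sum, as it is affine, and leaves an
   integrand of size at most [e'] times the distance to [z]. *)
have -> : trap3 f j ak bk ck = trap3 g j ak bk ck.
  rewrite -[LHS]subr0 -(trap3_affine (f z) d z j ak bk ck) /trap3 /g !trapB.
  by rewrite opprD addrACA opprD [X in X + _]addrACA.
have a1 : nm (ak - z) <= 2 * D / 2 ^+ k.
  have q0 : 0 <= D / 2 ^+ k by rewrite divr_ge0// ltW.
  by rewrite nmC -mulrA; lra.
have b1 : nm (bk - z) <= 2 * D / 2 ^+ k.
  have := nm_dist bk ak z; rewrite (nmC ak z); rewrite -mulrA; lra.
have c1 : nm (ck - z) <= 2 * D / 2 ^+ k.
  have := nm_dist ck ak z; rewrite (nmC ak z) (nmC ck ak); rewrite -mulrA; lra.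
have t1 := trap_bound j a1 b1 gs; have t2 := trap_bound j b1 c1 gs.
have t3 := trap_bound j c1 a1 gs.
set m := e' * _ in t1 t2 t3.
have q0 : 0 <= D / 2 ^+ k by rewrite divr_ge0// ltW.
have m0 : 0 <= m by apply: mulr_ge0; [exact: ltW|rewrite -mulrA mulr_ge0].
apply: (@le_trans _ _ (3 * m * (D / 2 ^+ k))).
  have := nmD (trap g j ak bk + trap g j bk ck) (trap g j ck ak).
  have := nmD (trap g j ak bk) (trap g j bk ck).
  have := ler_wpM2l m0 abk; have := ler_wpM2l m0 bck; have := ler_wpM2l m0 cak.
  by rewrite /trap3; lra.
have -> : 3 * m * (D / 2 ^+ k) = (6 * D ^+ 2 * e') / 4 ^+ k.
  have -> : 4 = 2 * 2 :> R by lra.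
  by rewrite /m exprMn; field; rewrite gt_eqF.
rewrite ler_pM2r ?invr_gt0 ?exprn_gt0// /e' mulrA ler_pdivrMr; last first.
  by rewrite ltr_wpDl// mulr_ge0// sqr_ge0.
by have := sqr_ge0 D; nra.
Qed.

End Goursat.

(** * Continuity, and compactness of closed discs *)

Definition econt (R : realType) (V W : normedZmodType (CC R)) (f : V -> W)
    (z : V) : Prop :=
  forall e : R, 0 < e ->
  exists2 r : R, 0 < r & forall x, nm (x - z) < r -> nm (f x - f z) < e.

Section Continuity.
Variables (R : realType).
Local Notation C := (CC R).

Lemma ucv_econt (V W : normedZmodType C) (f : V -> W) (u : nat -> V) z :
  econt f z -> ucv u z -> ucv (f \o u) (f z).
Proof.
by move=> fz uz e /fz[r r0 fr]; apply: filterS (uz _ r0) => k /=; exact: fr.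
Qed.

Lemma cdiff_econt (T : normedModType C) (f : C -> T) z : cdiff f z -> econt f z.
Proof.
move=> [d fd] e e0; have [r r0 fr] := fd 1 ltr01.
have k0 : 0 < nm d + 1 by rewrite ltr_wpDl// nm_ge0.
exists (Num.min r (e / (nm d + 1))) => [|x].
  by rewrite lt_min r0 divr_gt0.
rewrite lt_min ltr_pdivlMr// => /andP[xr xe].
have := fr _ xr; rewrite subrKC mul1r.
have := nm_leB (f x - f z) ((x - z) *: d); rewrite nmZ; nra.
Qed.

Lemma unif_disc (W : normedZmodType C) (f : C -> W) (r : R) :
  (forall z, nm z <= r -> econt f z) ->
  forall e : R, 0 < e -> exists2 s : R, 0 < s & forall x y,
    nm x <= r -> nm y <= r -> nm (x - y) <= s -> nm (f x - f y) <= e.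
Proof.
move=> fc e e0; apply: contrapT => none.
have /choice[u uP] : forall k : nat, exists p : C * C,
    [/\ nm p.1 <= r, nm p.2 <= r, nm (p.1 - p.2) <= k.+1%:R^-1 &
        e < nm (f p.1 - f p.2)].
  move=> k; apply: contrapT => /forallNP nk; apply: none.
  exists (k.+1%:R^-1) => [|x y xr yr xy]; first by rewrite invr_gt0 ltr0n.
  by rewrite leNgt; apply/negP => h; exact: (nk (x, y)).
have [z uz] : exists z, ucv (fun k => (u k).1) z.
  by apply: (@ucv_exC _ _ r) => k; have [] := uP k.
have zr : nm z <= r by apply: (ucv_nm_le uz) => k; have [] := uP k.
have uz2 : ucv (fun k => (u k).2) z.
  rewrite -[z]subr0; apply: (ucv_ext _ (ucvB uz (v := fun k => (u k).1 - (u k).2) _)).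
    by apply: filterE => k /=; rewrite opprB subrKC.
  apply: ucv_lim => d d0; have [N _ NP] := near_infty_natSinv_lt (PosNum d0).
  exists N => k /NP /= kd; rewrite subr0; apply: le_lt_trans kd.
  by have [] := uP k.
have e20 : 0 < e / 2 by rewrite divr_gt0.
have /(_ _ e20) k1 := ucv_econt (fc _ zr) uz.
have /(_ _ e20) k2 := ucv_econt (fc _ zr) uz2.
have [k /= [k1' k2']] := filter_ex (filterI k1 k2).
have [_ _ _] := uP k; have := nm_dist (f (u k).1) (f z) (f (u k).2).
rewrite (nmC (f z)); lra.
Qed.

Lemma bounded_disc (W : normedZmodType C) (f : C -> W) (r : R) :
  (forall z, nm z <= r -> econt f z) ->
  exists2 M : R, 0 <= M & forall x, nm x <= r -> nm (f x) <= M.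
Proof.
move=> fc; apply: contrapT => none.
have /choice[u uP] : forall k : nat, exists p : C,
    nm p <= r /\ k%:R < nm (f p).
  move=> k; apply: contrapT => /forallNP nk; apply: none.
  exists k%:R => [|x xr]; first by rewrite ler0n.
  by rewrite leNgt; apply/negP => h; exact: (nk x).
have [z uz] : exists z, ucv u z.
  by apply: (@ucv_exC _ _ r) => k; have [] := uP k.
have zr : nm z <= r by apply: (ucv_nm_le uz) => k; have [] := uP k.
have /(_ _ ltr01) k1 := ucv_econt (fc _ zr) uz.
have [N NP] : exists N : nat, nm (f z) + 1 < N%:R.
  by exists (Num.truncn (nm (f z) + 1)).+1; rewrite truncnS_gt.
have k2 : UU [set k | (N <= k)%N] by exact: (@UU_eventually _ N).
have [k /= [k1' k2']] := filter_ex (filterI k1 k2).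
have [_] := uP k; have := nm_leB (f (u k)) (f z).
have : N%:R <= k%:R :> R by rewrite ler_nat.
lra.
Qed.

End Continuity.

Section Primitive.
Variables (R : realType) (n : nat).
Local Notation C := (CC R).
Local Notation X := 'rV[C]_n.+1.
Implicit Types (f P : C -> X).

(** An increment estimate instead of a derivative: it is uniform in both end points, so it can be
    summed along a polygon. *)
Definition primitive f P (r : R) : Prop :=
  forall a b : C, nm a < r -> nm b < r -> forall e : R,
  (forall x, nm (x - a) <= nm (b - a) -> nm (f x - f a) <= e) ->
  nm (P b - P a - (b - a) *: f a) <= e * nm (b - a).

(** [P b] is the limit of the trapezoid sums from 0 to [b]; Goursat on the triangle 0, [a], [b]
    turns [P b - P a] into the sum from [a] to [b]. *)
Lemma primitive_exists f (r : R) :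
  (forall z, nm z < r -> cdiff f z) -> exists P, primitive f P r.
Proof.
move=> fd.
have /choice[P PP] : forall b : C, exists l : X,
    nm b < r -> ucv (fun k => trap f k 0 b) l.
  move=> b; have [br|nb] := ltP (nm b) r; last first.
    by exists 0.
  have [z zb|M M0 fM] := @bounded_disc _ _ f (nm b).
    by apply/cdiff_econt/fd/(le_lt_trans zb).
  have [k|l ul] := @ucv_exV _ _ (fun k => trap f k 0 b) (M * nm (b - 0)).
    apply: (@trap_bound _ _ _ _ _ _ 0 (nm b)).
    - by rewrite subr0 nm0 nm_ge0.
    - by rewrite subr0.
    - by move=> x; rewrite subr0; exact: fM.
  by exists l.
exists P => a b ar br e fe.
apply/ler_addgt0Pr => e' e'0.
apply: (ucv_le (ucvB (PP _ br) (PP _ ar))).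
pose m := Num.max (nm a) (nm b).
have mr : m < r by rewrite gt_max ar br.
have m0 : nm (0 : C) <= m by rewrite nm0 le_max nm_ge0.
have am : nm a <= m by rewrite le_max lexx.
have bm : nm b <= m by rewrite le_max lexx orbT.
have [K KP] := goursat mr fd m0 am bm e'0.
apply: (UU_eventually (N := K)) => k /KP /= h.
have -> : trap f k 0 b - trap f k 0 a = trap f k a b - trap3 f k 0 a b.
  rewrite /trap3 (trap_anti f k 0 b) (addrC (trap f k 0 a)) opprD opprK opprD.
  by rewrite !addrA subrr add0r addrC.
have := trap_near k fe; have := nmB (trap f k a b - (b - a) *: f a) (trap3 f k 0 a b).
rewrite addrAC; lra.
Qed.

End Primitive.

(** * Cauchy's formula *)

Section RootsOfUnity.
Variables (R : realType).
Local Notation C := (CC R).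

(** The square root in the closed right half-plane is chosen so that [root2 k] tends to 1. *)
Definition half_root (c : C) : C :=
  if 0 <= complex.Re (sqrtC c) then sqrtC c else - sqrtC c.

(* The root [exp (i pi / 2 ^ k)], obtained without the exponential. *)
Fixpoint root2 (k : nat) : C := if k is k'.+1 then half_root (root2 k') else -1.

Definition nroots (k : nat) : nat := 2 ^ k.+1.

Lemma root2_sqr k : root2 k.+1 ^+ 2 = root2 k.
Proof. by rewrite /= /half_root; case: ifP => _; rewrite ?sqrrN sqrtCK. Qed.

Lemma Re_root2 k : 0 <= complex.Re (root2 k.+1).
Proof.
rewrite /= /half_root; case: ifPn => //; rewrite -ltNge.
by case: (sqrtC _) => a b /=; rewrite oppr_ge0 => /ltW.
Qed.

Lemma root2_half k : root2 k ^+ (2 ^ k) = -1.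
Proof.
elim: k => [|k IH]; first by rewrite expn0 expr1.
by rewrite expnS exprM root2_sqr.
Qed.

Lemma root2_1 k : root2 k ^+ nroots k = 1.
Proof. by rewrite /nroots expnSr exprM root2_half sqrrN expr1n. Qed.

Lemma nm_root2 k : nm (root2 k) = 1.
Proof.
elim: k => [|k IH]; first by rewrite /= nmN nm1.
apply/eqP; rewrite -(@eqrXn2 _ 2)// ?nm_ge0// expr1n -nmX root2_sqr.
exact/eqP.
Qed.

Lemma nm_root2X k j : nm (root2 k ^+ j) = 1.
Proof. by rewrite nmX nm_root2 expr1n. Qed.

Lemma root2_neq1 k : root2 k != 1.
Proof.
apply/eqP => w1; have := root2_half k; rewrite w1 expr1n => /eqP.
by rewrite -subr_eq0 opprK -mulr2n pnatr_eq0.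
Qed.

(** With c = [root2 k.+1], c^2 - 1 = (c - 1)(c + 1) and |c + 1|^2 = 2 + 2 Re c >= 2, so the squared
    distance to 1 is at least halved at each step. *)
Lemma root2_near1 k : nm (root2 k - 1) ^+ 2 <= 4 / 2 ^+ k.
Proof.
elim: k => [|k IH].
  rewrite expr0 divr1 /= -opprD nmN -[1 + 1]/(2%:R) nm_nat; lra.
have h : root2 k - 1 = (root2 k.+1 - 1) * (root2 k.+1 + 1).
  by rewrite -root2_sqr; ring.
have w1 := nm_sqr (root2 k.+1); rewrite nm_root2 expr1n in w1.
have w2 := Re_root2 k.
have h2 : 2 <= nm (root2 k.+1 + 1) ^+ 2.
  rewrite nm_sqr; move: w1 w2; case: (root2 k.+1) => a b /=.
  by rewrite addr0; nra.
move: IH; rewrite h nmM exprMn [2 ^+ k.+1]exprSr invfM.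
set a := nm (_ - 1) ^+ 2; set b := nm (_ + 1) ^+ 2 in h2 *.
have a0 : 0 <= a by exact: sqr_ge0.
by have := ler_wpM2l a0 h2; lra.
Qed.

Lemma root2_cvg (e : R) : 0 < e ->
  exists K, forall k, (K <= k)%N -> nm (root2 k - 1) <= e.
Proof.
move=> e0; have d0 : 0 < e ^+ 2 / 4 by rewrite divr_gt0// exprn_gt0.
have [K _ KP] := near_infty_natSinv_expn_lt (PosNum d0).
exists K => k Kk; rewrite -(@ler_pXn2r _ 2)// ?nnegrE ?nm_ge0 ?ltW//.
have := KP k Kk; rewrite /= div1r; have := root2_near1 k; lra.
Qed.

Lemma expr_cvg (a e : R) : 0 <= a -> a < 1 -> 0 < e ->
  exists K, forall k, (K <= k)%N -> a ^+ k <= e.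
Proof.
move=> a0 a1 e0; have /cvg_expr/cvgrPdist_lt H : `|a| < 1 by rewrite ger0_norm.
have [K _ KP] := H _ e0; exists K => k /KP /=.
by rewrite sub0r normrN ger0_norm ?exprn_ge0//; exact: ltW.
Qed.

End RootsOfUnity.

Section Average.
Variables (R : realType).
Local Notation C := (CC R).
Variable T : normedModType C.
Implicit Types (g h : C -> T).

(** Discrete mean over the unit circle, in the role of the integral of g(z) dz / (2 pi i z). *)
Definition avg g k : T :=
  (nroots k)%:R^-1 *: \sum_(j < nroots k) g (root2 R k ^+ j).

Lemma nroots_gt0 k : (0 < nroots k)%N.
Proof. by rewrite expn_gt0. Qed.

Lemma avgB g h k : avg (fun z => g z - h z) k = avg g k - avg h k.
Proof. by rewrite /avg sumrB scalerBr. Qed.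

Lemma avgZ c g k : avg (fun z => c *: g z) k = c *: avg g k.
Proof. by rewrite /avg -scaler_sumr !scalerA mulrC. Qed.

Lemma eq_avg g h k : (forall z, nm z = 1 -> g z = h z) -> avg g k = avg h k.
Proof.
move=> gh; rewrite /avg; congr (_ *: _); apply: eq_bigr => j _.
by rewrite gh// nm_root2X.
Qed.

Lemma avg_le g k (m : R) : (forall z, nm z = 1 -> nm (g z) <= m) ->
  nm (avg g k) <= m.
Proof.
move=> gm; rewrite nmZ nmV nm_nat ler_pdivrMl ?ltr0n ?nroots_gt0//.
apply: le_trans (nm_sum _ _ _) _.
apply: (@le_trans _ _ (\sum_(j < nroots k) m)).
  by apply: ler_sum => j _; rewrite gm// nm_root2X.
by rewrite sumr_const card_ord mulr_natl.
Qed.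

Lemma nm_lt_neq (x z : C) : nm x < nm z -> z - x != 0.
Proof. by move=> xz; rewrite subr_eq0; apply: contraTneq xz => ->; rewrite ltxx. Qed.

(** The terms of z and -z add up to twice the term of z^2 for the point x^2, which reduces level
    [k.+1] at [x] to level [k] at [x ^+ 2]. *)
Lemma sum_cauchy_kernel (x : C) k : nm x < 1 ->
  \sum_(j < nroots k) root2 R k ^+ j / (root2 R k ^+ j - x) =
  (nroots k)%:R / (1 - x ^+ nroots k).
Proof.
have pair (z y : C) : nm z = 1 -> nm y < 1 ->
    z / (z - y) + (- z) / (- z - y) = 2 * (z ^+ 2 / (z ^+ 2 - y ^+ 2)).
  move=> z1 y1; have h1 : z - y != 0 by rewrite nm_lt_neq ?z1.
  have h2 : z + y != 0 by rewrite -[y]opprK nm_lt_neq ?nmN ?z1.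
  have h3 : z ^+ 2 - y ^+ 2 != 0 by rewrite subr_sqr mulf_neq0.
  have h4 : - z - y != 0 by rewrite -opprD oppr_eq0.
  by field; rewrite h1 h4 h3.
elim: k x => [|k IH] x x1.
  rewrite /nroots expn1 !big_ord_recl big_ord0 addr0 /= expr0 expr1.
  by rewrite pair ?nm1// expr1n mulrA mulr1.
have -> : nroots k.+1 = (nroots k + nroots k)%N.
  by rewrite /nroots [(2 ^ k.+2)%N]expnS mul2n addnn.
rewrite big_split_ord /= -big_split /=.
have half : root2 R k.+1 ^+ nroots k = -1 by exact: root2_half.
rewrite (eq_bigr (fun j : 'I_(nroots k) =>
    2 * (root2 R k ^+ j / (root2 R k ^+ j - x ^+ 2)))) => [|j _].
  rewrite -mulr_sumr IH; last by rewrite nmX expr_lt1// nm_ge0.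
  by rewrite -exprM mul2n -addnn natrD mulrA [2 * _]mulr_natl mulr2n.
rewrite exprD half mulN1r pair//; last exact: (@nm_root2X R k.+1 j).
by rewrite -exprM mulnC exprM root2_sqr.
Qed.

Lemma avg_cauchy_kernel (x : C) (v : T) k : nm x < 1 ->
  avg (fun z => (z / (z - x)) *: v) k = (1 - x ^+ nroots k)^-1 *: v.
Proof.
move=> x1; rewrite /avg -scaler_suml sum_cauchy_kernel// scalerA mulrA mulVf.
  by rewrite mul1r.
by rewrite pnatr_eq0 -lt0n nroots_gt0.
Qed.

End Average.

Section CauchyFormula.
Variables (R : realType) (n : nat).
Local Notation C := (CC R).
Local Notation X := 'rV[C]_n.+1.
Implicit Types (f P : C -> X) (x z : C).

Lemma nm_kernel x z : nm x < 1 -> nm z = 1 -> nm (z / (z - x)) <= (1 - nm x)^-1.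
Proof.
move=> x1 z1; rewrite nmM z1 mul1r nmV lef_pV2 ?posrE ?subr_gt0//; last first.
  by rewrite nm_gt0// nm_lt_neq ?z1.
by have := nm_leB z x; rewrite z1; lra.
Qed.

Lemma seg_disc x z (t : R) : 0 <= t -> t <= 1 -> nm x <= 1 -> nm z <= 1 ->
  nm (x + rc t * (z - x)) <= 1.
Proof.
move=> t0 t1 x1 z1; have -> : x + rc t * (z - x) = rc (1 - t) * x + rc t * z.
  by rewrite rcD rcN rc1; ring.
rewrite (le_trans (nmD _ _))// !nmM !nm_rcp ?subr_ge0//.
by nra.
Qed.

Definition small_steps f P (s e : R) : Prop :=
  forall a b : C, nm a <= 1 -> nm (b - a) <= s ->
  nm (P b - P a - (b - a) *: f a) <= e * nm (b - a).

Lemma primitive_small_steps f P (r e : R) : 1 < r ->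
  (forall z, nm z < r -> econt f z) -> primitive f P r -> 0 < e ->
  exists2 s : R, 0 < s & 1 + s < r /\ small_steps f P s e.
Proof.
move=> r1 fc fP e0; pose r' := (1 + r) / 2.
have [z zr|s s0 fs] := @unif_disc _ _ f r' _ e e0.
  by apply: fc; rewrite (le_lt_trans zr)// /r'; lra.
exists (Num.min s ((r - 1) / 2)); first by rewrite lt_min s0/=; lra.
split; first by rewrite -ltrBrDl gt_min; apply/orP; right; lra.
move=> a b a1; rewrite le_min => /andP[ba1 ba2].
have ba : nm b <= r' by have := nm_leB b a; rewrite /r'; lra.
have ar : nm a <= r' by rewrite /r'; lra.
apply: fP.
- by rewrite (le_lt_trans ar)// /r'; lra.
- by rewrite (le_lt_trans ba)// /r'; lra.
move=> y yb; apply: fs => //; last by rewrite (le_trans yb).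
by have := nm_leB y a; rewrite /r'; lra.
Qed.

(** Multiplied by t (w - 1), the sum is a Riemann sum of [f] along the closed polygon with vertices
    [Z j]. The increments of the primitive telescope to 0 around it, and only the errors remain.
    Since t > 0, the factor can be divided out again. *)
Lemma avg_derivative_small f P x (s e t : R) k : small_steps f P s e ->
  0 <= s -> 0 <= e ->
  nm (root2 R k - 1) <= s -> nm x < 1 -> 0 < t -> t <= 1 ->
  nm (avg (fun z => z *: f (x + rc t * (z - x))) k) <= e.
Proof.
move=> fP s0 e0 ws x1 t0 t1; set w := root2 R k in ws *.
pose Z j := x + rc t * (w ^+ j - x).
have Z1 j : nm (Z j) <= 1.
  by apply: seg_disc => //; rewrite ?nm_root2X// ltW.
have ZS j : Z j.+1 - Z j = (rc t * (w - 1)) * w ^+ j.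
  by rewrite /Z exprS; ring.
have w1 : 0 < nm (w - 1) by rewrite nm_gt0// subr_eq0 root2_neq1.
have nt : nm (rc t * (w - 1)) = t * nm (w - 1) by rewrite nmM nm_rcp// ltW.
have tw0 : 0 < nm (rc t * (w - 1)) by rewrite nt mulr_gt0.
have Zs j : nm (Z j.+1 - Z j) = nm (rc t * (w - 1)).
  by rewrite ZS nmM nm_root2X mulr1.
have tele : \sum_(j < nroots k) (P (Z j.+1) - P (Z j)) = 0.
  rewrite -(big_mkord xpredT (fun j => P (Z j.+1) - P (Z j))) telescope_sumr//.
  by rewrite /Z expr0 root2_1 subrr.
have key : (rc t * (w - 1)) *: \sum_(j < nroots k) w ^+ j *: f (Z j) =
    - \sum_(j < nroots k) (P (Z j.+1) - P (Z j) - (Z j.+1 - Z j) *: f (Z j)).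
  rewrite sumrB tele sub0r opprK scaler_sumr; apply: eq_bigr => j _.
  by rewrite scalerA ZS.
have := congr1 nm key; rewrite nmZ nmN => keyn.
rewrite /avg nmZ nmV nm_nat ler_pdivrMl ?ltr0n ?nroots_gt0//.
rewrite -(ler_pM2l tw0) keyn; apply: le_trans (nm_sum _ _ _) _.
apply: (@le_trans _ _ (\sum_(j < nroots k) e * nm (rc t * (w - 1)))).
  apply: ler_sum => j _; rewrite -(Zs j); apply: fP => //.
  by rewrite Zs nt; have := nm_ge0 (w - 1); nra.
rewrite sumr_const card_ord le_eqVlt; apply/orP; left; apply/eqP.
by rewrite -[LHS]mulr_natl; ring.
Qed.

(** The circle is contracted to [x]: [M t] averages the kernel against P(x + t (z - x)). Its
    derivative in t is the average of z f(x + t (z - x)), small by [avg_derivative_small], so [M 1]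
    is close to [M 0], which the sum of the kernel evaluates. *)
Lemma cauchy_primitive f P x (r : R) : 1 < r ->
  (forall z, nm z < r -> econt f z) -> primitive f P r -> nm x < 1 ->
  ucv (avg (fun z => (z / (z - x)) *: P z)) (P x).
Proof.
move=> r1 fc fP x1; pose q := (1 - nm x)^-1.
have q0 : 0 < q by rewrite invr_gt0 subr_gt0.
apply: ucv_lim => e e0.
pose e1 := e / (2 * (2 + 2 * q)).
have e10 : 0 < e1 by rewrite divr_gt0// !mulr_gt0// addr_gt0// mulr_gt0.
have [s s0 [_ ss]] := primitive_small_steps r1 fc fP e10.
have [K1 K1P] := root2_cvg s0.
pose e2 := Num.min (1 / 2) (e / (8 * (nm (P x) + 1))).
have Px0 : 0 < nm (P x) + 1 by rewrite ltr_wpDl// nm_ge0.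
have e20 : 0 < e2 by rewrite lt_min !divr_gt0// mulr_gt0.
have [K2 K2P] := expr_cvg (nm_ge0 x) x1 e20.
exists (maxn K1 K2) => k; rewrite geq_max => /andP[kK1 kK2].
pose M (t : R) := avg (fun z => (z / (z - x)) *: P (x + rc t * (z - x))) k.
have Mstep (t t' : R) : 0 < t -> t <= 1 -> 0 <= t' -> t' <= 1 ->
    2 * `|t' - t| <= s -> nm (M t' - M t) <= `|t' - t| * (e1 + 2 * (q * e1)).
  move=> t0 t1 t'0 t'1 tt.
  have := avg_derivative_small ss (ltW s0) (ltW e10) (K1P k kK1) x1 t0 t1.
  set D := avg _ k => De.
  have : nm (M t' - M t - rc (t' - t) *: D) <= `|t' - t| * (2 * (q * e1)).
    rewrite /M /D -avgZ -!avgB; apply: avg_le => z z1.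
    have zx : z - x != 0 by rewrite nm_lt_neq// z1.
    set a := x + rc t * (z - x); set b := x + rc t' * (z - x).
    have ba : b - a = rc (t' - t) * (z - x) by rewrite /a /b rcD rcN; ring.
    have -> : (z / (z - x)) *: P b - (z / (z - x)) *: P a -
        rc (t' - t) *: (z *: f a) =
        (z / (z - x)) *: (P b - P a - (b - a) *: f a).
      rewrite !scalerBr !scalerA; congr (_ - _ *: _); rewrite ba.
      by field.
    have nba : nm (b - a) <= `|t' - t| * 2.
      rewrite ba nmM nm_rc ler_wpM2l//; have := nmB z x; rewrite z1; lra.
    rewrite nmZ; have := nm_kernel x1 z1; rewrite -/q => kq.
    have a1 : nm a <= 1 by apply: seg_disc => //; rewrite ?z1// ltW.
    have bs : nm (b - a) <= s by rewrite (le_trans nba)// mulrC.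
    have h := ss a b a1 bs.
    have h2 : nm (P b - P a - (b - a) *: f a) <= e1 * (`|t' - t| * 2).
      by apply: le_trans h _; rewrite ler_wpM2l// ltW.
    rewrite [leRHS](_ : _ = q * (e1 * (`|t' - t| * 2))); last by ring.
    by apply: ler_pM => //; apply: nm_ge0.
  move=> h; apply: le_trans (nm_leB _ (rc (t' - t) *: D)) _.
  by rewrite mulrDr lerD// nmZ nm_rc ler_wpM2l.
have [m ms] : exists m : nat, 2 * m.+1%:R^-1 <= s.
  have s20 : 0 < s / 2 by rewrite divr_gt0.
  have [m _ mP] := near_infty_natSinv_lt (PosNum s20).
  have H : m.+1%:R^-1 < s / 2 by exact: mP m (leqnn m).
  by exists m; rewrite mulrC -ler_pdivlMr// ltW.
have m0 : 0 < m.+1%:R :> R by rewrite ltr0n.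
pose cst := e1 + 2 * (q * e1); pose d : R := m.+1%:R^-1.
have d0 : 0 < d by rewrite invr_gt0.
have Mi i : (i <= m.+1)%N -> nm (M (i%:R * d) - M 0) <= i%:R * d * cst.
  elim: i => [|i IH] im; first by rewrite !mul0r subrr nm0.
  have {}IH := IH (ltnW im); pose t := i%:R * d.
  have tS : i.+1%:R * d = t + d by rewrite -natr1 mulrDl mul1r.
  have t0 : 0 <= t by rewrite mulr_ge0// ltW.
  have t1 : t + d <= 1 by rewrite -tS ler_pdivrMr// mul1r ler_nat.
  have td : `|t - (t + d)| = d by rewrite opprD addrA subrr sub0r normrN gtr0_norm.
  (* The step is based at the right end [t + d], because [Mstep] needs a positive base point and [t]
     may be 0. *)
  have h : nm (M t - M (t + d)) <= d * cst.
    rewrite -{2}td; apply: Mstep => //; rewrite ?td//.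
    - by rewrite ltr_wpDl.
    - by rewrite (le_trans _ t1)// lerDl ltW.
  rewrite tS; rewrite nmC in h; rewrite -/t in IH; clearbody t.
  by apply: le_trans (nm_dist _ (M t) _) _; rewrite mulrDl addrC lerD.
have := Mi m.+1 (leqnn _); rewrite /d divff ?gt_eqF// mul1r => M1.
have -> : avg (fun z => (z / (z - x)) *: P z) k = M 1.
  by apply: eq_avg => z _; rewrite rc1 mul1r subrKC.
have M0 : M 0 = (1 - x ^+ nroots k)^-1 *: P x.
  rewrite -avg_cauchy_kernel//; apply: eq_avg => z _.
  by rewrite rc0 mul0r addr0.
set y := x ^+ nroots k in M0.
have ye : nm y <= e2.
  rewrite nmX (le_trans _ (K2P k kK2))//.
  by apply: ler_wiXn2l; rewrite ?nm_ge0 ?ltW// /nroots (leq_trans (leqnSn k))// ltnW// ltn_expl.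
have [y1 y2] : nm y <= 1 / 2 /\ nm y <= e / (8 * (nm (P x) + 1)).
  by apply/andP; rewrite -le_min.
have ny : 1 / 2 <= nm (1 - y).
  have := nm_leB 1 y; rewrite nm1; lra.
have ny0 : 1 - y != 0 by apply: contraTneq ny => ->; rewrite nm0 -ltNge.
have h0 : nm (M 0 - P x) <= e / 4.
  have -> : M 0 - P x = (y / (1 - y)) *: P x.
    rewrite M0 -[X in _ - X]scale1r -scalerBl; congr (_ *: _); by field.
  rewrite nmZ nmM nmV.
  apply: (@le_trans _ _ (e / (8 * (nm (P x) + 1)) * 2 * (nm (P x) + 1))).
    apply: ler_pM; rewrite ?mulr_ge0 ?invr_ge0 ?nm_ge0//; last lra.
    apply: ler_pM; rewrite ?invr_ge0 ?nm_ge0//.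
    by rewrite -[2]invrK lef_pV2 ?posrE ?invr_gt0//; lra.
  by rewrite le_eqVlt; apply/orP; left; apply/eqP; field; rewrite gt_eqF.
have ec : cst <= e / 2.
  have : e1 * (2 * (2 + 2 * q)) = e.
    by rewrite /e1 divfK// gt_eqF// mulr_gt0// addr_gt0// mulr_gt0.
  by rewrite /cst; clear -e10; lra.
apply: le_lt_trans (nm_dist _ (M 0) _) _; clear -M1 h0 ec e0; lra.
Qed.

(** On the closed unit disc [f] is uniformly within [e1] of the difference quotient of [P] with step
    [h], and the formula is known for [P] and for its translate by [h]. *)
Lemma cauchy_formula f x (r : R) : 1 < r ->
  (forall z, nm z < r -> cdiff f z) -> nm x < 1 ->
  ucv (avg (fun z => (z / (z - x)) *: f z)) (f x).
Proof.
move=> r1 fd x1; have [P fP] := primitive_exists fd.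
have fc z : nm z < r -> econt f z by move=> /fd; exact: cdiff_econt.
pose q := (1 - nm x)^-1.
have q0 : 0 < q by rewrite invr_gt0 subr_gt0.
move=> e e0; pose e1 := e / (2 * (2 + q)).
have e10 : 0 < e1 by rewrite divr_gt0// !mulr_gt0// addr_gt0.
have [h h0 [hr ss]] := primitive_small_steps r1 fc fP e10.
pose Ph z := P (z + rc h); pose fh z := f (z + rc h).
have nh : nm (rc h) = h by rewrite nm_rcp// ltW.
have nadd (z : C) : nm z < r - h -> nm (z + rc h) < r.
  by move=> zr; have := nmD z (rc h); rewrite nh; lra.
have fhc z : nm z < r - h -> econt fh z.
  move=> zr d d0; have [s s0 fs] := fc (z + rc h) (nadd _ zr) d d0.
  by exists s => // y yz; apply: fs; rewrite opprD addrACA subrr addr0.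
have fhP : primitive fh Ph (r - h).
  move=> a b ar br d H; have := fP _ _ (nadd _ ar) (nadd _ br) d.
  have -> : b + rc h - (a + rc h) = b - a by ring.
  apply => y ya.
  have := H (y - rc h); rewrite /fh subrK; apply.
  by have -> : y - rc h - a = y - (a + rc h) by ring.
have u1 : ucv (avg (fun z => (z / (z - x)) *: Ph z)) (Ph x).
  by apply: (cauchy_primitive _ fhc fhP x1); lra.
have u2 := cauchy_primitive r1 fc fP x1.
have he : 0 < h * e1 by rewrite mulr_gt0.
apply: filterS (ucvB u1 u2 he) => k /=.
rewrite -avgB => h1.
have h2 : nm (Ph x - P x - rc h *: f x) <= e1 * h.
  have hh : x + rc h - x = rc h by rewrite addrC addKr.
  have := ss x (x + rc h) (ltW x1); rewrite hh nh lexx => /(_ isT).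
  by rewrite /Ph.
have h3 : nm (avg (fun z => (z / (z - x)) *: Ph z - (z / (z - x)) *: P z) k -
    rc h *: avg (fun z => (z / (z - x)) *: f z) k) <= q * (e1 * h).
  rewrite -avgZ -avgB; apply: avg_le => z z1.
  have := nm_kernel x1 z1; move: (z / (z - x)) => c cq.
  rewrite scalerA [rc h * _]mulrC -scalerA -!scalerBr nmZ.
  apply: ler_pM; [exact: nm_ge0|exact: nm_ge0|exact: cq|].
  have z1' : nm z <= 1 by rewrite z1.
  have hh : z + rc h - z = rc h by rewrite addrC addKr.
  have := ss z (z + rc h) z1'; rewrite hh nh lexx => /(_ isT).
  by rewrite /Ph.
rewrite -(ltr_pM2l h0) -{1}nh -nmZ scalerBr.
set A := avg _ k in h1 h3; set B := avg _ k in h3 *.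
have -> : rc h *: B - rc h *: f x =
    - (A - rc h *: B) + (A - (Ph x - P x)) + (Ph x - P x - rc h *: f x).
  by rewrite opprB -addrA [_ + (Ph x - _ - _)]addrA subrK addrA subrK.
apply: le_lt_trans (nmD _ _) _.
apply: le_lt_trans (lerD (nmD _ _) (lexx _)) _; rewrite nmN.
have eE : h * e = h * (e1 * (2 * (2 + q))).
  by rewrite /e1 divfK// gt_eqF// !mulr_gt0// addr_gt0.
have := mulr_gt0 q0 he; clear -h1 h2 h3 he eE.
move: (nm _) (nm _) (nm _) h1 h2 h3 => y1 y2 y3; lra.
Qed.

End CauchyFormula.

(** * Cauchy estimates and analytic continuation *)

Section ComplexDerivative.
Variables (R : realType).
Local Notation C := (CC R).
Variable T : normedModType C.
Implicit Types (f g : C -> T) (a : C -> C) (c w x z : C) (d : T).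

Definition isd f z d : Prop := forall e : R, 0 < e ->
  exists2 r : R, 0 < r &
    forall h : C, nm h < r -> nm (f (z + h) - f z - h *: d) <= e * nm h.

Lemma isd_cdiff f z d : isd f z d -> cdiff f z.
Proof. by exists d. Qed.

Lemma isd_quadratic f z d (r K : R) : 0 < r ->
  (forall h, nm h < r -> nm (f (z + h) - f z - h *: d) <= K * nm h ^+ 2) ->
  isd f z d.
Proof.
move=> r0 fK e e0; pose K' := Num.max K 1.
have K'0 : 0 < K' by rewrite lt_max ltr01 orbT.
exists (Num.min r (e / K')); first by rewrite lt_min r0 divr_gt0.
move=> h; rewrite lt_min => /andP[hr he].
apply: le_trans (fK _ hr) _; rewrite expr2 mulrA ler_wpM2r ?nm_ge0//.
apply: (@le_trans _ _ (K' * nm h)).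
  by rewrite ler_wpM2r ?nm_ge0// le_max lexx.
by rewrite mulrC -ler_pdivlMr// ltW.
Qed.

Lemma isd_ext f g z d (r : R) : 0 < r ->
  (forall h, nm h < r -> f (z + h) = g (z + h)) -> isd f z d -> isd g z d.
Proof.
move=> r0 fg fd e e0; have [s s0 fs] := fd e e0.
exists (Num.min r s); first by rewrite lt_min r0.
move=> h; rewrite lt_min => /andP[hr hs].
by have := fg 0; rewrite addr0 nm0 => <-//; rewrite -fg// fs.
Qed.

Lemma isd_cst d z : isd (fun=> d) z 0.
Proof.
move=> e e0; exists 1 => // h _.
by rewrite subrr scaler0 subr0 nm0 mulr_ge0 ?nm_ge0// ltW.
Qed.

Lemma isdD f g z d d' : isd f z d -> isd g z d' ->
  isd (fun x => f x + g x) z (d + d').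
Proof.
move=> fd gd e e0; have e20 : 0 < e / 2 by rewrite divr_gt0.
have [r r0 fr] := fd _ e20; have [s s0 gs] := gd _ e20.
exists (Num.min r s); first by rewrite lt_min r0.
move=> h; rewrite lt_min => /andP[hr hs].
have -> : f (z + h) + g (z + h) - (f z + g z) - h *: (d + d') =
   (f (z + h) - f z - h *: d) + (g (z + h) - g z - h *: d').
  by rewrite scalerDr !opprD [in RHS]addrACA; congr (_ + _); rewrite addrACA.
rewrite (le_trans (nmD _ _))// [e in leRHS]splitr mulrDl lerD//.
  exact: fr.
exact: gs.
Qed.

Lemma isd_comp_affine f c s z d :
  isd f (c + s * z) d -> isd (fun x => f (c + s * x)) z (s *: d).
Proof.
move=> fd e e0; have s0 : 0 < nm s + 1 by rewrite ltr_wpDl ?nm_ge0.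
have [r r0 fr] := fd _ (divr_gt0 e0 s0).
exists (r / (nm s + 1)); first by rewrite divr_gt0.
move=> h; rewrite ltr_pdivlMr// => hr.
have sh : nm (s * h) <= nm h * (nm s + 1).
  by rewrite nmM mulrC ler_wpM2l ?nm_ge0// lerDl.
rewrite mulrDr addrA scalerA [h * s]mulrC.
apply: le_trans (fr _ (le_lt_trans sh hr)) _.
rewrite mulrAC ler_pdivrMr// -mulrA ler_wpM2l// ltW//.
Qed.

Lemma isd_bound f z d (r K : R) : 0 < r -> isd f z d ->
  (forall w, nm w < r -> nm (f (z + w) - f z) <= K * nm w) -> nm d <= K.
Proof.
move=> r0 fd fK; apply/ler_addgt0Pr => e e0.
have [s s0 fs] := fd e e0.
pose t := Num.min r s / 2.
have m0 : 0 < Num.min r s by rewrite lt_min r0.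
have t0 : 0 < t by rewrite divr_gt0.
have nt : nm (rc t) = t by rewrite nm_rcp// ltW.
have [tr ts] : t < r /\ t < s.
  by apply/andP; rewrite -lt_min /t ltr_pdivrMr// ltr_pMr// ltr1n.
rewrite -(ler_pM2l t0) -{1}nt -nmZ mulrDr.
apply: le_trans (nm_leB _ (f (z + rc t) - f z)) _; apply: lerD.
  by rewrite mulrC -[in leRHS]nt; apply: fK; rewrite nt.
by rewrite nmC mulrC -[in leRHS]nt; apply: fs; rewrite nt.
Qed.

Lemma isd_scale (a : C -> C^o) f z (b : C^o) d :
  (forall e : R, 0 < e -> exists2 r : R, 0 < r &
    forall h : C, nm h < r -> nm (a (z + h) - a z - h * b) <= e * nm h) ->
  isd f z d -> isd (fun x => a x *: f x) z (b *: f z + a z *: d).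
Proof.
move=> ad fd e e0; pose K := nm (f z) + 1 + nm b + nm (a z).
have K0 : 0 < K.
  by have := nm_ge0 (f z); have := nm_ge0 b; have := nm_ge0 (a z); rewrite /K; lra.
pose e1 := Num.min 1 (e / K).
have e10 : 0 < e1 by rewrite lt_min ltr01 divr_gt0.
have [r1 r10 ar] := ad _ e10; have [r2 r20 fr] := fd _ e10.
have [r3 r30 fc] := cdiff_econt (isd_cdiff fd) e10.
exists (Num.min r1 (Num.min r2 r3)); first by rewrite !lt_min r10 r20.
move=> h; rewrite !lt_min => /and3P[h1 h2 h3].
have fc' : nm (f (z + h) - f z) <= e1 by rewrite ltW// fc// addrC addKr.
have -> : a (z + h) *: f (z + h) - a z *: f z - h *: (b *: f z + a z *: d) =
   (a (z + h) - a z - h * b) *: f (z + h) +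
   ((h * b) *: (f (z + h) - f z) + a z *: (f (z + h) - f z - h *: d)).
  rewrite !scalerBl !scalerBr scalerDr !scalerA [h * a z]mulrC.
  rewrite opprD [RHS](AC (3*(2*3)) ((1*7)*(5*8)*((6*2)*(4*3)))) /=.
  by rewrite !subrr !addr0.
have h0 := nm_ge0 h.
have b1 : nm ((a (z + h) - a z - h * b) *: f (z + h)) <=
    e1 * nm h * (nm (f z) + 1).
  rewrite nmZ; apply: ler_pM; rewrite ?nm_ge0 ?ar//.
  apply: le_trans (nm_leB _ (f z)) _; rewrite lerD2l.
  by apply: le_trans fc' _; rewrite ge_min lexx.
have b2 : nm ((h * b) *: (f (z + h) - f z)) <= e1 * nm h * nm b.
  rewrite nmZ nmM mulrC mulrA; apply: ler_wpM2r; first exact: nm_ge0.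
  exact: ler_wpM2r.
have b3 : nm (a z *: (f (z + h) - f z - h *: d)) <= e1 * nm h * nm (a z).
  by rewrite nmZ mulrC; apply: ler_wpM2r; [exact: nm_ge0|exact: fr].
apply: le_trans (nmD _ _) _.
apply: le_trans (lerD b1 (le_trans (nmD _ _) (lerD b2 b3))) _.
have -> : e1 * nm h * (nm (f z) + 1) + (e1 * nm h * nm b + e1 * nm h * nm (a z))
  = (e1 * K) * nm h by rewrite /K; ring.
by rewrite ler_wpM2r// -ler_pdivlMr// ge_min lexx orbT.
Qed.

Lemma isd_inv_scale f z d : z != 0 -> isd f z d -> cdiff (fun x => x^-1 *: f x) z.
Proof.
move=> z0 fd; apply: isd_cdiff.
apply: (@isd_scale (fun x => x^-1) f z (- z ^- 2) d) => // e e0.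
have nz : 0 < nm z by exact: nm_gt0.
exists (Num.min (nm z / 2) (e * nm z ^+ 3 / 2)).
  by rewrite lt_min !divr_gt0// mulr_gt0// exprn_gt0.
move=> h; rewrite lt_min => /andP[h1 h2].
have zh : nm z / 2 <= nm (z + h).
  by have := nm_leB z (- h); rewrite opprK nmN; lra.
have zh0 : z + h != 0.
  by apply: contraTneq zh => ->; rewrite nm0 -ltNge divr_gt0.
have -> : (z + h)^-1 - z^-1 - h * (- z ^- 2) = h * h / (z ^+ 2 * (z + h)).
  by field; rewrite zh0 z0.
rewrite !nmM nmV nmM nmX mulrAC ler_wpM2r ?nm_ge0//.
have zh1 : 0 < nm (z + h) by exact: nm_gt0.
rewrite ler_pdivrMr; last by rewrite mulr_gt0// exprn_gt0.
apply: le_trans (ltW h2) _.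
rewrite -mulrA ler_wpM2l ?(ltW e0)// exprSr -mulrA ler_wpM2l//.
by rewrite exprn_ge0// ltW.
Qed.

End ComplexDerivative.

(** * Cauchy estimates, limits of holomorphic functions, identity theorem *)

Section Estimates.
Variables (R : realType) (n : nat).
Local Notation C := (CC R).
Local Notation X := 'rV[C]_n.+1.
Implicit Types (f g : C -> X) (c w x y z : C) (d : X).

Definition hol f c (r : R) : Prop := forall z, nm (z - c) < r -> cdiff f z.

Lemma cdiff_comp_affine f c s z :
  cdiff f (c + s * z) -> cdiff (fun x => f (c + s * x)) z.
Proof. by move=> [d fd]; exists (s *: d); exact: isd_comp_affine. Qed.

Lemma hol_rescale f c (r rho : R) : hol f c r -> 0 < rho ->
  hol (fun x => f (c + rc rho * x)) 0 (r / rho).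
Proof.
move=> fh rho0 z; rewrite subr0 ltr_pdivlMr// => zr.
apply: cdiff_comp_affine; apply: fh.
by rewrite addrC addKr nmM nm_rcp ?ltW// mulrC.
Qed.

Lemma cauchy_formula0 f x (r : R) : 1 < r -> hol f 0 r -> nm x < 1 ->
  ucv (avg (fun z => (z / (z - x)) *: f z)) (f x).
Proof. by move=> r1 fh; apply: cauchy_formula r1 _ => z zr; apply: fh; rewrite subr0. Qed.

Lemma nm_kernel2 x z : nm x <= 1 / 2 -> nm z = 1 ->
  z - x != 0 /\ nm (z - x)^-1 <= 2.
Proof.
move=> x2 z1; have zx : 1 / 2 <= nm (z - x) by have := nm_leB z x; lra.
have zx0 : z - x != 0 by apply: contraTneq zx => ->; rewrite nm0 -ltNge; lra.
split=> //; rewrite nmV -[2]invrK lef_pV2 ?posrE ?invr_gt0 ?nm_gt0//; lra.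
Qed.

(** The kernel at [x] minus the kernel at 0 is z / (z - x) - 1 = x / (z - x); divide by x. *)
Lemma cauchy_quotient f x (r : R) : 1 < r -> hol f 0 r -> x != 0 ->
  nm x <= 1 / 2 ->
  ucv (avg (fun z => (z - x)^-1 *: f z)) (x^-1 *: (f x - f 0)).
Proof.
move=> r1 fh x0 x2.
have x1 : nm x < 1 by lra.
have z1 : nm (0 : C) < 1 by rewrite nm0.
have := ucvZ x^-1 (ucvB (cauchy_formula0 r1 fh x1) (cauchy_formula0 r1 fh z1)).
apply: ucv_ext; apply: filterE => k /=.
rewrite -avgB -avgZ; apply: eq_avg => z nz.
have [zx _] := nm_kernel2 x2 nz.
have z0 : z != 0 by apply: contraTneq (ltr01 : 0 < 1 :> R) => z0; rewrite -nz z0 nm0 ltxx.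
by rewrite -scalerBl scalerA; congr (_ *: _); field; rewrite x0 zx z0.
Qed.

Lemma quotient_bound f x (r M : R) : 1 < r -> hol f 0 r ->
  (forall z, nm z = 1 -> nm (f z) <= M) -> nm x <= 1 / 2 ->
  nm (f x - f 0) <= 2 * M * nm x.
Proof.
move=> r1 fh fM x2; have [->|x0] := eqVneq x 0.
  by rewrite subrr !nm0 mulr0.
have := ucv_nm_le (M := 2 * M) (cauchy_quotient r1 fh x0 x2).
rewrite nmZ nmV ler_pdivrMl ?nm_gt0// [_ * nm x]mulrC; apply => k.
apply: avg_le => z z1; have [_ kz] := nm_kernel2 x2 z1.
by rewrite nmZ; apply: ler_pM; rewrite ?nm_ge0 ?fM.
Qed.

Lemma quotient_lip f x y (r M : R) : 1 < r -> hol f 0 r ->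
  (forall z, nm z = 1 -> nm (f z) <= M) ->
  x != 0 -> y != 0 -> nm x <= 1 / 2 -> nm y <= 1 / 2 ->
  nm (x^-1 *: (f x - f 0) - y^-1 *: (f y - f 0)) <= 4 * M * nm (x - y).
Proof.
move=> r1 fh fM x0 y0 x2 y2.
apply: (ucv_nm_le (ucvB (cauchy_quotient r1 fh x0 x2)
                        (cauchy_quotient r1 fh y0 y2))) => k.
rewrite -avgB; apply: avg_le => z z1.
have [zx kx] := nm_kernel2 x2 z1; have [zy ky] := nm_kernel2 y2 z1.
have -> : (z - x)^-1 *: f z - (z - y)^-1 *: f z =
    (((z - x)^-1 * (z - y)^-1) * (x - y)) *: f z.
  by rewrite -scalerBl; congr (_ *: _); field; rewrite zx zy.
rewrite nmZ !nmM mulrAC; apply: ler_wpM2r; first exact: nm_ge0.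
have -> : 4 * M = 2 * 2 * M by congr (_ * _); rewrite -natrM.
by apply: ler_pM; rewrite ?mulr_ge0 ?nm_ge0 ?fM//; apply: ler_pM; rewrite ?nm_ge0.
Qed.

(** The quotient at a small real [t] is close to [d], and [quotient_lip] compares it with the
    quotient at [x]. *)
Lemma second_order0 f d x (r M : R) : 1 < r -> hol f 0 r ->
  (forall z, nm z = 1 -> nm (f z) <= M) -> isd f 0 d -> nm x <= 1 / 2 ->
  nm (f x - f 0 - x *: d) <= 4 * M * nm x ^+ 2.
Proof.
move=> r1 fh fM fd x2; have [->|x0] := eqVneq x 0.
  by rewrite subrr scale0r subrr !nm0 expr0n mulr0.
have M0 : 0 <= M by rewrite (le_trans (nm_ge0 _) (fM 1 _))// nm1.
suff : nm (x^-1 *: (f x - f 0) - d) <= 4 * M * nm x.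
  have -> : f x - f 0 - x *: d = x *: (x^-1 *: (f x - f 0) - d).
    by rewrite scalerBr scalerA divff// scale1r.
  by rewrite nmZ => h; rewrite expr2 mulrA mulrC ler_wpM2r// nm_ge0.
apply/ler_addgt0Pr => e e0.
pose e1 := e / (4 * M + 1); have e10 : 0 < e1 by rewrite divr_gt0// ltr_wpDl// mulr_ge0.
have [s s0 fs] := fd _ e10.
pose t := Num.min (Num.min s (1 / 2)) e1 / 2.
have m0 : 0 < Num.min (Num.min s (1 / 2)) e1 by rewrite !lt_min s0 e10 divr_gt0.
have t0 : 0 < t by rewrite divr_gt0.
have nt : nm (rc t) = t by rewrite nm_rcp// ltW.
have /and3P[ts t2 te] : [&& t < s, t < 1 / 2 & t < e1].
  by rewrite andbA -!lt_min /t ltr_pdivrMr// ltr_pMr// ltr1n.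
have y0 : rc t != 0 by apply: contraTneq t0 => ty; rewrite -nt ty nm0 ltxx.
have nt2 : nm (rc t) <= 1 / 2 by rewrite nt ltW.
have h1 := quotient_lip r1 fh fM x0 y0 x2 nt2.
have h2 : nm ((rc t)^-1 *: (f (rc t) - f 0) - d) <= e1.
  have -> : (rc t)^-1 *: (f (rc t) - f 0) - d =
     (rc t)^-1 *: (f (0 + rc t) - f 0 - rc t *: d).
    by rewrite add0r [in RHS]scalerBr scalerA mulVf// scale1r.
  by rewrite nmZ nmV nt ler_pdivrMl// [t * _]mulrC -[t in leRHS]nt; apply: fs; rewrite nt.
apply: le_trans (nm_dist _ ((rc t)^-1 *: (f (rc t) - f 0)) _) _.
apply: le_trans (lerD h1 h2) _.
have h3 : nm (x - rc t) <= nm x + e1.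
  by apply: le_trans (nmB _ _) _; rewrite lerD2l nt ltW.
have h4 := ler_wpM2l (mulr_ge0 (ler0n R 4) M0) h3.
apply: le_trans (lerD h4 (lexx _)) _.
rewrite mulrDr -addrA lerD2l -{2}[e1]mul1r -mulrDl /e1 mulrCA divff ?mulr1//.
by rewrite gt_eqF// ltr_wpDl// mulr_ge0.
Qed.

Lemma lip_est f c w (r M : R) : hol f c r ->
  (forall z, nm (z - c) < r -> nm (f z) <= M) -> nm w < r ->
  nm (f (c + w) - f c) <= 8 * M / r * nm w.
Proof.
move=> fh fM wr; have r0 : 0 < r by exact: le_lt_trans (nm_ge0 _) wr.
have fc : nm (f c) <= M by apply: fM; rewrite subrr nm0.
have M0 : 0 <= M by exact: le_trans (nm_ge0 _) fc.
have fw : nm (f (c + w)) <= M by apply: fM; rewrite addrC addKr.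
(* Beyond a quarter of the radius the trivial bound [2 * M] suffices. Otherwise the circle of radius
   [r / 2] is rescaled to the unit circle, where [w] becomes at most 1/2. *)
have [w4|w4] := leP (nm w) (r / 4); last first.
  apply: le_trans (nmB _ _) _; apply: le_trans (lerD fw fc) _.
  rewrite mulrAC ler_pdivlMr//; have : 0 <= M * nm w by rewrite mulr_ge0 ?nm_ge0.
  by have := ler_wpM2l M0 (ltW w4); lra.
pose rho := r / 2; have rho0 : 0 < rho by rewrite divr_gt0.
have nrho : nm (rc rho) = rho by rewrite nm_rcp// ltW.
have rho1 : rc rho != 0 by apply: contraTneq rho0 => h; rewrite -nrho h nm0 ltxx.
have r1 : 1 < r / rho by rewrite ltr_pdivlMr// mul1r /rho; lra.
have gh := hol_rescale fh rho0.
have gM z : nm z = 1 -> nm (f (c + rc rho * z)) <= M.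
  by move=> z1; apply: fM; rewrite addrC addKr nmM nrho z1 mulr1 /rho; lra.
have nx : nm (w / rc rho) = nm w / rho by rewrite nmM nmV nrho.
have x2 : nm (w / rc rho) <= 1 / 2.
  by rewrite nx ler_pdivrMr// /rho; lra.
have := quotient_bound r1 gh gM x2.
rewrite mulr0 addr0 mulrC divfK// nx => h.
apply: le_trans h _; rewrite /rho invf_div.
have -> : 2 * M * (nm w * (2 / r)) = 4 * M / r * nm w by ring.
rewrite ler_wpM2r ?nm_ge0// ler_wpM2r ?invr_ge0 ?(ltW r0)//.
by rewrite ler_wpM2r// ler_nat.
Qed.

Lemma second_order f c w d (r M : R) : hol f c r ->
  (forall z, nm (z - c) < r -> nm (f z) <= M) -> isd f c d -> nm w <= r / 4 ->
  0 < r ->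
  nm (f (c + w) - f c - w *: d) <= 16 * M / r ^+ 2 * nm w ^+ 2.
Proof.
move=> fh fM fd w4 r0.
pose rho := r / 2; have rho0 : 0 < rho by rewrite divr_gt0.
have nrho : nm (rc rho) = rho by rewrite nm_rcp// ltW.
have rho1 : rc rho != 0 by apply: contraTneq rho0 => h; rewrite -nrho h nm0 ltxx.
have r1 : 1 < r / rho by rewrite ltr_pdivlMr// mul1r /rho; lra.
have gh := hol_rescale fh rho0.
have gM z : nm z = 1 -> nm (f (c + rc rho * z)) <= M.
  by move=> z1; apply: fM; rewrite addrC addKr nmM nrho z1 mulr1 /rho; lra.
have nx : nm (w / rc rho) = nm w / rho by rewrite nmM nmV nrho.
have x2 : nm (w / rc rho) <= 1 / 2.
  by rewrite nx ler_pdivrMr// /rho; lra.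
have gd : isd (fun x => f (c + rc rho * x)) 0 (rc rho *: d).
  by apply: isd_comp_affine; rewrite mulr0 addr0.
have := second_order0 r1 gh gM gd x2.
have -> : rc rho * (w / rc rho) = w by rewrite mulrC divfK.
rewrite mulr0 addr0 scalerA divfK// nx => h.
apply: le_trans h _; rewrite le_eqVlt /rho; apply/orP; left; apply/eqP.
by field; rewrite gt_eqF.
Qed.

(** [lip_est] bounds the derivatives at [z], so they have a limit as well, and the remainder in
    [second_order] is uniform in [k]. *)
Lemma ulim_hol (u : nat -> C -> X) f c (r M : R) :
  (forall k, hol (u k) c r) ->
  (forall k z, nm (z - c) < r -> nm (u k z) <= M) ->
  (forall z, nm (z - c) < r -> ucv (u^~ z) (f z)) ->
  hol f c r.
Proof.
move=> uh uM uf z zr.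
pose s := r - nm (z - c); have s0 : 0 < s by rewrite subr_gt0.
have sr x : nm (x - z) < s -> nm (x - c) < r.
  by move=> xz; have := nm_dist x z c; move: xz; rewrite /s; lra.
have uh' k : hol (u k) z s by move=> x /sr; exact: uh.
have uM' k x : nm (x - z) < s -> nm (u k x) <= M by move=> /sr; exact: uM.
have /choice[d ud] : forall k, exists d, isd (u k) z d by move=> k; exact: uh.
have [l dl] : exists l, ucv d l.
  apply: (@ucv_exV _ _ d (8 * M / s)) => k.
  by apply: isd_bound s0 (ud k) _ => w ws; exact: lip_est (uh' k) (uM' k) ws.
exists l; apply: (@isd_quadratic _ _ _ _ _ (s / 4) (16 * M / s ^+ 2)).
  by rewrite divr_gt0.
move=> h hs.
have hz : nm (z + h - z) < s by rewrite addrC addKr; lra.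
apply: (ucv_nm_le (ucvB (ucvB (uf _ (sr _ hz)) (uf _ zr)) (ucvZ h dl))) => k.
exact: second_order (uh' k) (uM' k) (ud k) (ltW hs) s0.
Qed.

(** After rescaling, division by x^k keeps the function holomorphic, as it is zero near 0, and keeps
    its size on the unit circle. Cauchy's formula then bounds |f| by a constant times |x|^k for
    every k. *)
Lemma vanish_disc f c (r s : R) : hol f c r -> 0 < s ->
  (forall z, nm (z - c) < s -> f z = 0) ->
  forall z, nm (z - c) < r -> f z = 0.
Proof.
move=> fh s0 f0 z zr.
pose rho := (nm (z - c) + r) / 2.
have rhor : rho < r by rewrite /rho; lra.
have zrho : nm (z - c) < rho by rewrite /rho; lra.
have rho0 : 0 < rho by exact: le_lt_trans (nm_ge0 _) zrho.
have nrho : nm (rc rho) = rho by rewrite nm_rcp// ltW.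
have rho1 : rc rho != 0 by apply: contraTneq rho0 => h; rewrite -nrho h nm0 ltxx.
pose r' := r / rho; have r1 : 1 < r' by rewrite ltr_pdivlMr// mul1r.
pose g k x := (x ^- k) *: f (c + rc rho * x).
have g0 k x : nm x < s / rho -> g k x = 0.
  move=> xs; rewrite /g f0 ?scaler0//.
  by rewrite addrC addKr nmM nrho mulrC -ltr_pdivlMr.
have gh k : hol (g k) 0 r'.
  elim: k => [|k IH].
    have := hol_rescale fh rho0; rewrite -/r' => h x xr.
    have [d hd] := h x xr.
    apply: (@isd_cdiff _ _ _ _ d); apply: (isd_ext (f := fun t => f (c + rc rho * t)) (g := g 0%N) ltr01 _ hd) => y _.
    by rewrite /g expr0 invr1 scale1r.
  move=> x xr; have [->|x0] := eqVneq x 0.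
    apply: isd_cdiff; apply: isd_ext (divr_gt0 s0 rho0) _ (isd_cst 0 0) => h hs.
    by rewrite add0r g0.
  have [d hd] := IH x xr; have [d' hd'] := isd_inv_scale x0 hd.
  apply: (@isd_cdiff _ _ _ _ d'); apply: (isd_ext (f := fun t => t^-1 *: g k t) (g := g k.+1) ltr01 _ hd') => y _.
  by rewrite /g scalerA exprS invfM.
have [y yr|M M0 fM] := @bounded_disc _ _ (fun x => f (c + rc rho * x)) 1.
  by apply/cdiff_econt/(hol_rescale fh rho0); rewrite subr0 (le_lt_trans yr).
pose x := (z - c) / rc rho.
have xz : c + rc rho * x = z by rewrite /x mulrC divfK// subrKC.
have nx : nm x = nm (z - c) / rho by rewrite nmM nmV nrho.
have x1 : nm x < 1 by rewrite nx ltr_pdivrMr// mul1r.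
have q0 : 0 < (1 - nm x)^-1 by rewrite invr_gt0 subr_gt0.
have key k : nm (f z) <= (1 - nm x)^-1 * M * nm x ^+ k.
  have [x0|x0] := eqVneq x 0.
    rewrite -xz x0 mulr0 addr0 f0 ?subrr ?nm0//.
    by rewrite !mulr_ge0 ?exprn_ge0 ?nm_ge0// ?ltW// x0 nm0 subr0 invr1.
  have xk0 : 0 < nm x ^+ k by rewrite exprn_gt0// nm_gt0.
  have h : nm (g k x) <= (1 - nm x)^-1 * M.
    apply: (ucv_nm_le (cauchy_formula0 r1 (gh k) x1)) => j.
    apply: avg_le => y y1; rewrite nmZ; apply: ler_pM; rewrite ?nm_ge0//.
      exact: nm_kernel.
    by rewrite /g nmZ nmV nmX y1 expr1n invr1 mul1r fM// y1.
  by move: h; rewrite /g nmZ nmV nmX xz ler_pdivrMl// [_ * nm x ^+ k]mulrC mulrC.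
apply: nm_eq0; apply/eqP; rewrite eq_le nm_ge0 andbT.
apply/ler_addgt0Pr => e e0; rewrite add0r.
have A0 : 0 < (1 - nm x)^-1 * M + 1 by rewrite ltr_wpDl// mulr_ge0// ltW.
have [K KP] := expr_cvg (nm_ge0 x) x1 (divr_gt0 e0 A0).
apply: le_trans (key K) _; have h := KP K (leqnn K).
rewrite ler_pdivlMr// mulrC in h; apply: le_trans _ h.
by rewrite ler_wpM2r ?exprn_ge0 ?nm_ge0// lerDl.
Qed.

End Estimates.

(** * Analytic continuation along a real segment *)

Section Continuation.
Variables (R : realType) (n : nat).
Local Notation C := (CC R).
Local Notation X := 'rV[C]_n.+1.

(** The discs have the common radius [rho], so vanishing propagates from [b] leftwards in steps of
    [rho / 2], each covered by [vanish_disc]. *)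
Lemma vanish_segment (f : C -> X) (a b rho : R) : 0 < rho ->
  (forall t, a <= t -> t <= b -> hol f (rc t) rho) ->
  (forall z, nm (z - rc b) < rho -> f z = 0) ->
  forall t, a <= t -> t <= b -> f (rc t) = 0.
Proof.
move=> rho0 fh fb.
suff key (j : nat) t : a <= t -> t <= b -> b - t <= j%:R * (rho / 2) ->
    forall z, nm (z - rc t) < rho -> f z = 0.
  move=> t at0 tb; pose j := (Num.truncn ((b - t) / (rho / 2))).+1.
  apply: (key j t) => //; last by rewrite subrr nm0.
  by rewrite -ler_pdivrMr ?divr_gt0// ltW// truncnS_gt.
elim: j t => [|j IH] t at0 tb.
  rewrite mul0r subr_le0 => bt.
  by have -> : t = b by apply/eqP; rewrite eq_le tb.
move=> tj; pose t' := Num.min b (t + rho / 2).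
have tt' : t <= t' by rewrite le_min tb lerDl divr_ge0// ltW.
have t'b : t' <= b by rewrite ge_min lexx.
have t'j : b - t' <= j%:R * (rho / 2).
  have j0 : 0 <= j%:R * (rho / 2) by rewrite mulr_ge0// divr_ge0// ltW.
  rewrite lerBlDr /t' minEle; case: ifP => _; first by rewrite lerDr.
  by move: tj; rewrite -natr1 mulrDl mul1r; lra.
have IH' := IH t' (le_trans at0 tt') t'b t'j.
apply: (vanish_disc (fh t at0 tb) (s := rho / 2)); first by rewrite divr_gt0.
move=> z zt; apply: IH'; apply: le_lt_trans (nm_dist _ (rc t) _) _.
have d2 : nm (rc t - rc t') <= rho / 2.
  rewrite -rcN -rcD nm_rc distrC ger0_norm ?subr_ge0//.
  by rewrite lerBlDr addrC ge_min lexx orbT.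
by rewrite [ltRHS]splitr; apply: ltr_leD.
Qed.

End Continuation.

(** * A holomorphic peak function *)

Section Peak.
Variables (R : realType).
Local Notation C := (CC R).

(* With [w = 1 - a z], the real part of [2 / w - 1] is the Poisson kernel, which
   has mean 1 on the unit circle but is small away from [z = 1] when [a] is
   close to 1.  Hence [`|1 + b (2 / w - 2)| < 1] there for small [b], although
   the value at [z = 0] is 1; then raise to a high power. *)
Lemma peak_function (eta kappa : R) : 0 < eta -> 0 < kappa ->
  exists2 P : C -> C^o, P 0 = 1 & exists2 r : R, 1 < r &
  (forall z, nm z <= r -> cdiff P z) /\
  (forall z, nm z = 1 -> eta <= nm (z - 1) -> nm (P z) <= kappa).
Proof.
(* The bound [eta / 2] yields |w| >= eta / 2 on the arc away from z = 1; then [eta ^+ 2 / 16] makes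
   1 - a^2 <= 2 c at most |w|^2 / 2 there. *)
move=> eta0 kappa0; pose c := Num.min (1 / 2) (Num.min (eta / 2) (eta ^+ 2 / 16)).
have c0 : 0 < c by rewrite !lt_min !divr_gt0// exprn_gt0.
have c1 : c <= 1 / 2 by rewrite ge_min lexx.
have c2 : c <= eta / 2 by rewrite !ge_min lexx orbT.
have c3 : c <= eta ^+ 2 / 16 by rewrite !ge_min lexx !orbT.
pose a := 1 - c.
have a0 : 0 < a by rewrite /a; lra.
have a1 : a < 1 by rewrite /a; lra.
pose w (z : C) := 1 - rc a * z.
(* This radius lies halfway between 1 and the pole [a^-1]. *)
have nw z : nm z <= (1 + a^-1) / 2 -> (1 - a) / 2 <= nm (w z).
  move=> za; have := nm_leB 1 (rc a * z); rewrite nm1 nmM (nm_rcp (ltW a0)).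
  have := ler_wpM2l (ltW a0) za; rewrite mulrA mulrDr divff ?gt_eqF// mulr1.
  rewrite -/(w z); lra.
have w0 z : nm z <= (1 + a^-1) / 2 -> w z != 0.
  move=> /nw h; apply: contraTneq h => ->; rewrite nm0 -ltNge /a; lra.
have r1 : 1 < (1 + a^-1) / 2 by have := invf_gt1 a0; rewrite a1; lra.
have wlow z : nm z = 1 -> eta <= nm (z - 1) -> eta / 2 <= nm (w z).
  move=> z1 ze; have := nm_leB (1 - z) (w z).
  have -> : 1 - z - w z = - (rc c * z).
    by rewrite /w /a rcD rcN rc1; ring.
  rewrite nmN nmM z1 mulr1 (nm_rcp (ltW c0)) nmC; lra.
(* [Q] bounds |2 / w - 2|^2 on the far arc. With [b * Q = 1 / 2] the quadratic term of |1 + b q|^2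
   is at most [b / 2], half of the gain [b] from the linear term. *)
pose Q := (4 / eta + 2) ^+ 2; have Q1 : 1 <= Q.
  by rewrite /Q; have := divr_gt0 (ltr0n R 4) eta0; move: (4 / eta) => y; nra.
pose b := 1 / (2 * Q).
have b0 : 0 < b by rewrite divr_gt0// mulr_gt0//; lra.
pose p (z : C) : C := 1 - 2 * rc b + 2 * rc b / w z.
have psmall z : nm z = 1 -> eta <= nm (z - 1) -> nm (p z) ^+ 2 <= 1 - b / 2.
  move=> z1 ze; pose q := 2 / w z - 2.
  have wz : w z != 0 by apply: w0; rewrite z1 ltW.
  have nwz : 0 < nm (w z) by exact: nm_gt0.
  have pq : p z = 1 + rc b * q by rewrite /p /q; ring.
  have nq : nm q ^+ 2 <= Q.
    rewrite /Q ler_pXn2r ?nnegrE ?nm_ge0 ?addr_ge0 ?divr_ge0 ?(ltW eta0)//.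
    apply: le_trans (nmB _ _) _; rewrite nmM nmV (nm_nat R 2) lerD2r.
    rewrite ler_pdivrMr// mulrAC ler_pdivlMr//.
    by have := wlow z z1 ze; lra.
  have Req : complex.Re q <= - (1 / 2).
    have h1 := nm_sqr (w z); have h2 := nm_sqr z; rewrite z1 expr1n in h2.
    have h3 : complex.Re q = 2 * complex.Re (w z) / nm (w z) ^+ 2 - 2.
      rewrite /q h1; case: (w z) => x y /=.
      ring.
    have h4 : 2 * complex.Re (w z) = 1 - a ^+ 2 + nm (w z) ^+ 2.
      rewrite h1 /w; move: h2; case: z {z1 ze wz nwz pq q nq h1 h3} => x y /=.
      by move=> h; nra.
    have h5 : eta ^+ 2 / 4 <= nm (w z) ^+ 2.
      by have := wlow z z1 ze; move: nwz; nra.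
    have h6 : 1 - a ^+ 2 <= nm (w z) ^+ 2 / 2 by rewrite /a; nra.
    rewrite h3 h4 lerBlDr ler_pdivrMr ?exprn_gt0//; lra.
  have -> : nm (p z) ^+ 2 = 1 + 2 * b * complex.Re q + b ^+ 2 * nm q ^+ 2.
    rewrite pq !nm_sqr; case: q {pq nq Req} => x y /=; ring.
  have bQ : b * Q = 1 / 2 by rewrite /b; field; rewrite gt_eqF//; lra.
  have h7 := ler_wpM2l (ltW b0) Req.
  have h8 : b ^+ 2 * nm q ^+ 2 <= b * (1 / 2).
    by rewrite -bQ mulrA -expr2 ler_wpM2l// sqr_ge0.
  lra.
have b1 : b < 2 by have := ler_wpM2l (ltW b0) Q1; have : b * Q = 1 / 2 by [rewrite /b; field; rewrite gt_eqF//; lra]; lra.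
have [N NP] : exists N, (1 - b / 2) ^+ N <= kappa ^+ 2.
  have u0 : 0 <= 1 - b / 2 by lra.
  have u1 : 1 - b / 2 < 1 by lra.
  by have [N /(_ N (leqnn N))] := expr_cvg u0 u1 (exprn_gt0 2 kappa0); exists N.
exists (fun z => p z ^+ N).
  by rewrite /p /w mulr0 subr0 divr1 subrK expr1n.
exists ((1 + a^-1) / 2) => //; split=> [z zr|z z1 ze]; last first.
  rewrite -(@ler_pXn2r _ 2)// ?nnegrE ?nm_ge0 ?(ltW kappa0)// -nmX -exprM mulnC exprM nmX nmX.
  by apply: le_trans NP; apply: lerXn2r; rewrite ?nnegrE ?sqr_ge0 ?psmall// (le_trans (sqr_ge0 _) (psmall z z1 ze)).
have [d pd] : cdiff (p : C -> C^o) z.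
  have [d1 hd1] : cdiff (fun x : C => x^-1 *: (2 * rc b : C^o)) (w z).
    exact: isd_inv_scale (w0 z zr) (isd_cst _ _).
  pose f (x : C) : C^o := x^-1 *: (2 * rc b : C^o).
  have wE x : 1 + - rc a * x = w x by rewrite /w mulNr.
  have hd2 : isd (fun x => f (1 + - rc a * x)) z (- rc a *: d1).
    by apply: isd_comp_affine; rewrite wE.
  have hd3 := isdD (@isd_cst R C^o (1 - 2 * rc b) z) hd2.
  exists (0 + (- rc a) *: d1); apply: isd_ext ltr01 _ hd3 => h _.
  by rewrite wE /p /f [_ / w _]mulrC.
elim: N {NP} => [|N [dN hN]]; first by exists 0; exact: isd_cst.
apply: (@isd_cdiff _ _ _ _ (d *: (p z ^+ N : C^o) + p z *: dN)).
have := @isd_scale _ _ p (fun x => p x ^+ N : C^o) z d dN pd hN.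
move=> hN1; apply: (isd_ext (f := fun x => p x *: (p x ^+ N : C^o)) (g := fun x => p x ^+ N.+1 : C^o) ltr01 _ hN1).
by move=> h _; rewrite exprS.
Qed.

End Peak.

(** * Gateaux holomorphic maps *)

Section GateauxHolomorphy.
Variables (R : realType) (n : nat).
Local Notation C := (CC R).
Local Notation X := 'rV[C]_n.+1.
Implicit Types (F Phi : X -> X) (D : X -> Prop) (x z v : X) (t : C).

Definition fdiff F x : Prop := exists L : X -> X,
  [/\ forall u v, L (u + v) = L u + L v, forall c v, L (c *: v) = c *: L v,
      exists2 K : R, 0 <= K & forall v, nm (L v) <= K * nm v &
      forall e : R, 0 < e -> exists2 r : R, 0 < r &
        forall h, nm h < r -> nm (F (x + h) - F x - L h) <= e * nm h].

(** Holomorphy along complex lines only: together with a bound it gives Lipschitz estimates, hence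
    continuity, by the one-variable results. *)
Definition ghol D Phi : Prop :=
  forall z, D z -> forall v, cdiff (fun t => Phi (z + t *: v)) 0.

Definition nball z (r : R) : X -> Prop := fun y => nm (y - z) < r.

Lemma cdiff_shift (g : C -> X) t0 :
  cdiff (fun t => g (t0 + t)) 0 <-> cdiff g t0.
Proof.
split=> -[d gd]; exists d => e e0; have [r r0 gr] := gd e e0; exists r => // h hr.
  by have := gr h hr; rewrite add0r addr0.
by rewrite add0r addr0 gr.
Qed.

Lemma ghol_line D Phi z v t0 : ghol D Phi -> D (z + t0 *: v) ->
  cdiff (fun t => Phi (z + t *: v)) t0.
Proof.
move=> Ph Dz; apply/cdiff_shift; have := Ph _ Dz v.
by under eq_fun do rewrite -addrA -scalerDl.
Qed.

Lemma fdiff_econt F x : fdiff F x -> econt F x.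
Proof.
move=> [L [_ _ [K K0 LK] Fx]] e e0; have [r r0 Fr] := Fx 1 ltr01.
have K1 : 0 < 1 + K by rewrite ltr_pwDl.
exists (Num.min r (e / (1 + K))); first by rewrite lt_min r0 divr_gt0.
move=> y; rewrite lt_min ltr_pdivlMr// => /andP[yr ye].
have := Fr _ yr; rewrite subrKC => h.
apply: le_lt_trans (nm_leB _ (L (y - x))) _; apply: le_lt_trans ye.
by apply: le_trans (lerD (LK _) h) _; rewrite -mulrDl mulrC (addrC K).
Qed.

Lemma cdiff_fcomp F (g : C -> X) t : cdiff g t -> fdiff F (g t) ->
  cdiff (F \o g) t.
Proof.
move=> [d gd] [L [LD LZ [K K0 LK] Fx]]; exists (L d) => e e0.
have LN v : L (- v) = - L v by rewrite -scaleN1r LZ scaleN1r.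
pose A := K + (nm d + 1).
have A0 : 0 < A by rewrite ltr_wpDl// ltr_wpDl// nm_ge0.
pose e1 := Num.min 1 (e / A).
have e10 : 0 < e1 by rewrite lt_min ltr01 divr_gt0.
have [r r0 Fr] := Fx _ e10; have [s s0 gs] := gd _ e10.
have [u u0 gu] := cdiff_econt (ex_intro _ d gd) r0.
exists (Num.min s u); first by rewrite lt_min s0.
move=> h; rewrite lt_min => /andP[hs hu].
set k := g (t + h) - g t.
have kr : nm k < r by apply: gu; rewrite addrC addKr.
have kd : nm (k - h *: d) <= e1 * nm h by exact: gs.
have kn : nm k <= (nm d + 1) * nm h.
  apply: le_trans (nm_leB _ (h *: d)) _; rewrite nmZ mulrDl [nm h * _]mulrC lerD2l.
  by apply: le_trans kd _; rewrite ler_wpM2r ?nm_ge0// ge_min lexx.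
have Lk w : L (w - h *: d) = L w - h *: L d by rewrite LD LN LZ.
have -> : (F \o g) (t + h) - (F \o g) t - h *: L d =
    (F (g t + k) - F (g t) - L k) + L (k - h *: d).
  by rewrite Lk /= /k subrKC addrA subrK.
apply: le_trans (nmD _ _) _.
apply: le_trans (lerD (Fr _ kr) (LK _)) _.
have h1 := ler_wpM2l (ltW e10) kn; have h2 := ler_wpM2l K0 kd.
apply: le_trans (lerD h1 h2) _.
have -> : e1 * ((nm d + 1) * nm h) + K * (e1 * nm h) = (e1 * A) * nm h.
  by rewrite /A; ring.
by rewrite ler_wpM2r ?nm_ge0// -ler_pdivlMr// ge_min lexx orbT.
Qed.

Lemma ghol_subset D D' Phi : (forall z, D' z -> D z) -> ghol D Phi -> ghol D' Phi.
Proof. by move=> DD h z /DD; exact: h. Qed.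

(** On the complex line through [z] and [z'] the parameter disc of radius [r / 2 / nm v] stays in
    the ball, and it contains 1 because |v| < r / 2. *)
Lemma ghol_lip Phi p (r M : R) : ghol (nball p r) Phi ->
  (forall z, nball p r z -> nm (Phi z) <= M) ->
  forall z z', nball p (r / 4) z -> nball p (r / 4) z' ->
  nm (Phi z' - Phi z) <= 16 * M / r * nm (z' - z).
Proof.
move=> Ph PM z z' zr z'r; have [->|zz] := eqVneq z' z.
  by rewrite !subrr !nm0 mulr0.
pose v := z' - z; have v0 : 0 < nm v by rewrite nm_gt0// subr_eq0.
have r0 : 0 < r by have := le_lt_trans (nm_ge0 _) zr; lra.
pose s := r / 2 / nm v; have s0 : 0 < s by rewrite !divr_gt0.
have line t : nm (t - 0) < s -> nball p r (z + t *: v).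
  rewrite subr0 ltr_pdivlMr// => ts; rewrite /nball addrAC.
  by apply: le_lt_trans (nmD _ _) _; rewrite nmZ; move: zr ts; rewrite /nball; lra.
have gh : hol (fun t => Phi (z + t *: v)) 0 s.
  by move=> t /line; exact: ghol_line.
have s1 : nm (1 : C) < s.
  rewrite nm1 ltr_pdivlMr// mul1r; have := nm_dist z' p z.
  by rewrite (nmC p z) -/v; move: zr z'r; rewrite /nball; lra.
have := lip_est gh (fun t ts => PM _ (line t ts)) s1.
rewrite add0r scale1r scale0r addr0 subrKC nm1 mulr1 => h.
apply: le_trans h _; rewrite le_eqVlt; apply/orP; left; apply/eqP.
by rewrite /s -/v; field; rewrite !gt_eqF.
Qed.

Lemma ghol_econt Phi p (r M : R) : ghol (nball p r) Phi ->
  (forall z, nball p r z -> nm (Phi z) <= M) ->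
  forall z, nball p r z -> econt Phi z.
Proof.
move=> Ph PM z zp e e0.
pose s := r - nm (z - p); have s0 : 0 < s by rewrite subr_gt0.
have sub y : nball z s y -> nball p r y.
  by rewrite /nball /s => ys; have := nm_dist y z p; lra.
have Ps := ghol_subset sub Ph.
have M0 : 0 <= M by exact: le_trans (nm_ge0 _) (PM _ zp).
have K0 : 0 < 16 * M / s + 1 by rewrite ltr_wpDl// divr_ge0 ?mulr_ge0// ltW.
exists (Num.min (s / 4) (e / (16 * M / s + 1))).
  by rewrite lt_min !divr_gt0.
move=> y; rewrite lt_min => /andP[ys]; rewrite ltr_pdivlMr// => ye.
have zz : nball z (s / 4) z by rewrite /nball subrr nm0 divr_gt0.
have Ms w : nball z s w -> nm (Phi w) <= M by move=> /sub; exact: PM.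
have h := ghol_lip Ps Ms zz ys; apply: le_lt_trans h _.
apply: le_lt_trans ye; rewrite mulrC ler_wpM2l ?nm_ge0// lerDl//.
Qed.

Lemma ulim_ghol (u : nat -> X -> X) Phi p (r M : R) :
  (forall k, ghol (nball p r) (u k)) ->
  (forall k z, nball p r z -> nm (u k z) <= M) ->
  (forall z, nball p r z -> ucv (u^~ z) (Phi z)) ->
  ghol (nball p r) Phi.
Proof.
move=> uh uM uP z zp v.
pose s := (r - nm (z - p)) / (nm v + 1).
have v0 : 0 < nm v + 1 by rewrite ltr_wpDl// nm_ge0.
have s0 : 0 < s by rewrite divr_gt0// subr_gt0.
have line t : nm (t - 0) < s -> nball p r (z + t *: v).
  rewrite subr0 ltr_pdivlMr// => ts; rewrite /nball addrAC.
  apply: le_lt_trans (nmD _ _) _; rewrite nmZ.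
  by have := nm_ge0 t; have := nm_ge0 v; nra.
have := @ulim_hol _ _ (fun k t => u k (z + t *: v)) (fun t => Phi (z + t *: v)) 0 s M.
apply.
- by move=> k t ts; exact: ghol_line (uh k) (line _ ts).
- by move=> k t ts; apply: uM; exact: line.
- by move=> t ts; apply: uP; exact: line.
- by rewrite subrr nm0.
Qed.

End GateauxHolomorphy.

(** * Extension across a Lipschitz boundary *)

Section LocalExtension.
Variables (R : realType) (n : nat).
Local Notation C := (CC R).
Local Notation X := 'rV[C]_n.+1.
Implicit Types (x y z v d q : X) (s t : C).

Definition adherent (Om : X -> Prop) x : Prop :=
  forall e : R, 0 < e -> exists2 y, Om y & nm (y - x) < e.

(** An interior cone condition, uniform over the adherent points near [q]. The parameter [s] is
    complex because F (x + s d) will be continued holomorphically in s. *)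
Definition sector_at (Om : X -> Prop) q d (k e : R) : Prop :=
  forall x, adherent Om x -> nm (x - q) < e ->
  forall s, nm s < e -> k * `|complex.Im s| < complex.Re s -> Om (x + s *: d).

Variables (Om : X -> Prop) (F : X -> X) (M0 : R).
Hypothesis Om_open : forall x, Om x ->
  exists2 r : R, 0 < r & forall y, nm (y - x) < r -> Om y.
Hypothesis F_diff : forall x, Om x -> fdiff F x.
Hypothesis Om_bounded : forall x, adherent Om x -> nm x <= M0.

Lemma ucv_adherent (u : nat -> X) x :
  (forall k, adherent Om (u k)) -> ucv u x -> adherent Om x.
Proof.
move=> uO ux e e0; have e20 : 0 < e / 2 by rewrite divr_gt0.
have [k /= kx] := filter_ex (ux _ e20).
have [y Oy yk] := uO k _ e20; exists y => //.
by apply: le_lt_trans (nm_dist _ (u k) _) _; rewrite [ltRHS]splitr ltrD.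
Qed.

Lemma F_locally_bounded x : Om x -> exists2 r : R, 0 < r &
  forall y, nm (y - x) < r -> Om y /\ nm (F y) <= nm (F x) + 1.
Proof.
move=> Ox; have [r r0 rO] := Om_open Ox.
have [s s0 sF] := fdiff_econt (F_diff Ox) ltr01.
exists (Num.min r s); first by rewrite lt_min r0.
move=> y; rewrite lt_min => /andP[/rO Oy /sF Fy]; split=> //.
by apply: le_trans (nm_leB _ (F x)) _; rewrite lerD2l ltW.
Qed.

(** Compactness: a sequence with unbounded values would have limits [x] and [s] with [x + s *: d] in
    [Om], where [F] is locally bounded. The margin [c] keeps the limit [s] inside the open
    sector. *)
Lemma sector_bounded q d (k e c : R) : sector_at Om q d k e -> 0 < e -> 0 < c ->
  exists2 M : R, 0 <= M & forall x, adherent Om x -> nm (x - q) <= e / 2 ->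
    forall s, nm s <= e / 2 -> k * `|complex.Im s| + c <= complex.Re s ->
    nm (F (x + s *: d)) <= M.
Proof.
move=> sec e0 c0; apply: contrapT => none.
have /choice[u uP] : forall j : nat, exists p : X * C,
    [/\ adherent Om p.1, nm (p.1 - q) <= e / 2, nm p.2 <= e / 2,
        k * `|complex.Im p.2| + c <= complex.Re p.2 &
        j%:R < nm (F (p.1 + p.2 *: d))].
  move=> j; apply: contrapT => /forallNP nj; apply: none.
  exists j%:R => [|x Ox xq s se sc]; first by rewrite ler0n.
  by rewrite leNgt; apply/negP => h; exact: (nj (x, s)).
have [x ux] : exists x, ucv (fun j => (u j).1) x.
  by apply: (@ucv_exV _ _ _ M0) => j; apply: Om_bounded; have [] := uP j.
have [s us] : exists s, ucv (fun j => (u j).2) s.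
  by apply: (@ucv_exC _ _ (e / 2)) => j; have [] := uP j.
have Ox : adherent Om x by apply: (ucv_adherent _ ux) => j; have [] := uP j.
have xq : nm (x - q) <= e / 2.
  by apply: (ucv_le ux); apply: filterE => j /=; have [] := uP j.
have se : nm s <= e / 2 by apply: (ucv_nm_le us) => j; have [] := uP j.
have sc : k * `|complex.Im s| < complex.Re s.
  (* With r = c / k1, passing to the limit costs at most (1 + |k|) r of the margin c = (|k| + 2)
     r. *)
  pose k1 := `|k| + 2; have k10 : 0 < k1 by rewrite ltr_wpDl.
  have [j /= js] := filter_ex (us _ (divr_gt0 c0 k10)).
  have [_ _ _ sj _] := uP j.
  have hI := le_lt_trans (nm_Im _) js; have hR := le_lt_trans (nm_Re _) js.
  set r := c / k1 in js hI hR; have rc1 : r * k1 = c by rewrite /r divfK// gt_eqF.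
  have r0 : 0 < r by rewrite divr_gt0.
  have ImB : complex.Im ((u j).2 - s) = complex.Im (u j).2 - complex.Im s.
    by case: ((u j).2) => ? ?; case: (s).
  have ReB : complex.Re ((u j).2 - s) = complex.Re (u j).2 - complex.Re s.
    by case: ((u j).2) => ? ?; case: (s).
  rewrite ImB in hI; rewrite ReB in hR.
  set a := complex.Im (u j).2 in hI sj; set b := complex.Re (u j).2 in hR sj.
  have h1 : b - complex.Re s < r by exact: le_lt_trans (ler_norm _) hR.
  have h2 : `| `|a| - `|complex.Im s| | < r by exact: le_lt_trans (ler_dist_dist _ _) hI.
  have h3 : k * `|complex.Im s| - k * `|a| <= `|k| * r.
    rewrite -mulrBr; apply: le_trans (ler_norm _) _.
    by rewrite normrM ler_wpM2l// distrC ltW.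
  rewrite /k1 in rc1; lra.
have xqe : nm (x - q) < e by apply: le_lt_trans xq _; lra.
have see : nm s < e by apply: le_lt_trans se _; lra.
have [r r0 rF] := F_locally_bounded (sec x Ox xqe s see sc).
have d0 : 0 < nm d + 1 by rewrite ltr_wpDl// nm_ge0.
have r20 : 0 < r / 2 by rewrite divr_gt0.
have h1 := ux _ r20; have h2 := us _ (divr_gt0 r20 d0).
have [N NP] : exists N : nat, nm (F (x + s *: d)) + 1 < N%:R.
  by exists (Num.truncn (nm (F (x + s *: d)) + 1)).+1; rewrite truncnS_gt.
have h3 : UU [set j | (N <= j)%N] by exact: (@UU_eventually _ N).
have [j /= [[j1 j2] j3]] := filter_ex (filterI (filterI h1 h2) h3).
have [_ _ _ _ ] := uP j; apply/negP; rewrite -leNgt.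
have [_ Fj] : Om ((u j).1 + (u j).2 *: d) /\
    nm (F ((u j).1 + (u j).2 *: d)) <= nm (F (x + s *: d)) + 1.
  apply: rF; rewrite opprD addrACA -scalerBl.
  apply: le_lt_trans (nmD _ _) _; rewrite nmZ [ltRHS]splitr ltr_leD//.
  rewrite ltr_pdivlMr// in j2; apply: le_trans _ (ltW j2).
  by rewrite ler_wpM2l ?nm_ge0// lerDl.
by apply: le_trans Fj _; apply: le_trans (ltW NP) _; rewrite ler_nat.
Qed.

Lemma cdiff_fshift Phi z v t (a : C -> C^o) d : cdiff (fun t => Phi (z + t *: v)) t ->
  cdiff a t -> Om (Phi (z + t *: v) + a t *: d) ->
  cdiff (fun t => F (Phi (z + t *: v) + a t *: d)) t.
Proof.
move=> [p hp] [b hb] hO.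
apply: (@cdiff_fcomp _ _ F (fun t => Phi (z + t *: v) + a t *: d)); last exact: F_diff.
have h := @isd_scale _ _ a (fun=> d) t b 0 hb (isd_cst _ _).
exact: isd_cdiff (isdD hp h).
Qed.

End LocalExtension.

(** * The Hartogs continuation argument *)

Section Hartogs.
Variables (R : realType) (n : nat).
Local Notation C := (CC R).
Local Notation X := 'rV[C]_n.+1.

Lemma isdZ (c : C) (f : C -> X) z d :
  isd f z d -> isd (fun t => c *: f t) z (c *: d).
Proof.
move=> fd e e0; have c0 : 0 < nm c + 1 by rewrite ltr_wpDl ?nm_ge0.
have [r r0 fr] := fd _ (divr_gt0 e0 c0); exists r => // h hr.
rewrite scalerA [h * c]mulrC -scalerA -!scalerBr nmZ.
apply: le_trans (ler_wpM2l (nm_ge0 _) (fr h hr)) _.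
rewrite mulrA; apply: ler_wpM2r; first exact: nm_ge0.
by rewrite mulrA ler_pdivrMr// [nm c * e]mulrC ler_wpM2l ?(ltW e0)// lerDl.
Qed.

Lemma cdiffB (f g : C -> X) z : cdiff f z -> cdiff g z ->
  cdiff (fun t => f t - g t) z.
Proof.
move=> [d fd] [d' gd]; have := isdD fd (isdZ (-1) gd) => h.
apply: (@isd_cdiff _ _ _ _ (d + -1 *: d')).
apply: (isd_ext (f := fun t => f t + -1 *: g t)
  (g := fun t => f t - g t) ltr01 _ h) => y _.
by rewrite scaleN1r.
Qed.

Lemma cdiff_avg (g : C -> C -> X) z k :
  (forall w, nm w = 1 -> cdiff (g w) z) -> cdiff (fun t => avg (g^~ t) k) z.
Proof.
move=> gd; rewrite /avg.
suff [d hd] : cdiff (fun t => \sum_(j < nroots k) g (root2 R k ^+ j) t) z.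
  exact: isd_cdiff (isdZ _ hd).
pose S s t := \sum_(j <- s) g (root2 R k ^+ (j : 'I_(nroots k))) t.
suff H s : cdiff (S s) z by exact: H.
elim: s => [|j s [d hd]].
  apply: (@isd_cdiff _ _ _ _ 0).
  apply: (isd_ext (f := fun=> 0) (g := S [::]) ltr01 _ (isd_cst 0 z)) => h _.
  by rewrite /S big_nil.
have [d' hd'] := gd _ (nm_root2X R k j).
apply: (@isd_cdiff _ _ _ _ (d' + d)).
apply: (isd_ext (f := fun t => g (root2 R k ^+ j) t + S s t) (g := S (j :: s))
  ltr01 _ (isdD hd' hd)) => h _.
by rewrite /S big_cons.
Qed.

(* Hartogs: the circle averages of [g] extend [G] analytically along the whole
   segment and are bounded there by the values of [g] on the circle alone. *)
Lemma hartogs_segment (g : C -> C -> X) (G : C -> X) (r rho l0 M : R) :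
  1 < r -> 0 < rho ->
  (forall t l w, 0 <= t -> t <= l0 -> nm (l - rc t) < rho -> nm w = 1 ->
     nm (g w l) <= M /\ cdiff (g w) l) ->
  (forall l, nm (l - rc l0) < rho -> hol (g^~ l) 0 r /\ g 0 l = G l) ->
  (forall s, 0 < s -> s <= l0 -> exists2 rs : R, 0 < rs & rs <= rho /\
     forall t, s <= t -> t <= l0 -> hol G (rc t) rs) ->
  forall s, 0 < s -> s <= l0 -> nm (G (rc s)) <= M.
Proof.
move=> r1 rho0 gM gG Gh s s0 sl0.
pose I k l := avg (g^~ l) k.
pose N (l : C) := exists t : R, [/\ 0 <= t, t <= l0 & nm (l - rc t) < rho].
have IM k l : N l -> nm (I k l) <= M.
  by move=> [t [t0 tl lt]]; apply: avg_le => w w1; have [] := gM t l w t0 tl lt w1.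
have /choice[J JP] : forall l, exists y, N l -> ucv (I^~ l) y.
  move=> l; have [Nl|nN] := pselect (N l); last by exists 0.
  by have [y hy] := @ucv_exV _ _ (I^~ l) M (fun k => IM k l Nl); exists y.
have JM l : N l -> nm (J l) <= M.
  by move=> Nl; apply: ucv_nm_le (JP l Nl) _ => k; exact: IM.
have [rs rs0 [rsr Gs]] := Gh s s0 sl0.
have Nin t l : s <= t -> t <= l0 -> nm (l - rc t) < rs -> N l.
  move=> st tl lt; exists t; split=> //; first exact: le_trans (ltW s0) st.
  exact: lt_le_trans lt rsr.
have Js t : s <= t -> t <= l0 -> hol J (rc t) rs.
  move=> st tl; apply: (@ulim_hol _ _ I J (rc t) rs M).
  - move=> k l /(Nin _ _ st tl)[t' [t'0 t'l lt']].
    by apply: cdiff_avg => w w1; have [] := gM t' l w t'0 t'l lt' w1.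
  - by move=> k l /(Nin _ _ st tl); exact: IM.
  - by move=> l /(Nin _ _ st tl); exact: JP.
(* Mean value property: near [l0] the function [g^~ l] is holomorphic on a full disc, so its
   averages converge to its value at the centre. *)
have Jend l : nm (l - rc l0) < rs -> J l = G l.
  move=> ll; have lr := lt_le_trans ll rsr.
  have [gh g0] := gG l lr.
  have z1 : nm (0 : C) < 1 by rewrite nm0.
  have := cauchy_formula0 r1 gh z1; rewrite g0 => h.
  apply: ucv_unique (JP l (Nin _ _ sl0 (lexx _) ll)) _.
  apply: ucv_ext h; apply: filterE => k /=; apply: eq_avg => w w1.
  rewrite subr0 divff ?scale1r//.
  by apply: contraTneq (ltr01 : 0 < 1 :> R) => w0; rewrite -w1 w0 nm0 ltxx.
have Eh t : s <= t -> t <= l0 -> hol (fun l => J l - G l) (rc t) rs.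
  by move=> st tl l lt; apply: cdiffB; [exact: Js st tl l lt|exact: Gs st tl l lt].
have E0 l : nm (l - rc l0) < rs -> J l - G l = 0 by move=> /Jend ->; rewrite subrr.
(* The equality is continued from [l0] down to [s]. The radius [rs] may depend on [s], but the bound
   [M] of the averages does not. *)
have /eqP := vanish_segment rs0 Eh E0 (lexx s) sl0.
rewrite subr_eq0 => /eqP <-; apply: JM; apply: (Nin s) (lexx s) sl0 _.
by rewrite subrr nm0.
Qed.

End Hartogs.

(** * Bounds near a boundary point *)

Section Extension.
Variables (R : realType) (n : nat).
Local Notation C := (CC R).
Local Notation X := 'rV[C]_n.+1.

Lemma Re_bounds (t : R) (w : C) :
  t - nm w <= complex.Re (rc t + w) /\ `|complex.Im (rc t + w)| <= nm w.
Proof.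
have := nm_Re w; have := nm_Im w; case: w => a b /=; rewrite add0r => h1 h2.
by split=> //; have := ler_norm (- a); rewrite normrN; lra.
Qed.

Variables (Om : X -> Prop) (F : X -> X) (M0 : R).
Hypothesis Om_open : forall x, Om x ->
  exists2 r : R, 0 < r & forall y, nm (y - x) < r -> Om y.
Hypothesis F_diff : forall x, Om x -> fdiff F x.
Hypothesis Om_bounded : forall x, adherent Om x -> nm x <= M0.

Definition dense_preimage (Phi : X -> X) z0 (r0 : R) : Prop :=
  forall z, nball z0 r0 z -> forall e : R, 0 < e ->
  exists2 z1, nm (z1 - z) < e & Om (Phi z1).

Lemma cdiff_shift_param x d (c l : C) : Om (x + (l + c) *: d) ->
  cdiff (fun l => F (x + (l + c) *: d)) l.
Proof.
move=> hO; apply: (@cdiff_fcomp _ _ F (fun l => x + (l + c) *: d)); last exact: F_diff.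
apply: (@isd_cdiff _ _ _ _ d) => e e0; exists 1 => // h _.
rewrite [X in nm X](_ : _ = 0) ?nm0 ?mulr_ge0 ?nm_ge0 ?(ltW e0)//.
rewrite opprD addrACA subrr add0r -scalerBl -scalerBl.
by rewrite [X in X *: _](_ : _ = 0) ?scale0r//; ring.
Qed.

(** [hartogs_segment] is applied to the circles w -> z + w v with v = z1 - z0 and [Phi z1] in [Om],
    shifted along [d] by l + a(w), where a(w) = ep (1 - P(w)). As a(0) = 0, the centre gives F (Phi
    z + l d). Near w = 1 the bound comes from a neighbourhood of [Phi z1]; elsewhere a(w) is close
    to ep, and [sector_bounded] applies with a margin that survives l -> 0. *)
Lemma boundary_bound Phi z0 d (r0 k e : R) : 0 < r0 -> 0 <= k -> 0 < e ->
  ghol (nball z0 r0) Phi ->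
  (forall z, nball z0 r0 z -> adherent Om (Phi z)) ->
  dense_preimage Phi z0 r0 ->
  sector_at Om (Phi z0) d k e ->
  exists r l0 M : R, [/\ 0 < r, r <= r0, 0 < l0 &
    forall z, nball z0 r z -> forall s, 0 < s -> s <= l0 ->
      Om (Phi z + rc s *: d) /\ nm (F (Phi z + rc s *: d)) <= M].
Proof.
move=> r00 k0 e0 Ph PO Pd sec; set q := Phi z0 in sec.
have PM z : nball z0 r0 z -> nm (Phi z) <= M0 by move=> /PO; exact: Om_bounded.
have Pc := ghol_econt Ph PM.
have z0z0 : nball z0 r0 z0 by rewrite /nball subrr nm0.
have e20 : 0 < e / 2 by rewrite divr_gt0.
have eh : e / 2 < e by rewrite ltr_pdivrMr// ltr_pMr// ltr1n.
have [de de0 deP] := Pc z0 z0z0 _ e20.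
pose e1 := Num.min de r0.
have e10 : 0 < e1 by rewrite lt_min de0.
have P1 z : nm (z - z0) < e1 ->
    [/\ nball z0 r0 z, nm (Phi z - q) <= e / 2 & adherent Om (Phi z)].
  rewrite lt_min => /andP[zd zr]; split=> //; last exact: PO.
  exact/ltW/deP.
have e140 : 0 < e1 / 4 by rewrite divr_gt0.
have [z1 z1z0 Oz1] := Pd z0 z0z0 _ e140.
pose v := z1 - z0.
have z1r : nball z0 r0 z1 by have [] := P1 z1 _; [lra|].
have [rh1 rh10 rh1P] := F_locally_bounded Om_open F_diff Oz1.
have rh120 : 0 < rh1 / 2 by rewrite divr_gt0.
have [d1 d10 d1P] := Pc z1 z1r _ rh120.
have v0 : 0 < nm v + 1 by rewrite ltr_wpDl ?nm_ge0.
have nd0 : 0 < nm d + 1 by rewrite ltr_wpDl ?nm_ge0.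
(* The first three bounds keep the argument of [F] in the neighbourhood of [Phi z1] when w is near
   1, z near z0 and the shift small; [e / 2] keeps the shifts within the range of the sector. *)
pose eta := Num.min (Num.min (d1 / 2 / (nm v + 1)) (d1 / 2))
  (Num.min (rh1 / 2 / (nm d + 1)) (e / 2)).
have eta0 : 0 < eta by rewrite !lt_min !divr_gt0.
have [[et1 et2] [et3 et4]] : (eta <= d1 / 2 / (nm v + 1) /\ eta <= d1 / 2) /\
    (eta <= rh1 / 2 / (nm d + 1) /\ eta <= e / 2).
  have : eta <= eta by []. rewrite {2}/eta !le_min.
  by move=> /andP[/andP[? ?] /andP[? ?]].
have near1 z (w s : C) : nm (z - z0) < eta -> nm (w - 1) < eta -> nm s < eta ->
    Om (Phi (z + w *: v) + s *: d) /\
    nm (F (Phi (z + w *: v) + s *: d)) <= nm (F (Phi z1)) + 1.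
  move=> zz ww ss; apply: rh1P; rewrite addrAC.
  have h1 : nm (Phi (z + w *: v) - Phi z1) < rh1 / 2.
    apply: d1P; have -> : z + w *: v - z1 = (z - z0) + (w - 1) *: v.
      by rewrite scalerBl scale1r /v opprB addrACA [- z0 + _]addrC addrA
        addrAC !addrA subrK.
    apply: le_lt_trans (nmD _ _) _; rewrite nmZ [ltRHS]splitr ltrD//.
      exact: lt_le_trans zz et2.
    have := lt_le_trans ww et1; rewrite ltr_pdivlMr// => h.
    by apply: le_lt_trans h; rewrite ler_wpM2l ?nm_ge0// lerDl.
  apply: le_lt_trans (nmD _ _) _; rewrite nmZ [ltRHS]splitr ltrD//.
  have := lt_le_trans ss et3; rewrite ltr_pdivlMr// => h.
  by apply: le_lt_trans h; rewrite ler_wpM2l ?nm_ge0// lerDl.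
have k10 : 0 < 1 + k by rewrite ltr_pwDl.
(* [l - rc t] and [ep * P w] are each at most [rho = ep * kap] off the arc near 1. Together they
   cost [2 * rho * (1 + k) = ep / 2], half of the shift [ep]. *)
pose kap := 1 / (4 * (1 + k)).
have kap0 : 0 < kap by rewrite divr_gt0// mulr_gt0.
have kapE : kap * (1 + k) = 1 / 4 by rewrite /kap; field; rewrite gt_eqF.
have [P P0 [rP rP1 [Pcd Psmall]]] := peak_function eta0 kap0.
have [w wr|T T0 PT] := @bounded_disc _ _ P rP; first exact/cdiff_econt/Pcd.
(* The bound 2 keeps z + w v within [e1] of z0, as z - z0 and v are both shorter than [e1 / 4]. *)
pose r := Num.min rP 2; have r1 : 1 < r by rewrite lt_min rP1 ltr1n.
have [rrP r2] : r <= rP /\ r <= 2 by rewrite !ge_min !lexx orbT.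
pose ep := eta / (2 * (1 + T) * (k + 4)).
have T1 : 0 < 1 + T by rewrite ltr_pwDl.
have k4 : 0 < k + 4 by rewrite ltr_wpDl.
have ep0 : 0 < ep by rewrite divr_gt0// !mulr_gt0.
pose b := ep * (1 + T); have b0 : 0 < b by rewrite mulr_gt0.
have epb : ep <= b by rewrite /b ler_peMr ?(ltW ep0)// lerDl.
have bE : b * (k + 4) = eta / 2.
  by rewrite /b /ep; field; rewrite !gt_eqF.
pose rho := ep * kap; have rho0 : 0 < rho by rewrite mulr_gt0.
have kap1 : kap <= 1 by nra.
have rhob : rho <= b by apply: le_trans _ epb; rewrite /rho ler_piMr ?(ltW ep0).
(* Around [l0] the shifts of the whole disc lie in the sector: they deviate from [l0] by at most
   [rho + b], and [(rho + b) * (1 + k) < (k + 2) * b]. The factor [k + 4] in [ep] keeps every shift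
   below [eta]. *)
pose l0 := (k + 2) * b; have l00 : 0 < l0 by rewrite mulr_gt0// ltr_wpDl.
have size : l0 + rho + b <= eta / 2 by rewrite -bE /l0; lra.
pose a (w : C) : C^o := rc ep * (1 - P w).
have na w : nm w <= rP -> nm (a w) <= b.
  move=> wr; rewrite nmM (nm_rcp (ltW ep0)) /b ler_wpM2l ?(ltW ep0)//.
  by apply: le_trans (nmB _ _) _; rewrite nm1 lerD2l PT.
have a0 : a 0 = 0 by rewrite /a P0 subrr mulr0.
have acd w : nm w <= rP -> cdiff a w.
  move=> /Pcd[dP hP].
  pose h := isdD (@isd_cst R C^o (rc ep) w)
    (@isd_scale R C^o (fun=> - rc ep) P w 0 dP _ hP).
  apply: (@isd_cdiff _ _ _ _ (0 + (0 *: P w + - rc ep *: dP))).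
  apply: (isd_ext (g := a) ltr01 _ (h _)) => [y _|e' e'0].
    by rewrite /a mulrBr mulr1 scaleNr.
  exists 1 => // y _; rewrite subrr mulr0 subr0 nm0 mulr_ge0 ?nm_ge0//.
  exact: ltW.
pose e2 := Num.min eta (e1 / 4); have e20' : 0 < e2 by rewrite lt_min eta0.
have [M2 M20 secM] := sector_bounded Om_open F_diff Om_bounded sec e0
  (divr_gt0 ep0 (ltr0n R 2)).
pose M := Num.max (nm (F (Phi z1)) + 1) M2.
have dsum (t : R) (l w : C) : 0 <= t -> t <= l0 -> nm (l - rc t) < rho ->
    nm w <= rP -> nm (l + a w) < eta.
  move=> t0 tl lt /na aw; have := nm_leB l (rc t); rewrite (nm_rcp t0).
  have := nmD l (a w); move: size; lra.
have onN (z : X) (t : R) (l w : C) : nm (z - z0) < e2 -> 0 <= t -> t <= l0 ->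
    nm (l - rc t) < rho -> nm w = 1 ->
    Om (Phi (z + w *: v) + (l + a w) *: d) /\
    nm (F (Phi (z + w *: v) + (l + a w) *: d)) <= M.
  rewrite lt_min => /andP[ze ze1] t0 tl lt w1.
  have wr : nm w <= rP by rewrite w1 ltW.
  have ss := dsum t l w t0 tl lt wr.
  have [wn|wf] := ltP (nm (w - 1)) eta.
    by have [h1 h2] := near1 z w _ ze wn ss; split=> //; rewrite le_max h2.
  have [_ xq xO] : [/\ nball z0 r0 (z + w *: v), nm (Phi (z + w *: v) - q) <= e / 2
      & adherent Om (Phi (z + w *: v))].
    apply: P1; rewrite addrAC; apply: le_lt_trans (nmD _ _) _.
    by rewrite nmZ w1 mul1r; move: z1z0; rewrite -/v; lra.
  have sE : l + a w = rc (t + ep) + ((l - rc t) - rc ep * P w).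
    by rewrite /a rcD; ring.
  have nu : nm ((l - rc t) - rc ep * P w) <= 2 * rho.
    apply: le_trans (nmB _ _) _; rewrite nmM (nm_rcp (ltW ep0)).
    have := ler_wpM2l (ltW ep0) (Psmall w w1 wf); rewrite -/rho; lra.
  have [hR hI] := Re_bounds (t + ep) ((l - rc t) - rc ep * P w).
  rewrite -sE in hR hI.
  have sc : k * `|complex.Im (l + a w)| + ep / 2 <= complex.Re (l + a w).
    have h1 := ler_wpM2l k0 (le_trans hI nu).
    have h2 : rho * (1 + k) = ep / 4 by rewrite /rho -mulrA kapE; ring.
    move: (nm _) (complex.Re _) (`|complex.Im _|) nu hR h1 => y1 y2 y3 nu hR h1.
    clear -h1 h2 hR nu t0 ep0; lra.
  have se : nm (l + a w) <= e / 2 by apply: le_trans (ltW ss) et4.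
  split; last by rewrite le_max (secM _ xO xq _ se sc) orbT.
  apply: sec xO (le_lt_trans xq eh) _ (le_lt_trans se eh) _.
  apply: lt_le_trans sc; rewrite ltrDl divr_gt0//.
have secS (z : X) (t : R) (l : C) : nm (z - z0) < e1 -> 0 < t -> t <= l0 ->
    nm (l - rc t) * (1 + k) < t -> nm (l - rc t) <= rho + b ->
    Om (Phi z + l *: d).
  move=> /P1[_ xq xO] t0 tl lt lb; have lE : l = rc t + (l - rc t) by rewrite subrKC.
  have [hR hI] := Re_bounds t (l - rc t); rewrite -lE in hR hI.
  apply: sec xO (le_lt_trans xq eh) _ _ _.
    have := nm_leB l (rc t); rewrite (nm_rcp (ltW t0)).
    move: size et4; clear -lb tl e0 eta0; lra.
  have h1 := ler_wpM2l k0 hI.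
  move: (nm _) (complex.Re _) (`|complex.Im _|) lt hR h1 => y1 y2 y3 lt hR h1.
  clear -lt hR h1; lra.
exists e2, l0, M; split=> //.
  have h1 : e1 <= r0 by rewrite ge_min lexx orbT.
  have h2 : e2 <= e1 / 4 by rewrite ge_min lexx orbT.
  by apply: le_trans h2 _; apply: le_trans h1; rewrite ler_pdivrMr// ler_peMr ?(ltW e10)// ler1n.
move=> z; rewrite /nball => ze2 s s0 sl0.
have ze1 : nm (z - z0) < e1 by move: ze2; rewrite lt_min => /andP[_]; lra.
have Os : Om (Phi z + rc s *: d).
  apply: (secS z s) => //; rewrite subrr nm0 ?mul0r//.
  by rewrite addr_ge0// ltW.
split=> //.
pose g (w l : C) := F (Phi (z + w *: v) + (l + a w) *: d).
pose G (l : C) := F (Phi z + l *: d).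
apply: (@hartogs_segment _ _ g G r rho l0 M r1 rho0) => //.
- move=> t l w t0 tl lt w1; have [h1 h2] := onN z t l w ze2 t0 tl lt w1.
  by split=> //; exact: cdiff_shift_param.
- move=> l ll; split; last by rewrite /g /G scale0r addr0 a0 addr0.
  move=> w; rewrite subr0 => wr.
  have wP : nm w <= rP by exact: ltW (lt_le_trans wr rrP).
  have zw : nm (z + w *: v - z0) < e1.
    rewrite addrAC; apply: le_lt_trans (nmD _ _) _; rewrite nmZ.
    have w2 := ltW (lt_le_trans wr r2).
    have := ler_wpM2r (nm_ge0 v) w2; move: ze2 z1z0; rewrite lt_min -/v.
    by move=> /andP[_]; lra.
  have [da ha] := acd w wP.
  apply: (cdiff_fshift F_diff (a := fun w => l + a w)).
  + by apply: ghol_line Ph _; have [] := P1 _ zw.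
  + exact: isd_cdiff (isdD (@isd_cst R C^o l w) ha).
  + have aw := na w wP.
    have lE : l + a w - rc l0 = (l - rc l0) + a w by ring.
    have h : nm (l + a w - rc l0) <= rho + b.
      by rewrite lE (le_trans (nmD _ _))// lerD// ltW.
    apply: (secS _ l0) => //.
    apply: le_lt_trans (ler_wpM2r (ltW k10) h) _.
    have h2 : rho * (1 + k) = ep / 4 by rewrite /rho -mulrA kapE; ring.
    rewrite /l0 mulrDl h2; move: epb ep0; clear; lra.
(* The radius shrinks with [t], because the sector narrows towards its vertex. *)
- move=> t t0 tl; pose rs := Num.min rho (t / (2 * (1 + k))).
  have rs0 : 0 < rs by rewrite lt_min rho0 divr_gt0// mulr_gt0.
  exists rs => //; split; first by rewrite ge_min lexx.
  move=> t' tt' t'l l; rewrite lt_min => /andP[l1 l2].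
  have OG : Om (Phi z + (l + 0) *: d).
    rewrite addr0; apply: (secS z t') => //; first exact: lt_le_trans t0 tt'.
      move: l2; rewrite ltr_pdivlMr ?mulr_gt0//.
      have := mulr_ge0 (nm_ge0 (l - rc t')) (ltW k10).
      move: (nm _) => y; clear -t0 tt'; lra.
    by apply: le_trans (ltW l1) _; rewrite lerDl ltW.
  have [dd hd] := cdiff_shift_param OG.
  apply: (@isd_cdiff _ _ _ _ dd).
  apply: (isd_ext (f := fun l => F (Phi z + (l + 0) *: d)) (g := G) ltr01 _ hd).
  by move=> y _; rewrite addr0.
Qed.

End Extension.

(** * Gluing the local extensions and following the orbit *)

Section GlobalExtension.
Variables (R : realType) (n : nat).
Local Notation C := (CC R).
Local Notation X := 'rV[C]_n.+1.

Lemma econt_agree (f g : X -> X) z : econt f z -> econt g z ->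
  (forall e : R, 0 < e -> exists2 y, nm (y - z) < e & f y = g y) -> f z = g z.
Proof.
move=> fc gc fg; apply/eqP; rewrite -subr_eq0; apply/eqP/nm_eq0/eqP.
rewrite eq_le nm_ge0 andbT; apply/ler_addgt0Pr => e e0; rewrite add0r.
have e20 : 0 < e / 2 by rewrite divr_gt0.
have [r r0 fr] := fc _ e20; have [s s0 gs] := gc _ e20.
have m0 : 0 < Num.min r s by rewrite lt_min r0.
have [y] := fg _ m0; rewrite lt_min => /andP[yr ys] fgy.
apply: le_trans (nm_dist _ (f y) _) _; rewrite [leRHS]splitr lerD//.
  by rewrite nmC ltW// fr.
by rewrite fgy ltW// gs.
Qed.

Variables (Om : X -> Prop) (F : X -> X) (M0 : R).
Hypothesis Om_open : forall x, Om x ->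
  exists2 r : R, 0 < r & forall y, nm (y - x) < r -> Om y.
Hypothesis F_diff : forall x, Om x -> fdiff F x.
Hypothesis Om_bounded : forall x, adherent Om x -> nm x <= M0.
Hypothesis Om_sector : forall q, adherent Om q -> ~ Om q ->
  exists d (k e : R), [/\ 0 <= k, 0 < e & sector_at Om q d k e].

(** If [Phi z0] is in [Om], composition works. Otherwise [Psi] is the limit of F (Phi z + s d) as s
    tends to 0: it is holomorphic thanks to the uniform bound of [boundary_bound], and equals F (Phi
    z) by continuity of [F] wherever [Phi z] is in [Om]. *)
Lemma local_extension Phi z0 (r0 : R) : 0 < r0 ->
  ghol (nball z0 r0) Phi ->
  (forall z, nball z0 r0 z -> adherent Om (Phi z)) ->
  dense_preimage Om Phi z0 r0 ->
  exists (r M : R) Psi, [/\ 0 < r, r <= r0, ghol (nball z0 r) Psi,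
    forall z, nball z0 r z -> nm (Psi z) <= M &
    forall z, nball z0 r z -> Om (Phi z) -> Psi z = F (Phi z)].
Proof.
move=> r00 Ph PO Pd.
have PM z : nball z0 r0 z -> nm (Phi z) <= M0 by move=> /PO; exact: Om_bounded.
have z0z0 : nball z0 r0 z0 by rewrite /nball subrr nm0.
have Pc := ghol_econt Ph PM.
have [Oz0|nOz0] := pselect (Om (Phi z0)).
  have [s s0 sP] := F_locally_bounded Om_open F_diff Oz0.
  have [r r1 rP] := Pc z0 z0z0 _ s0.
  exists (Num.min r r0), (nm (F (Phi z0)) + 1), (F \o Phi); split=> //.
  - by rewrite lt_min r1.
  - by rewrite ge_min lexx orbT.
  - move=> z; rewrite /nball lt_min => /andP[zr zr0] v.
    apply: (@cdiff_fcomp _ _ F (fun t => Phi (z + t *: v))); first exact: Ph.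
    by rewrite scale0r addr0; apply: F_diff; have [] := sP _ (rP _ zr).
  - move=> z; rewrite /nball lt_min => /andP[zr zr0].
    by have [] := sP _ (rP _ zr).
have [d [k [e [k0 e0 sec]]]] := Om_sector (PO _ z0z0) nOz0.
have [r [l0 [M [r1 rr0 l00 bd]]]] :=
  boundary_bound Om_open F_diff Om_bounded r00 k0 e0 Ph PO Pd sec.
pose s (j : nat) : R := l0 / j.+1%:R.
have s0 j : 0 < s j by rewrite divr_gt0.
have sl j : s j <= l0 by rewrite ler_pdivrMr// ler_peMr ?(ltW l00)// ler1n.
pose u j z := F (Phi z + rc (s j) *: d).
have uM j z : nball z0 r z -> nm (u j z) <= M.
  by move=> zr; have [] := bd z zr _ (s0 j) (sl j).
have /choice[Psi PsiP] : forall z, exists y, nball z0 r z -> ucv (u^~ z) y.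
  move=> z; have [zr|nz] := pselect (nball z0 r z); last by exists 0.
  by have [y uy] := @ucv_exV _ _ (u^~ z) M (fun j => uM j z zr); exists y.
have sub z : nball z0 r z -> nball z0 r0 z by rewrite /nball => zr; exact: lt_le_trans zr rr0.
exists r, M, Psi; split=> //.
- apply: (@ulim_ghol _ _ u Psi z0 r M) => // j z zr v.
  have Oz : Om (Phi (z + 0 *: v) + rc (s j) *: d).
    by rewrite scale0r addr0; have [] := bd z zr _ (s0 j) (sl j).
  have cst : cdiff ((fun=> rc (s j)) : C -> C^o) 0.
    exact: isd_cdiff (@isd_cst R C^o (rc (s j)) 0).
  exact: (cdiff_fshift F_diff (Ph z (sub z zr) v) cst Oz).
- by move=> z zr; apply: (ucv_nm_le (PsiP z zr)) => j; exact: uM.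
move=> z zr Oz; apply: ucv_unique (PsiP z zr) _.
apply: (@ucv_econt _ _ _ F (fun j => Phi z + rc (s j) *: d) (Phi z)).
  exact/fdiff_econt/F_diff.
apply: ucv_lim => e' e'0; have nd0 : 0 < l0 * nm d + 1.
  by rewrite ltr_wpDl// mulr_ge0 ?nm_ge0// ltW.
have [N _ NP] := near_infty_natSinv_lt (PosNum (divr_gt0 e'0 nd0)).
exists N => j Nj; rewrite addrC addKr nmZ (nm_rcp (ltW (s0 j))) /s.
have := NP j Nj; rewrite /= ltr_pdivlMr// => h; apply: le_lt_trans h.
by rewrite mulrAC mulrC ler_wpM2l ?invr_ge0// lerDl.
Qed.

(** Two local extensions both equal F (Phi z) on the dense set where [Phi z] is in [Om], so by
    continuity they agree on overlaps. *)
Lemma extension Phi p (r : R) :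
  ghol (nball p r) Phi ->
  (forall z, nball p r z -> adherent Om (Phi z)) ->
  dense_preimage Om Phi p r ->
  exists2 Psi, ghol (nball p r) Psi &
    (forall z, nball p r z -> econt Psi z) /\
    forall z, nball p r z -> Om (Phi z) -> Psi z = F (Phi z).
Proof.
move=> Ph PO Pd.
have sub z y : nball z (r - nm (z - p)) y -> nball p r y.
  by rewrite /nball => h; have := nm_dist y z p; move: h; lra.
have /choice[E EP] : forall z0, exists E : R * R * (X -> X), nball p r z0 ->
    [/\ 0 < E.1.1, forall y, nball z0 E.1.1 y -> nball p r y,
      ghol (nball z0 E.1.1) E.2,
      forall z, nball z0 E.1.1 z -> nm (E.2 z) <= E.1.2 &
      forall z, nball z0 E.1.1 z -> Om (Phi z) -> E.2 z = F (Phi z)].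
  move=> z0; have [zr|nz] := pselect (nball p r z0); last by exists (0, 0, id).
  have [||||r1 [M [Psi [r10 rr hol1 bd eq1]]]] :=
      @local_extension Phi z0 (r - nm (z0 - p)).
  - by rewrite subr_gt0.
  - by move=> z /sub; exact: Ph.
  - by move=> z /sub; exact: PO.
  - by move=> z /sub; exact: Pd.
  exists (r1, M, Psi) => _; split=> // y yr; apply: (sub z0).
  exact: lt_le_trans yr rr.
have Pc := ghol_econt Ph (fun z zr => Om_bounded (PO z zr)).
have Ec z0 z : nball p r z0 -> nball z0 (E z0).1.1 z -> econt (E z0).2 z.
  by move=> /EP[_ _ h1 h2 _]; exact: ghol_econt h1 h2 z.
have self z : nball p r z -> nball z (E z).1.1 z.
  by move=> /EP[h _ _ _ _]; rewrite /nball subrr nm0.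
pose Psi z := (E z).2 z.
have agree z0 z : nball p r z0 -> nball z0 (E z0).1.1 z -> Psi z = (E z0).2 z.
  move=> z0r zz0; have [r10 s1 _ _ eq1] := EP z0 z0r.
  have zr := s1 z zz0; have [r20 s2 _ _ eq2] := EP z zr.
  apply: econt_agree (Ec z z zr (self z zr)) (Ec z0 z z0r zz0) _ => e e0.
  pose m := Num.min e (Num.min (E z).1.1 ((E z0).1.1 - nm (z - z0))).
  have m0 : 0 < m by rewrite !lt_min e0 r20 subr_gt0.
  have [y] := Pd z zr m m0; rewrite !lt_min => /and3P[ye yr1 yr2] Oy.
  exists y => //; rewrite eq1//; first by rewrite eq2.
  by rewrite /nball; have := nm_dist y z z0; move: yr2; lra.
have Psi_near z0 : nball p r z0 -> exists2 s : R, 0 < s &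
    forall y, nm (y - z0) < s -> Psi y = (E z0).2 y.
  move=> z0r; have [r10 _ _ _ _] := EP z0 z0r; exists (E z0).1.1 => // y.
  exact: agree.
exists Psi.
  move=> z zr v; have [s s0 sP] := Psi_near z zr.
  have [_ _ h1 _ _] := EP z zr; have [d hd] := h1 z (self z zr) v.
  have v0 : 0 < nm v + 1 by rewrite ltr_wpDl// nm_ge0.
  apply: (@isd_cdiff _ _ _ _ d).
  apply: (isd_ext (f := fun t => (E z).2 (z + t *: v))
    (g := fun t => Psi (z + t *: v)) (divr_gt0 s0 v0) _ hd) => h hs.
  rewrite sP// addrC addKr nmZ add0r; rewrite ltr_pdivlMr// in hs.
  by apply: le_lt_trans hs; rewrite ler_wpM2l ?nm_ge0// lerDl.
split=> z zr.
  have [s s0 sP] := Psi_near z zr => e e0.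
  have [r1 r10 r1P] := Ec z z zr (self z zr) e e0.
  exists (Num.min s r1); first by rewrite lt_min s0.
  move=> y; rewrite lt_min => /andP[ys yr]; rewrite !sP ?subrr ?nm0//.
  exact: r1P.
by move=> Oz; have [_ _ _ _ h] := EP z zr; apply: h => //; exact: self.
Qed.

Variable p : nat -> X.
Hypothesis p_in : forall k, Om (p k).
Hypothesis p_orbit : forall k, F (p k) = p k.+1.
Variable r : R.
Hypothesis p_dense : forall z, nball (p 0) r z -> forall e : R, 0 < e ->
  exists j, nm (p j - z) < e.

(** Induction on [k], extending [F \o Phi] at each step. The values are limits of orbit points,
    hence adherent to [Om], which restarts the induction and gives a bound [M0] independent of
    [k]. *)
Lemma orbit_extension k : exists Phi, [/\ ghol (nball (p 0) r) Phi,
  forall z, nball (p 0) r z -> nm (Phi z) <= M0 &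
  forall j, nball (p 0) r (p j) -> Phi (p j) = p (j + k)%N].
Proof.
have adh x : Om x -> adherent Om x by move=> Ox e e0; exists x => //; rewrite subrr nm0.
have p_dense' z : nball (p 0) r z -> forall e : R, 0 < e ->
    exists2 j, nm (p j - z) < e & nball (p 0) r (p j).
  move=> zr e e0; have m0 : 0 < Num.min e (r - nm (z - p 0)).
    by rewrite lt_min e0 subr_gt0.
  have [j] := p_dense zr m0; rewrite lt_min => /andP[je jr]; exists j => //.
  by rewrite /nball; have := nm_dist (p j) z (p 0); move: jr; lra.
have from_adh (Phi : X -> X) l : (forall z, nball (p 0) r z -> econt Phi z) ->
    (forall j, nball (p 0) r (p j) -> Phi (p j) = p (j + l)%N) ->
    forall z, nball (p 0) r z -> adherent Om (Phi z).
  move=> Pc Pp z zr e e0; have [s s0 sP] := Pc z zr e e0.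
  have [j js jr] := p_dense' z zr s s0.
  by exists (p (j + l)%N); [exact: p_in|rewrite -Pp// sP].
suff [Phi [h1 h2 h3]] : exists Phi, [/\ ghol (nball (p 0) r) Phi,
    forall z, nball (p 0) r z -> adherent Om (Phi z) &
    forall j, nball (p 0) r (p j) -> Phi (p j) = p (j + k)%N].
  by exists Phi; split=> // z /h2; exact: Om_bounded.
elim: k => [|k [Phi [Ph PO Pp]]].
  exists id; split.
  - move=> z zr v; apply: (@isd_cdiff _ _ _ _ v) => e e0; exists 1 => // h _.
    rewrite scale0r addr0 add0r (addrC z) addrK subrr nm0.
    by rewrite mulr_ge0 ?nm_ge0// ltW.
  - apply: (@from_adh id 0%N) => [z zr e e0|j _]; last by rewrite addn0.
    by exists e.
  - by move=> j _; rewrite addn0.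
have Pd : dense_preimage Om Phi (p 0) r.
  move=> z zr e e0; have [j je jr] := p_dense' z zr e e0.
  by exists (p j); rewrite ?Pp.
have [Psi Psih [Psic Psie]] := extension Ph PO Pd.
have Psip j : nball (p 0) r (p j) -> Psi (p j) = p (j + k.+1)%N.
  by move=> jr; rewrite Psie ?Pp// p_orbit addnS.
by exists Psi; split=> //; exact: from_adh Psic Psip.
Qed.

End GlobalExtension.

(** * Power maps of the orbit *)

Section PowerMaps.
Variables (R : realType) (n : nat).
Local Notation C := (CC R).
Local Notation X := 'rV[C]_n.+1.
Variables (p : nat -> X) (M r : R) (Phi : nat -> X -> X).
Hypothesis r0 : 0 < r.
Hypothesis pM : forall k, nm (p k) <= M.
Hypothesis p_dense : forall z, nball (p 0) r z -> forall e : R, 0 < e ->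
  exists j, nm (p j - z) < e.
Hypothesis Phi_hol : forall k, ghol (nball (p 0) r) (Phi k).
Hypothesis Phi_bd : forall k z, nball (p 0) r z -> nm (Phi k z) <= M.
Hypothesis Phi_p : forall k j, nball (p 0) r (p j) -> Phi k (p j) = p (j + k)%N.

Let B1 : X -> Prop := nball (p 0) (r / 4).
Let L : R := 16 * M / r.
Let L2 : R := 16 * L / r.

Let M_ge0 : 0 <= M.
Proof. exact: le_trans (nm_ge0 _) (pM 0). Qed.

Let L_ge0 : 0 <= L.
Proof. by rewrite divr_ge0 ?mulr_ge0// ltW. Qed.

Let L2_ge0 : 0 <= L2.
Proof. exact: divr_ge0 (mulr_ge0 (ler0n _ 16) L_ge0) (ltW r0). Qed.

Let B1B z : B1 z -> nball (p 0) r z.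
Proof. by rewrite /B1 /nball => h; apply: lt_le_trans h _; rewrite ler_pdivrMr// ler_peMr ?(ltW r0)// ler1n. Qed.

Lemma orbit_lip k z z' : B1 z -> B1 z' ->
  nm (Phi k z' - Phi k z) <= L * nm (z' - z).
Proof. by move=> zr z'r; exact: (ghol_lip (Phi_hol k) (Phi_bd k) zr z'r). Qed.

Lemma orbit_dense_in z (s : R) : nball (p 0) s z -> s <= r ->
  forall e : R, 0 < e -> exists2 j, nm (p j - z) < e & nball (p 0) s (p j).
Proof.
move=> zs sr e e0; have m0 : 0 < Num.min e (s - nm (z - p 0)).
  by rewrite lt_min e0 subr_gt0.
have zr : nball (p 0) r z by exact: lt_le_trans zs sr.
have [j] := p_dense zr m0; rewrite lt_min => /andP[je jr]; exists j => //.
by rewrite /nball; have := nm_dist (p j) z (p 0); move: jr; lra.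
Qed.

(** By density it suffices to take z = [p i]. There Phi (k + j) (p i) = p (i + k + j) = Phi (i + k)
    (p j): point and index exchange roles, and the Lipschitz bound of the single map Phi (i + k)
    applies. *)
Lemma orbit_shift_dist k j l z : B1 (p j) -> B1 (p l) -> nball (p 0) r z ->
  nm (Phi (k + j) z - Phi (k + l) z) <= L * nm (p j - p l).
Proof.
move=> jB lB zr; apply/ler_addgt0Pr => e e0.
have e20 : 0 < e / 2 by rewrite divr_gt0.
have [s s0 sP] := ghol_econt (Phi_hol (k + j)) (Phi_bd (k + j)) zr e20.
have [t t0 tP] := ghol_econt (Phi_hol (k + l)) (Phi_bd (k + l)) zr e20.
have m0 : 0 < Num.min s t by rewrite lt_min s0.
have [i0] := orbit_dense_in zr (lexx r) m0.
rewrite lt_min => /andP[/sP h1 /tP h2] ir.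
have h3 : nm (Phi (k + j) (p i0) - Phi (k + l) (p i0)) <= L * nm (p j - p l).
  rewrite !Phi_p// !addnA ![(i0 + k + _)%N]addnC.
  by rewrite -!Phi_p ?orbit_lip//; exact: B1B.
have -> : Phi (k + j) z - Phi (k + l) z = Phi (k + j) (p i0) - Phi (k + l) (p i0)
   + (Phi (k + l) (p i0) - Phi (k + l) z - (Phi (k + j) (p i0) - Phi (k + j) z)).
  rewrite opprB [RHS](AC (2*(2*2)) ((5*4)*((1*6)*(3*2)))) /=.
  by rewrite !subrr !addr0.
apply: le_trans (nmD _ _) _; apply: lerD => //.
by apply: le_trans (nmB _ _) _; rewrite [leRHS]splitr lerD// ltW.
Qed.

(** The difference of the two maps is holomorphic and bounded by L |p j - p l|, so its Lipschitz
    estimate carries this second small factor. *)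
Lemma orbit_increment_dist k j l z z' : B1 (p j) -> B1 (p l) -> B1 z -> B1 z' ->
  nm ((Phi (k + j) z' - Phi (k + j) z) - (Phi (k + l) z' - Phi (k + l) z)) <=
  L2 * nm (p j - p l) * nm (z' - z).
Proof.
move=> jB lB zB z'B.
pose D y := Phi (k + j) y - Phi (k + l) y.
have Dh : ghol (nball (p 0) r) D.
  by move=> y yr v; apply: cdiffB; exact: Phi_hol.
have := ghol_lip Dh (fun y yr => orbit_shift_dist k jB lB yr) zB z'B.
rewrite /D opprB [X in nm X <= _](AC (2*2) ((1*4)*(3*2))) /= => h.
rewrite opprB; apply: le_trans h _.
by rewrite le_eqVlt; apply/orP; left; apply/eqP; rewrite /L2; ring.
Qed.

(** Index of a product of [m] factors, [i] of them [l] and the others [j]. The path from [m.+1 * j]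
    to [m.+1 * l] exchanges one factor at a time while these [m] stay fixed. *)
Let expo m j l i := ((m - i) * j + i * l)%N.

Let incr m j l i := Phi (expo m j l i) (p l) - Phi (expo m j l i) (p j).

Lemma power_telescope m j l : B1 (p j) -> B1 (p l) ->
  p (m.+1 * l) - p (m.+1 * j) = \sum_(i < m.+1) incr m j l i.
Proof.
move=> jB lB; have jr := B1B jB; have lr := B1B lB.
pose a i := p ((m.+1 - i) * j + i * l)%N.
rewrite (eq_bigr (fun i : 'I_m.+1 => a i.+1 - a i)) => [|i _].
  rewrite -(big_mkord xpredT (fun i => a i.+1 - a i)) telescope_sumr//.
  by rewrite /a subnn mul0n add0n subn0 mul0n addn0.
have im : (i <= m)%N by rewrite -ltnS.
rewrite /incr /a !Phi_p// /expo subSS subSn// mulSn mulSn.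
by congr (p _ - p _); [rewrite addnCA|rewrite addnA].
Qed.

(** Consecutive increments differ by a second difference of size at most [c], so each of the [m.+1]
    increments is within [m.+1%:R * c] of the first. *)
Lemma power_increment m j l : B1 (p j) -> B1 (p l) ->
  nm (p (m.+1 * l) - p (m.+1 * j) -
      m.+1%:R *: (Phi (m * j) (p l) - Phi (m * j) (p j)))
  <= m.+1%:R ^+ 2 * L2 * nm (p l - p j) ^+ 2.
Proof.
move=> jB lB; rewrite power_telescope//.
pose c := L2 * nm (p l - p j) ^+ 2.
have c0 : 0 <= c by rewrite mulr_ge0// sqr_ge0.
have TT i : (i <= m)%N -> nm (incr m j l i - incr m j l 0) <= i%:R * c.
  elim: i => [|i IH] im; first by rewrite subrr nm0 mul0r.
  have {}IH := IH (ltnW im).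
  apply: le_trans (nm_dist _ (incr m j l i) _) _.
  rewrite -natr1 mulrDl mul1r addrC; apply: lerD => //.
  pose k' := ((m - i.+1) * j + i * l)%N.
  have -> : incr m j l i.+1 = Phi (k' + l) (p l) - Phi (k' + l) (p j).
    by rewrite /incr /expo /k' mulSn [(l + _)%N]addnC addnA.
  have -> : incr m j l i = Phi (k' + j) (p l) - Phi (k' + j) (p j).
    have e : expo m j l i = (k' + j)%N.
      by rewrite /expo /k' -(subnSK im) mulSn; lia.
    by rewrite /incr e.
  apply: le_trans (orbit_increment_dist k' lB jB jB lB) _.
  by rewrite /c expr2 mulrA.
have -> : Phi (m * j) (p l) - Phi (m * j) (p j) = incr m j l 0.
  by rewrite /incr /expo subn0 mul0n addn0.
have -> : \sum_(i < m.+1) incr m j l i - m.+1%:R *: incr m j l 0 =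
    \sum_(i < m.+1) (incr m j l i - incr m j l 0).
  by rewrite [in RHS]sumrB sumr_const card_ord scaler_nat.
apply: le_trans (nm_sum _ _ _) _.
apply: (@le_trans _ _ (\sum_(i < m.+1) m.+1%:R * c)).
  apply: ler_sum => i _; apply: le_trans (TT i _) _; first by rewrite -ltnS.
  by rewrite ler_wpM2r// ler_nat ltnW.
by rewrite sumr_const card_ord -[leLHS]mulr_natl /c expr2 !mulrA.
Qed.

(** The constant grows with [m]; this serves to identify the value of the power map at orbit points.
    The Lipschitz bound uniform in [m] comes later from [ghol_lip]. *)
Lemma power_lip m j l : B1 (p j) -> B1 (p l) ->
  nm (p (m.+1 * l) - p (m.+1 * j)) <= m.+1%:R * (L * nm (p l - p j)).
Proof.
move=> jB lB; rewrite power_telescope//.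
apply: le_trans (nm_sum _ _ _) _.
apply: (@le_trans _ _ (\sum_(i < m.+1) L * nm (p l - p j))).
  by apply: ler_sum => i _; exact: orbit_lip.
by rewrite sumr_const card_ord -[leLHS]mulr_natl.
Qed.

(* [Psi] extends [p j |-> p (m.+1 * j)]; its derivative at [z] is
   [m.+1] times that of [chi], the limit of [Phi (m * j)] as [p j] tends to
   [z]. *)
Lemma power_map m : exists Psi : X -> X,
  [/\ ghol B1 Psi, forall z, B1 z -> nm (Psi z) <= M &
      forall j, B1 (p j) -> Psi (p j) = p (m.+1 * j)].
Proof.
have r4 : r / 4 <= r by rewrite ler_pdivrMr// ler_peMr ?(ltW r0)// ler1n.
have /choice[a aP] : forall z, exists a : nat -> nat, B1 z ->
    forall k, nm (p (a k) - z) < k.+1%:R^-1 /\ B1 (p (a k)).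
  move=> z; have [zB|nz] := pselect (B1 z); last by exists (fun=> 0).
  have /choice[a aP] : forall k, exists j,
      nm (p j - z) < k.+1%:R^-1 /\ B1 (p j).
    move=> k; have [|j h1 h2] := @orbit_dense_in z (r / 4) zB r4 (k.+1%:R^-1).
      by rewrite invr_gt0.
    by exists j.
  by exists a.
have aB z k : B1 z -> B1 (p (a z k)) by move=> /aP/(_ k)[].
have acv z : B1 z -> ucv (fun k => p (a z k)) z.
  move=> zB; apply: ucv_lim => e e0.
  have [N _ NP] := near_infty_natSinv_lt (PosNum e0).
  exists N => k Nk; have [h _] := aP z zB k.
  exact: lt_trans h (NP k Nk).
have /choice[Psi PsiP] : forall z, exists y, ucv (fun k => p (m.+1 * a z k)) y.
  by move=> z; apply: (@ucv_exV _ _ _ M) => k; exact: pM.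
have PM z : nm (Psi z) <= M by apply: (ucv_nm_le (PsiP z)) => k; exact: pM.
have Pp j : B1 (p j) -> Psi (p j) = p (m.+1 * j).
  move=> jB; apply: ucv_unique (PsiP (p j)) _ => e e0.
  have K0 : 0 < m.+1%:R * L + 1 by rewrite ltr_wpDl// mulr_ge0.
  apply: filterS (acv _ jB _ (divr_gt0 e0 K0)) => k /=.
  rewrite ltr_pdivlMr// => h; apply: le_lt_trans (power_lip m jB (aB _ k jB)) _.
  by apply: le_lt_trans h; rewrite mulrA mulrC ler_wpM2l ?nm_ge0// lerDl.
exists Psi; split=> // z zB v.
have /choice[chi chiP] : forall w, exists y, nball (p 0) r w ->
    ucv (fun k => Phi (m * a z k) w) y.
  move=> w; have [wr|nw] := pselect (nball (p 0) r w); last by exists 0.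
  have [y hy] := @ucv_exV _ _ (fun k => Phi (m * a z k) w) M
    (fun k => Phi_bd _ wr).
  by exists y.
have chih : ghol (nball (p 0) r) chi.
  apply: (@ulim_ghol _ _ (fun k => Phi (m * a z k)) chi (p 0) r M).
  - by move=> k; exact: Phi_hol.
  - by move=> k w; exact: Phi_bd.
  - exact: chiP.
(* The 4 is the square of the 2 in |p (a z' k) - p (a z k)| <= 2 |z' - z|, valid for almost all [k]
   along [UU]. *)
pose K := m.+1%:R ^+ 2 * L2 * 4.
have mL2 : 0 <= m.+1%:R ^+ 2 * L2 by rewrite mulr_ge0// exprn_ge0.
have K0 : 0 <= K by exact: mulr_ge0.
have key z' : B1 z' ->
    nm (Psi z' - Psi z - m.+1%:R *: (chi z' - chi z)) <= K * nm (z' - z) ^+ 2.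
  move=> z'B; have [->|zz] := eqVneq z' z.
    by rewrite !subrr scaler0 subrr nm0 expr0n mulr0.
  have d0 : 0 < nm (z' - z) by rewrite nm_gt0// subr_eq0.
  have lim y : B1 y -> ucv (fun k => Phi (m * a z k) (p (a y k))) (chi y).
    move=> yB; rewrite -[chi y](subrK (chi y)) subrr.
    have h : ucv (fun k => Phi (m * a z k) (p (a y k)) - Phi (m * a z k) y) 0.
      move=> e e0; have K1 : 0 < L + 1 by rewrite ltr_wpDl.
      apply: filterS (acv _ yB _ (divr_gt0 e0 K1)) => k /=.
      rewrite ltr_pdivlMr// subr0 => h.
      apply: le_lt_trans (orbit_lip _ yB (aB _ k yB)) _; apply: le_lt_trans h.
      by rewrite mulrC ler_wpM2l ?nm_ge0// lerDl.
    apply: ucv_ext (ucvD h (chiP y (B1B yB))).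
    by apply: filterE => k /=; rewrite subrK.
  have lim2 := ucvB (ucvB (PsiP z') (PsiP z))
    (ucvZ m.+1%:R (ucvB (lim z' z'B) (lim z zB))).
  rewrite -[X in nm X]subr0; apply: (ucv_le lim2).
  have d20 : 0 < nm (z' - z) / 2 by rewrite divr_gt0.
  apply: filterS (filterI (acv _ z'B _ d20) (acv _ zB _ d20)) => k /= [h1 h2].
  rewrite subr0; apply: le_trans (power_increment m (aB _ k zB) (aB _ k z'B)) _.
  rewrite /K -[X in _ <= X]mulrA; apply: ler_wpM2l => //.
  have -> : 4 * nm (z' - z) ^+ 2 = (2 * nm (z' - z)) ^+ 2.
    by rewrite exprMn -natrX.
  rewrite ler_pXn2r ?nnegrE ?mulr_ge0 ?nm_ge0//.
  apply: le_trans (nm_dist _ z' _) _.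
  apply: le_trans (lerD (lexx _) (nm_dist _ z _)) _.
  rewrite (nmC z (p _)); move: h1 h2.
  move: (nm _) (nm _) (nm _) => x1 x2 x3; lra.
have [d hd] := chih z (B1B zB) v.
pose N1 : R := m.+1%:R.
have N10 : 0 < N1 by rewrite ltr0n.
apply: (@isd_cdiff _ _ _ _ (m.+1%:R *: d)) => e e0.
have [s s0 sP] := hd _ (divr_gt0 e0 (mulr_gt0 (ltr0n R 2) N10)).
have V0 : 0 < nm v + 1 by rewrite ltr_wpDl ?nm_ge0.
pose A := K * nm v ^+ 2 * 2 + 1.
have A0 : 0 < A by rewrite ltr_wpDl// mulr_ge0// mulr_ge0// exprn_ge0// nm_ge0.
pose t := r / 4 - nm (z - p 0); have t0 : 0 < t by rewrite subr_gt0.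
exists (Num.min s (Num.min (t / (nm v + 1)) (e / A))).
  by rewrite !lt_min s0 !divr_gt0.
move=> h; rewrite !lt_min => /and3P[hs ht he].
have zhz : z + h *: v - z = h *: v by rewrite addrC addKr.
have zhB : B1 (z + h *: v).
  rewrite /B1 /nball; apply: le_lt_trans (nm_dist _ z _) _; rewrite zhz nmZ.
  rewrite ltr_pdivlMr// in ht.
  have vv : nm v <= nm v + 1 by rewrite lerDl.
  have := le_lt_trans (ler_wpM2l (nm_ge0 h) vv) ht.
  by rewrite /t ltrBrDr.
have k1 := key _ zhB; rewrite zhz nmZ in k1.
have k2 := sP h hs; rewrite add0r scale0r addr0 in k2.
rewrite add0r scale0r addr0.
have -> : Psi (z + h *: v) - Psi z - h *: (m.+1%:R *: d) =
    (Psi (z + h *: v) - Psi z - m.+1%:R *: (chi (z + h *: v) - chi z)) +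
    m.+1%:R *: (chi (z + h *: v) - chi z - h *: d).
  move: (Psi _ - Psi z) (chi _ - chi z) => y1 y2.
  by rewrite scalerBr addrA subrK !scalerA [h * _]mulrC.
apply: le_trans (nmD _ _) _; rewrite [e in leRHS]splitr mulrDl; apply: lerD.
  apply: le_trans k1 _; rewrite exprMn [nm h ^+ 2]expr2.
  have -> : K * (nm h * nm h * nm v ^+ 2) = (nm h * (K * nm v ^+ 2)) * nm h by ring.
  apply: ler_wpM2r; first exact: nm_ge0.
  rewrite ler_pdivlMr// -mulrA; rewrite ltr_pdivlMr// in he.
  by apply: le_trans (ltW he); rewrite ler_wpM2l ?nm_ge0// lerDl.
rewrite nmZ (nm_nat R m.+1) -/N1; apply: le_trans (ler_wpM2l (ltW N10) k2) _.
by rewrite le_eqVlt; apply/orP; left; apply/eqP; field; rewrite gt_eqF.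
Qed.

(** The power map has values bounded by [M], so near [p 0] its Lipschitz constant is [L3] whatever
    [m]. Yet by [power_increment] at j = 0 it multiplies p l - p 0 by m.+1 up to a quadratic
    error. *)
Lemma no_dense_orbit_family : False.
Proof.
pose s := r / 16; have s0 : 0 < s by rewrite divr_gt0.
have s4 : s = r / 4 / 4 by rewrite /s; field.
pose L3 := 16 * M / (r / 4).
(* This gives [L3 + 1 < m.+1]; the extra 1 absorbs the quadratic error, as [N2 * dl <= 1]. *)
pose m := (Num.truncn L3).+1.
have mL : L3 + 1 < m.+1%:R.
  by rewrite -natr1 ltrD2r truncnS_gt.
pose N2 := m.+1%:R ^+ 2 * L2.
have N20 : 0 <= N2 by rewrite mulr_ge0// exprn_ge0.
pose t := Num.min s (1 / (N2 + 1)).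
have t0 : 0 < t by rewrite lt_min s0 divr_gt0// ltr_wpDl.
pose v : X := const_mx 1.
have v0 : 0 < nm v.
  rewrite nm_gt0//; apply/eqP => /matrixP/(_ 0 0)/eqP.
  by rewrite !mxE oner_eq0.
(* An orbit point within [t / 4] of this auxiliary point differs from [p 0] and is closer than [t]
   to it. *)
pose z := p 0 + rc (t / 2 / nm v) *: v.
have zp : nm (z - p 0) = t / 2.
  rewrite /z addrC addKr nmZ nm_rcp ?divfK ?gt_eqF//.
  by rewrite !divr_ge0// ltW.
have s_r : s <= r by rewrite /s ler_pdivrMr// ler_peMr ?(ltW r0)// ler1n.
have ts : t <= s by rewrite ge_min lexx.
have zs : nball (p 0) s z.
  by rewrite /nball zp; apply: lt_le_trans ts; rewrite ltr_pdivrMr// ltr_pMr// ltr1n.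
have [l lz ls] := orbit_dense_in zs s_r (divr_gt0 t0 (ltr0n R 4)).
pose dl := nm (p l - p 0).
have dl0 : 0 < dl.
  have := nm_dist z (p l) (p 0); rewrite zp (nmC z) /dl.
  by move: lz; move: (nm _) (nm _) => x1 x2; lra.
have dlt : dl < t.
  have := nm_dist (p l) z (p 0); rewrite zp -/dl.
  by move: lz; move: (nm _) => x1; lra.
have sub y : nball (p 0) s y -> B1 y.
  rewrite /B1 /nball => h; apply: lt_trans h _; rewrite s4.
  by rewrite ltr_pdivrMr// ltr_pMr ?divr_gt0// ltr1n.
have pp : nball (p 0) s (p 0) by rewrite /nball subrr nm0.
have lB := sub _ ls; have pB := sub _ pp.
have [Psi [Ph PM PP]] := power_map m.
have lip : nm (p (m.+1 * l) - p 0) <= L3 * dl.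
  have h := ghol_lip Ph PM; rewrite -s4 in h.
  by have := h _ _ pp ls; rewrite !PP// muln0.
have := power_increment m pB lB; rewrite !muln0 !Phi_p ?addn0; [|exact: B1B|exact: B1B].
rewrite -/dl -/N2 => inc.
have h1 : m.+1%:R * dl <= L3 * dl + N2 * dl ^+ 2.
  have -> : m.+1%:R * dl = nm (m.+1%:R *: (p l - p 0)).
    by rewrite nmZ (nm_nat R m.+1).
  apply: le_trans (nm_leB _ (p (m.+1 * l) - p 0)) _; rewrite nmC.
  exact: lerD.
have h2 : N2 * dl <= 1.
  have : dl <= 1 / (N2 + 1) by apply: le_trans (ltW dlt) _; rewrite ge_min lexx orbT.
  rewrite ler_pdivlMr ?ltr_wpDl// => h; apply: le_trans h.
  by rewrite mulrC ler_wpM2l ?(ltW dl0)// lerDl.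
have h3 : m.+1%:R * dl <= (L3 + 1) * dl.
  apply: le_trans h1 _; rewrite mulrDl mul1r lerD2l expr2 mulrA.
  by rewrite ler_piMl// ltW.
rewrite ler_pM2r// in h3.
by have := le_lt_trans h3 mL; rewrite ltxx.
Qed.

End PowerMaps.

(** * Sectors at Lipschitz boundary points *)

Section Interface.
Variables (R : realType) (n : nat).
Local Notation C := (CC R).
Local Notation X := 'rV[C]_n.+1.
Implicit Types (x y z w : X).

Lemma closure_adherent (A : set X) x : closure A x <-> adherent A x.
Proof.
split=> [clA e e0|xA B /nbhs_nm[e e0 eB]].
  have [|y [Ay yx]] := clA (fun y => nm (y - x) < e); last by exists y.
  by apply/nbhs_nm; exists e.
by have [y Ay yx] := xA e e0; exists y; split=> //; exact: eB.
Qed.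

Lemma open_nm (A : set X) x : open A -> A x ->
  exists2 r : R, 0 < r & forall y, nm (y - x) < r -> A y.
Proof. by move=> oA Ax; apply/nbhs_nm; exact: open_nbhs_nbhs. Qed.

Lemma compact_nm_bounded (A : set X) : compact A ->
  exists M : R, forall x, A x -> nm x <= M.
Proof.
move=> cA; apply: contrapT => none.
have /choice[u uP] : forall k : nat, exists x, A x /\ k%:R < nm x.
  move=> k; apply: contrapT => /forallNP nk; apply: none.
  exists k%:R => x Ax; rewrite leNgt; apply/negP => h; exact: (nk x).
have [l _ ul] := compact_UU cA (fun k => (uP k).1).
have h1 : UU (u @^-1` [set y | nm (y - l) < 1]).
  by apply: ul; apply/nbhs_nm; exists 1.
have [N NP] : exists N : nat, nm l + 1 < N%:R.
  by exists (Num.truncn (nm l + 1)).+1; rewrite truncnS_gt.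
have h2 : UU [set k | (N <= k)%N] by exact: (@UU_eventually _ N).
have [k /= [k1 k2]] := filter_ex (filterI h1 h2).
have [_] := uP k; apply/negP; rewrite -leNgt.
apply: le_trans (nm_leB _ l) _; apply: (@le_trans _ _ (nm l + 1)).
  by rewrite lerD2l ltW.
by apply: le_trans (ltW NP) _; rewrite ler_nat.
Qed.

Lemma differentiable_fdiff (F : X -> X) x : differentiable F x -> fdiff F x.
Proof.
move=> dF; exists ('d F x); split.
- by move=> u v; exact: linearD.
- by move=> c v; exact: linearZ.
- have /(_ 0 [set y | nm (y - 'd F x 0) < 1]) := diff_continuous dF.
  have nb : nbhs ('d F x 0) [set y | nm (y - 'd F x 0) < 1].
    by apply/nbhs_nm; exists 1.
  move=> /(_ nb) /nbhs_nm[r r0 rP].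
  exists (2 / r) => [|v]; first by rewrite divr_ge0// ltW.
  have [->|v0] := eqVneq v 0; first by rewrite linear0 !nm0 mulr0.
  have nv : 0 < nm v by exact: nm_gt0.
  have t0 : 0 < r / 2 / nm v by rewrite !divr_gt0.
  have := rP (rc (r / 2 / nm v) *: v); rewrite subr0 nmZ (nm_rcp (ltW t0)).
  rewrite divfK ?gt_eqF// ltr_pdivrMr// ltr_pMr// ltr1n => /(_ isT) /=.
  rewrite linear0 subr0 linearZ /= nmZ (nm_rcp (ltW t0)) => h.
  rewrite -[2 / r]invf_div -ler_pdivrMl ?invr_gt0 ?divr_gt0// invrK.
  by move: h; rewrite mulrAC ltr_pdivrMr// mul1r => /ltW.
move=> e e0; have := diff_locallyx dF => dE.
have /eqaddoP/(_ (rc e)) : (fun h => F (h + x)) =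
    (fun h => F x + 'd F x h) +o_ (0 : X) (fun h : X => h).
  by apply/funext => h; exact: dE.
rewrite -rc0 rc_lt e0 => /(_ isT) /nbhs_nm[r r0 rP].
exists r => // h hr; have := rP h; rewrite subr0 => /(_ hr) /=.
rewrite !normE -rcM rc_le => h1; apply: le_trans h1.
by rewrite (addrC x h) -addrA -opprD.
Qed.

Lemma nm_mulmx (v : X) (U : 'M[C]_n.+1) :
  nm (v *m U) <= nm v * \sum_i \sum_j nm (U j i).
Proof.
have [i ->] := nm_row (v *m U); rewrite mxE.
apply: le_trans (nm_sum _ _ _) _.
apply: (@le_trans _ _ (\sum_j nm v * nm (U j i))).
  by apply: ler_sum => j _; rewrite nmM ler_wpM2r ?nm_ge0// nm_coord.
rewrite -mulr_sumr ler_wpM2l ?nm_ge0// [leRHS](bigD1 i)//= lerDl.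
by apply: sumr_ge0 => k _; apply: sumr_ge0 => j _; exact: nm_ge0.
Qed.

Lemma eucl_dist_nm (w w' : X) :
  eucl_dist (graph_coord w) (graph_coord w') <= n.+1%:R * nm (w - w').
Proof.
rewrite -[leRHS]ger0_norm ?mulr_ge0 ?nm_ge0// -sqrtr_sqr /eucl_dist /=.
apply: ler_wsqrtr; set y := nm (w - w').
have ReB (a b : C) : complex.Re a - complex.Re b = complex.Re (a - b).
  by case: a => ? ?; case: b.
apply: (@le_trans _ _ (\sum_(j < n) y ^+ 2 + y ^+ 2)).
  apply: lerD.
    apply: ler_sum => j _; rewrite !mxE -nm_sqr.
    rewrite ler_pXn2r ?nnegrE ?nm_ge0//.
    by have := nm_coord (w - w') (lift ord_max j); rewrite !mxE.
  rewrite ReB -[leLHS]real_normK ?num_real// ler_pXn2r ?nnegrE ?nm_ge0//.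
  apply: le_trans (nm_Re _) _.
  by have := nm_coord (w - w') ord_max; rewrite !mxE.
rewrite sumr_const card_ord -mulrSr -[leLHS]mulr_natl exprMn.
by rewrite ler_wpM2r ?sqr_ge0// expr2 ler_peMl// ler1n.
Qed.

(** In the coordinates [w], adding s d adds -i s to the last coordinate only: its imaginary part
    drops by Re s, and its real part moves by Im s, which changes the graph function by at most k
    |Im s|. *)
Lemma lipschitz_sector (Om : set X) q : open Om -> lipschitz_boundary Om ->
  adherent Om q -> ~ Om q ->
  exists d (k e : R), [/\ 0 <= k, 0 < e & sector_at Om q d k e].
Proof.
move=> oOm lip qO nOq.
have bq : boundary Om q.
  split; first exact/closure_adherent.
  by move=> /interior_subset.
have [U [b [rr [Cst [Uu rlip /nbhs_nm[e1 e10 e1P]]]]]] := lip q bq.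
have Uunit := unitarymx_unit Uu.
pose w x := x *m U + b.
pose u : X := delta_mx 0 ord_max.
pose I : C := Complex 0 1.
pose d : X := - I *: (u *m invmx U).
pose k : R := `|Cst|; have k0 : 0 <= k by exact: normr_ge0.
have wshift x (s : C) : w (x + s *: d) = w x + (- (I * s)) *: u.
  rewrite /w mulmxDl -addrA [_ + b]addrC addrA; congr (_ + _).
  rewrite /d scalerA -scalemxAl mulmxKV//; congr (_ *: _).
  by rewrite mulrN mulrC.
have rk c c' : `|rr c - rr c'| <= k * eucl_dist c c'.
  by apply: le_trans (rlip c c') _; rewrite ler_wpM2r ?sqrtr_ge0// ler_norm.
have nd0 : 0 < nm d + 1 by rewrite ltr_wpDl ?nm_ge0.
pose e := Num.min (e1 / 2) (e1 / 2 / (nm d + 1)).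
have e0 : 0 < e by rewrite lt_min !divr_gt0.
have [ee1 ee2] : e <= e1 / 2 /\ e <= e1 / 2 / (nm d + 1).
  by rewrite !ge_min !lexx orbT.
exists d, k, e; split=> // x xO xq s se hs.
have xs1 : nm (x + s *: d - q) < e1.
  rewrite addrAC; apply: le_lt_trans (nmD _ _) _; rewrite [ltRHS]splitr.
  apply: ltrD; first exact: lt_le_trans xq ee1.
  have := lt_le_trans se ee2; rewrite ltr_pdivlMr// => h.
  by rewrite nmZ; apply: le_lt_trans h; rewrite ler_wpM2l ?nm_ge0// lerDl.
(* Adherent points satisfy the weak inequality by continuity; the strict one is regained from k |Im
   s| < Re s. *)
have wle : complex.Im (w x 0 ord_max) <= rr (graph_coord (w x)).
  pose K := \sum_i \sum_j nm (U j i).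
  have K0 : 0 <= K.
    by apply: sumr_ge0 => ? _; apply: sumr_ge0 => ? _; exact: nm_ge0.
  pose A := K + k * (n.+1%:R * K) + 1.
  have A0 : 0 < A by rewrite ltr_wpDl// addr_ge0// !mulr_ge0.
  apply/ler_addgt0Pr => g g0.
  have m0 : 0 < Num.min (e1 / 2) (g / A) by rewrite lt_min !divr_gt0.
  have [y Oy] := xO _ m0; rewrite lt_min => /andP[y1].
  rewrite ltr_pdivlMr// => y2.
  have yq : nm (y - q) < e1.
    apply: le_lt_trans (nm_dist _ x _) _; rewrite [ltRHS]splitr.
    apply: ltrD; first exact: y1.
    exact: lt_le_trans xq ee1.
  have hy : complex.Im (w y 0 ord_max) < rr (graph_coord (w y)).
    exact: (e1P y yq).1 Oy.
  have wxy : nm (w x - w y) <= nm (y - x) * K.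
    have -> : w x - w y = (x - y) *m U.
      by rewrite /w opprD addrACA subrr addr0 mulmxBl.
    by rewrite (nmC y); exact: nm_mulmx.
  have h1 : complex.Im (w x 0 ord_max) - complex.Im (w y 0 ord_max) <=
      nm (y - x) * K.
    apply: le_trans wxy; apply: le_trans (nm_coord _ ord_max).
    have -> : (w x - w y) 0 ord_max = w x 0 ord_max - w y 0 ord_max by rewrite !mxE.
    apply: le_trans (nm_Im _); apply: le_trans (ler_norm _).
    by case: (w x 0 ord_max) => ? ?; case: (w y 0 ord_max).
  have h2 : rr (graph_coord (w y)) - rr (graph_coord (w x)) <=
      k * (n.+1%:R * (nm (y - x) * K)).
    apply: le_trans (ler_norm _) _; apply: le_trans (rk _ _) _.
    apply: ler_wpM2l => //; apply: le_trans (eucl_dist_nm _ _) _.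
    by apply: ler_wpM2l; [exact: ler0n|rewrite nmC; exact: wxy].
  have h3 : nm (y - x) * K + k * (n.+1%:R * (nm (y - x) * K)) <= g.
    apply: le_trans (ltW y2); rewrite /A !mulrDr mulr1 -[leLHS]addr0.
    apply: lerD; last exact: nm_ge0.
    by rewrite lerD2l le_eqVlt; apply/orP; left; apply/eqP; ring.
  move: (complex.Im _) (complex.Im _) (rr _) (rr _) hy h1 h2 h3.
  by move=> a1 a2 a3 a4; lra.
apply/(e1P _ xs1); rewrite -/(w _) wshift.
have wlast (c : C) : (w x + c *: u) ord0 ord_max = w x ord0 ord_max + c.
  by rewrite mxE; congr (_ + _); rewrite !mxE !eqxx mulr1.
have Imd : complex.Im ((w x + (- (I * s)) *: u) ord0 ord_max) =
    complex.Im (w x 0 ord_max) - complex.Re s.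
  rewrite wlast; case: (w x 0 ord_max) => a1 a2.
  by rewrite /I; case: s {xs1 se hs} => s1 s2 /=; ring.
have gd : eucl_dist (graph_coord (w x)) (graph_coord (w x + (- (I * s)) *: u)) =
    `|complex.Im s|.
  rewrite /eucl_dist /= big1 ?add0r => [|j _].
    rewrite sqrtr_sqr -normrN opprB wlast.
    congr (`|_|); case: (w x 0 ord_max) => a1 a2.
    by rewrite /I; case: s {xs1 se hs Imd} => s1 s2 /=; ring.
  rewrite !mxE (_ : (lift ord_max j == ord_max) = false); last first.
    by apply/negbTE; rewrite eq_sym neq_lift.
  by rewrite andbF mulr0 addr0 subrr /= expr0n addr0.
rewrite Imd; have := rk (graph_coord (w x)) (graph_coord (w x + (- (I * s)) *: u)).
rewrite gd => h; have := le_trans (ler_norm _) h.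
move: hs wle; set y1 := complex.Im _; set y2 := k * _; set y3 := complex.Re s.
by move: (rr _) (rr _) y1 y2 y3 {h} => z1 z2 y1 y2 y3; lra.
Qed.

End Interface.

Theorem theorem1p1 (R : realType) (n : nat)
    (Omega V : set 'rV[CC R]_n.+1)
    (F : 'rV[CC R]_n.+1 -> 'rV[CC R]_n.+1) :
  domain Omega -> precompact Omega -> lipschitz_boundary Omega ->
  holomorphic_on Omega F ->
  open V -> V `<=` Omega -> V !=set0 ->
  ~ has_dense_orbit Omega F V.
Proof.
move=> [oO _]; rewrite precompactE => cO lipO holF oV VO [v0 Vv0].
move=> [p [pO Fp pdense]].
have exV : exists j, `[< V (p j) >].
  have [|y [[[j _ <-] Vj] _]] := pdense v0 Vv0 setT; first exact: filterT.
  by exists j; apply/asboolP.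
(* With [a] the first visit to [V], every orbit point in the ball around [p a] has index at least
   [a], so the tail [p'] is still dense there. *)
pose a := ex_minn exV.
have [Va amin] : V (p a) /\ forall j, V (p j) -> (a <= j)%N.
  rewrite /a; case: ex_minnP => m /asboolP Vm mmin; split=> // j Vj.
  by apply: mmin; apply/asboolP.
have [r r0 rV] := open_nm oV Va.
pose p' j := p (a + j)%N.
have p'0 : p' 0%N = p a by rewrite /p' addn0.
have [M MP] := compact_nm_bounded cO.
have bdO x : adherent Omega x -> nm x <= M by move=> /closure_adherent; exact: MP.
have opO x : Omega x -> exists2 s : R, 0 < s & forall y, nm (y - x) < s -> Omega y.
  exact: open_nm.
have dF x : Omega x -> fdiff F x by move=> /holF; exact: differentiable_fdiff.
have p'O k : Omega (p' k) by exact: pO.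
have Fp' k : F (p' k) = p' k.+1 by rewrite /p' Fp addnS.
have p'dense z : nball (p' 0%N) r z -> forall e : R, 0 < e -> exists j, nm (p' j - z) < e.
  rewrite /nball p'0 => /rV Vz e e0.
  have [_ [[j _ <-] Vj] jz] := (closure_adherent _ z).1 (pdense z Vz) e e0.
  by exists (j - a)%N; rewrite /p' subnKC// amin.
have /choice[Phi PhiP] :=
  orbit_extension opO dF bdO (fun q => @lipschitz_sector R n Omega q oO lipO)
    p'O Fp' p'dense.
apply: (@no_dense_orbit_family R n p' M r Phi r0) => //.
- by move=> k; apply: bdO => e e0; exists (p' k); rewrite ?subrr ?nm0.
- by move=> k; have [] := PhiP k.
- by move=> k; have [] := PhiP k.
- by move=> k; have [] := PhiP k.
Qed.
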